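(* For every integer $\ell>0$, there is a short exact sequence of $k\mathbf{FS}^0\otimes k\mathbf{FB}^{\mathrm{op}}$-modules $$0\to k\mathbf{FS}^{\ell/(\ell-1)}\xrightarrow{\ \theta^\ell\ } k\mathbf{FS}^0\odot_{\mathbf{FB}^{\mathrm{op}}}\mathsf{triv}_\ell\to\bigoplus_{a\in\mathbb N}\mathsf{sgn}_a\boxtimes S_{(\ell,1^a)}\to 0,$$ where the cokernel is a $k\mathbf{FS}^0\otimes k\mathbf{FB}^{\mathrm{op}}$-module by restriction of its $k\mathbf{FB}\otimes k\mathbf{FB}^{\mathrm{op}}$-module structure along the augmentation $k\mathbf{FS}^0\subset k\mathbf{FS}\twoheadrightarrow k\mathbf{FB}$ (tensored with $k\mathbf{FB}^{\mathrm{op}}$).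
   Context: $k$ is a field of characteristic zero; $\mathbb N=\{0,1,2,\dots\}$. $\mathbf{FS}$, $\mathbf{FI}$, $\mathbf{FB}$ are the categories of finite sets with, respectively, surjections, injections, bijections. For a category $\mathcal C$, $k\mathcal C$ is its $k$-linearization, with basis elements $[f]$. A module over a $k$-linear category $\mathcal A$ is a $k$-linear functor from $\mathcal A$ to $k$-vector spaces; $\mathcal A\otimes\mathcal B$ has as objects pairs of objects and as morphism spaces the tensor products of morphism spaces. For a finite set $X$, $k\mathbf{FS}(-,X)$ is a $k\mathbf{FI}^{\mathrm{op}}$-module: for an injection $i:V\hookrightarrow U$ and a surjection $f:U\twoheadrightarrow X$, $i^*[f]=[f\circ i]$ if $f\circ i$ is surjective and $0$ otherwise. For an integer $t\ge -1$, $k\mathbf{FS}^t(U,X)\subseteq k\mathbf{FS}(U,X)$ is the subspace of $x$ such that $i^*x=0$ for all injections $i:V\hookrightarrow U$ with $|U|-|V|=t+1$ (all of $k\mathbf{FS}(U,X)$ if $|U|\le t$). These form an increasing filtration; $k\mathbf{FS}^{\ell/(\ell-1)}:=k\mathbf{FS}^\ell/k\mathbf{FS}^{\ell-1}$. $k\mathbf{FS}^0$ is a wide $k$-linear subcategory of $k\mathbf{FS}$, and each $k\mathbf{FS}^\ell$ is a $k\mathbf{FS}^0\otimes k\mathbf{FI}^{\mathrm{op}}$-module (hence a $k\mathbf{FS}^0\otimes k\mathbf{FB}^{\mathrm{op}}$-module): $k\mathbf{FS}^0$ acts by postcomposition in the variable $X$, and $k\mathbf{FI}^{\mathrm{op}}$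 acts by restriction in the variable $U$. The augmentation $k\mathbf{FS}\to k\mathbf{FB}$ is the identity on objects and sends non-bijective maps to zero. Day convolution of $k\mathbf{FB}^{\mathrm{op}}$-modules: $(M\odot_{\mathbf{FB}^{\mathrm{op}}}N)(S)=\bigoplus_{S=S_1\amalg S_2}M(S_1)\otimes N(S_2)$, over ordered decompositions of $S$ into two subsets. $\mathsf{triv}_\ell$ is the trivial representation of the symmetric group $\mathfrak S_\ell$, considered as a $k\mathbf{FB}^{\mathrm{op}}$-module supported on sets of cardinality $\ell$. $k\mathbf{FS}^0\odot_{\mathbf{FB}^{\mathrm{op}}}\mathsf{triv}_\ell$ has value $\big(k\mathbf{FS}^0(-,X)\odot_{\mathbf{FB}^{\mathrm{op}}}\mathsf{triv}_\ell\big)(U)=\bigoplus_{S\subseteq U,\ |U\setminus S|=\ell}k\mathbf{FS}^0(S,X)$ at $(U,X)$, with $k\mathbf{FS}^0$ acting by naturality in $X$ (postcomposition). The map $\theta^\ell$ is induced by the $k\mathbf{FI}^{\mathrm{op}}$-module structure: the morphism $k\mathbf{FS}^\ell(U,X)\to\hom_{k\mathrm{Aut}(V)^{\mathrm{op}}}(k\mathbf{FI}(V,U),k\mathbf{FS}^0(V,X))$, $x\mapsto([i]\mapsto i^*x)$, where $|V|=|U|-\ell$ (the target being zero if $|U|<\ell$), has kernel $k\mathbf{FS}^{\ell-1}(U,X)$; its codomain is identified with $(k\mathbf{FS}^0(-,X)\odot_{\mathbf{FB}^{\mathrm{op}}}\mathsf{triv}_\ell)(U)$. Under this identification $\theta^\ell$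 sends the class of $x$ to the family $(i_S^*x)_S$ with $i_S:S\hookrightarrow U$ the inclusion. $\mathsf{sgn}_a$ is the sign representation of $\mathfrak S_a$, considered as a $k\mathbf{FB}$-module supported on sets of cardinality $a$; $S_{(\ell,1^a)}$ is the simple representation of $\mathfrak S_{\ell+a}$ indexed by the partition $(\ell,1^a)$ (with the convention that $S_{(b)}$ is the trivial representation of $\mathfrak S_b$), considered as a $k\mathbf{FB}^{\mathrm{op}}$-module supported on sets of cardinality $\ell+a$ (using $\mathbf{FB}\cong\mathbf{FB}^{\mathrm{op}}$). $\boxtimes$ is the external tensor product. *)

(* Defs.v *)
From HB Require Import structures.
From mathcomp Require Import all_boot all_order all_fingroup all_algebra.
From mathcomp Require Import boolp.

Set Implicit Arguments.
Unset Strict Implicit.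
Unset Printing Implicit Defensive.

Import GRing.Theory VectorInternalTheory.
Local Open Scope ring_scope.
Local Open Scope quotient_scope.

Section LinearProps.
Variables (k : fieldType) (V W : lmodType k) (F : V -> W).
Hypothesis linF : linear F.

Lemma lin0 : F 0 = 0.
Proof.
have := linF (-1) 0 0.
by rewrite scaler0 addr0 scaleN1r addNr.
Qed.

Lemma linD u v : F (u + v) = F u + F v.
Proof. by have := linF 1 u v; rewrite !scale1r. Qed.

Lemma linZ a v : F (a *: v) = a *: F v.
Proof. by have := linF a v 0; rewrite !addr0 lin0 addr0. Qed.

Lemma linB u v : F (u - v) = F u - F v.
Proof. by rewrite linD -scaleN1r linZ scaleN1r. Qed.

Lemma lin_sumZ (I : Type) (r : seq I) (P : pred I) (a : I -> k) (v : I -> V) :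
  F (\sum_(i <- r | P i) a i *: v i) = \sum_(i <- r | P i) a i *: F (v i).
Proof.
elim/big_rec2: _ => [|i y x _ <-]; first exact: lin0.
by rewrite linF.
Qed.

End LinearProps.

Section FreeModule.
Variables (k : fieldType) (H : finType).

Definition free_mod := {ffun H -> k^o}.

Definition bas (h : H) : free_mod := [ffun g => (g == h)%:R].

(* The linear map sending the basis vector [bas h] to [F h]. *)
Definition lext (V : lmodType k) (F : H -> V) (x : free_mod) : V :=
  \sum_h x h *: F h.

Lemma lext_linear (V : lmodType k) (F : H -> V) : linear (lext F).
Proof.
move=> a x y; rewrite /lext scaler_sumr -big_split; apply: eq_bigr => h _ /=.
by rewrite !ffunE scalerDl scalerA.
Qed.

Lemma lext_bas (V : lmodType k) (F : H -> V) h : lext F (bas h) = F h.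
Proof.
rewrite /lext (bigD1 h) //= big1 => [|g /negPf ng]; last by rewrite ffunE ng scale0r.
by rewrite ffunE eqxx scale1r addr0.
Qed.

Lemma free_modE (x : free_mod) : x = lext bas x.
Proof.
apply/ffunP => h; rewrite /lext sum_ffunE (bigD1 h) //= big1 => [|g ng].
  by rewrite !ffunE eqxx addr0 /GRing.scale /= mulr1.
by rewrite !ffunE eq_sym (negPf ng) scaler0.
Qed.

Lemma lextE (V : lmodType k) (F : free_mod -> V) :
  linear F -> forall x, F x = lext (F \o bas) x.
Proof. by move=> linF x; rewrite [in LHS](free_modE x) /lext lin_sumZ. Qed.

Lemma lin_ext (V : lmodType k) (F G : free_mod -> V) : linear F -> linear G ->
  (forall h, F (bas h) = G (bas h)) -> forall x, F x = G x.
Proof.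
move=> linF linG e x; rewrite (lextE linF) (lextE linG).
by apply: eq_bigr => h _ /=; rewrite e.
Qed.

Lemma eq_lext (V : lmodType k) (F G : H -> V) : F =1 G -> lext F =1 lext G.
Proof. by move=> e x; apply: eq_bigr => h _; rewrite e. Qed.

Lemma lin_lext (V W : lmodType k) (G : V -> W) (F : H -> V) : linear G ->
  forall x, G (lext F x) = lext (G \o F) x.
Proof. by move=> linG x; rewrite /lext lin_sumZ. Qed.

Lemma lext_linear2 (V W : lmodType k) (F : H -> V -> W) :
  (forall h, linear (F h)) -> forall x, linear (fun v => lext (F^~ v) x).
Proof.
move=> linF x a u v; rewrite /lext scaler_sumr -big_split; apply: eq_bigr => h _ /=.
by rewrite linF scalerDr !scalerA mulrC.
Qed.

End FreeModule.

Lemma linear_comp (k : fieldType) (U V W : lmodType k) (G : V -> W) (F : U -> V) :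
  linear G -> linear F -> linear (fun x => G (F x)).
Proof. by move=> linG linF a x y; rewrite linF linG. Qed.

Lemma linear_id (k : fieldType) (V : lmodType k) : linear (fun x : V => x).
Proof. by []. Qed.

Section SubModule.
Variables (k : fieldType) (V : lmodType k) (W : submodClosed V).

Record subm := Subm { smval : V; smvalP : smval \in W }.

HB.instance Definition _ := [isSub of subm for smval].
HB.instance Definition _ := [Choice of subm by <:].
HB.instance Definition _ := [SubChoice_isSubLmodule of subm by <:].

Lemma smval_linear : linear smval.
Proof. by move=> a x y. Qed.

End SubModule.

Section QuotModule.
Variables (k : fieldType) (V : lmodType k) (W : submodClosed V).

Definition submod_pred : pred V := fun x => x \in W.

Fact submod_pred_closed : zmod_closed submod_pred.
Proof.
split=> [|x y xW yW]; first exact: (rpred0 W).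
by apply: (rpredD (xW : x \in W)); rewrite -scaleN1r rpredZ.
Qed.

Definition submod_zmod : zmodClosed V := HB.pack submod_pred
  (GRing.isZmodClosed.Build V submod_pred submod_pred_closed).

Definition quotm := Quotient.quot submod_zmod.

HB.instance Definition _ := GRing.Zmodule.on quotm.

Definition quot_proj (x : V) : quotm := \pi_(Quotient.quot submod_zmod) x.
Definition quot_repr (q : quotm) : V := generic_quotient.repr q.

Lemma quot_reprK q : quot_proj (quot_repr q) = q.
Proof. exact: reprK. Qed.

Lemma quot_projP x y : reflect (quot_proj x = quot_proj y) (x - y \in W).
Proof.
have -> : (x - y \in W) = (x - y \in submod_zmod) by [].
by rewrite Quotient.idealrBE; exact: eqP.
Qed.

Lemma quot_projD x y : quot_proj (x + y) = quot_proj x + quot_proj y.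
Proof. exact: raddfD. Qed.

Lemma quot_repr_proj x : quot_repr (quot_proj x) - x \in W.
Proof. by apply/quot_projP; rewrite quot_reprK. Qed.

Definition quot_scale (a : k) (q : quotm) : quotm := quot_proj (a *: quot_repr q).

Lemma quot_scale_proj a x : quot_scale a (quot_proj x) = quot_proj (a *: x).
Proof. by apply/quot_projP; rewrite -scalerBr rpredZ // quot_repr_proj. Qed.

Fact quot_scaleA a b q : quot_scale a (quot_scale b q) = quot_scale (a * b) q.
Proof. by rewrite -[q]quot_reprK !quot_scale_proj scalerA. Qed.
Fact quot_scale1 : left_id 1 quot_scale.
Proof. by move=> q; rewrite -[q]quot_reprK !quot_scale_proj scale1r. Qed.
Fact quot_scaleDr : right_distributive quot_scale +%R.
Proof.
move=> a q r; rewrite -[q]quot_reprK -[r]quot_reprK -quot_projD !quot_scale_proj.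
by rewrite scalerDr quot_projD.
Qed.
Fact quot_scaleDl q : {morph quot_scale^~ q : a b / a + b}.
Proof.
by move=> a b; rewrite -[q]quot_reprK !quot_scale_proj scalerDl quot_projD.
Qed.

HB.instance Definition _ := GRing.Zmodule_isLmodule.Build k quotm
  quot_scaleA quot_scale1 quot_scaleDr quot_scaleDl.

Lemma quot_proj_linear : linear quot_proj.
Proof. by move=> a x y; rewrite quot_projD -quot_scale_proj. Qed.

(* The linear map induced on the quotient by a linear map vanishing on W. *)
Definition quot_lift (Z : lmodType k) (F : V -> Z) (q : quotm) : Z :=
  F (quot_repr q).

Lemma quot_liftE (Z : lmodType k) (F : V -> Z) : linear F ->
  (forall x, x \in W -> F x = 0) ->
  forall x, quot_lift F (quot_proj x) = F x.
Proof.
move=> linF F0 x; apply/eqP; rewrite /quot_lift -subr_eq0 -(linB linF); apply/eqP/F0.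
exact: quot_repr_proj.
Qed.

Lemma quot_lift_linear (Z : lmodType k) (F : V -> Z) : linear F ->
  (forall x, x \in W -> F x = 0) -> linear (quot_lift F).
Proof.
move=> linF F0 a q r; rewrite -[q]quot_reprK -[r]quot_reprK -quot_proj_linear.
by rewrite !quot_liftE // linF.
Qed.

End QuotModule.

Section DirectSum.
Variables (k : fieldType) (I : eqType) (V : I -> lmodType k).

Definition finsupp (f : forall i, V i) :=
  exists s : seq I, forall i, i \notin s -> f i = 0.

Record dirsum := DirSum { dsfun :> forall i, V i; dsfunP : finsupp dsfun }.

HB.instance Definition _ := gen_eqMixin dirsum.
HB.instance Definition _ := gen_choiceMixin dirsum.

Lemma dirsumP (f g : dirsum) : (forall i, f i = g i) -> f = g.
Proof.
case: f g => f fP [g gP] /= e; have {}e : f = g by apply: functional_extensionality_dep.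
by case: g / e gP => gP; congr DirSum; exact: Prop_irrelevance.
Qed.

Fact ds0_subproof : finsupp (fun i => 0).
Proof. by exists [::]. Qed.
Definition ds0 := DirSum ds0_subproof.

Fact dsD_subproof (f g : dirsum) : finsupp (fun i => f i + g i).
Proof.
case: f g => f [s sP] [g [t tP]]; exists (s ++ t) => i /=.
by rewrite mem_cat negb_or => /andP[/sP-> /tP->]; rewrite addr0.
Qed.
Definition dsD f g := DirSum (dsD_subproof f g).

Fact dsN_subproof (f : dirsum) : finsupp (fun i => - f i).
Proof. by case: f => f [s sP]; exists s => i /sP /= ->; rewrite oppr0. Qed.
Definition dsN f := DirSum (dsN_subproof f).

Fact dsZ_subproof a (f : dirsum) : finsupp (fun i => a *: f i).
Proof. by case: f => f [s sP]; exists s => i /sP /= ->; rewrite scaler0. Qed.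
Definition dsZ a f := DirSum (dsZ_subproof a f).

Fact dsDA : associative dsD.
Proof. by move=> f g h; apply: dirsumP => i /=; rewrite addrA. Qed.
Fact dsDC : commutative dsD.
Proof. by move=> f g; apply: dirsumP => i /=; rewrite addrC. Qed.
Fact ds0D : left_id ds0 dsD.
Proof. by move=> f; apply: dirsumP => i /=; rewrite add0r. Qed.
Fact dsND : left_inverse ds0 dsN dsD.
Proof. by move=> f; apply: dirsumP => i /=; rewrite addNr. Qed.

HB.instance Definition _ := GRing.isZmodule.Build dirsum dsDA dsDC ds0D dsND.

Fact dsZA a b f : dsZ a (dsZ b f) = dsZ (a * b) f.
Proof. by apply: dirsumP => i /=; rewrite scalerA. Qed.
Fact dsZ1 : left_id 1 dsZ.
Proof. by move=> f; apply: dirsumP => i /=; rewrite scale1r. Qed.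
Fact dsZDr : right_distributive dsZ +%R.
Proof. by move=> a f g; apply: dirsumP => i /=; rewrite scalerDr. Qed.
Fact dsZDl f : {morph dsZ^~ f : a b / a + b}.
Proof. by move=> a b; apply: dirsumP => i /=; rewrite scalerDl. Qed.

HB.instance Definition _ := GRing.Zmodule_isLmodule.Build k dirsum
  dsZA dsZ1 dsZDr dsZDl.

End DirectSum.

Lemma finsupp_fin (k : fieldType) (I : finType) (V : I -> lmodType k)
  (f : forall i, V i) : finsupp f.
Proof. by exists (enum I) => i; rewrite mem_enum. Qed.

Fact dsmap_subproof (k : fieldType) (I : eqType) (V W : I -> lmodType k)
  (F : forall i, V i -> W i) (linF : forall i, linear (F i)) (f : dirsum V) :
  finsupp (fun i => F i (f i)).
Proof. by case: f => f [s sP]; exists s => i /sP /= ->; rewrite lin0. Qed.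

Definition dsmap (k : fieldType) (I : eqType) (V W : I -> lmodType k)
  (F : forall i, V i -> W i) (linF : forall i, linear (F i)) (f : dirsum V) :
  dirsum W := DirSum (dsmap_subproof linF f).

(** Tensor product of finite-dimensional vector spaces: the coordinate model,
    with its universal property [tens_univ]. *)

Section Tensor.
Variable k : fieldType.

Definition tens (V W : vectType k) := 'M[k]_(dim V, dim W).

Definition pure (V W : vectType k) (v : V) (w : W) : tens V W :=
  (v2r v)^T *m v2r w.

Lemma tensE (V W : vectType k) (A : tens V W) :
  A = \sum_i \sum_j A i j *: pure (r2v (delta_mx 0 i)) (r2v (delta_mx 0 j)).
Proof.
rewrite [LHS]matrix_sum_delta; apply: eq_bigr => i _; apply: eq_bigr => j _.
by rewrite /pure !r2vK trmx_delta mul_delta_mx.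
Qed.

Lemma pure_linearl (V W : vectType k) (w : W) : linear (fun v : V => pure v w).
Proof. by move=> a u v; rewrite /pure !linearP /= mulmxDl -scalemxAl. Qed.

Lemma pure_linearr (V W : vectType k) (v : V) : linear (fun w : W => pure v w).
Proof. by move=> a u w; rewrite /pure [v2r (a *: u + w)]linearP /= mulmxDr -scalemxAr. Qed.

Lemma tens_ext (V W : vectType k) (Z : lmodType k) (F G : tens V W -> Z) :
  linear F -> linear G -> (forall v w, F (pure v w) = G (pure v w)) ->
  forall A, F A = G A.
Proof.
move=> linF linG e A; rewrite (tensE A) !pair_big /= !lin_sumZ //.
by apply: eq_bigr => i _; rewrite e.
Qed.

Definition tens_lift (V W : vectType k) (Z : lmodType k) (B : V -> W -> Z)
  (A : tens V W) : Z :=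
  \sum_i \sum_j A i j *: B (r2v (delta_mx 0 i)) (r2v (delta_mx 0 j)).

Lemma tens_lift_linear (V W : vectType k) (Z : lmodType k) (B : V -> W -> Z) :
  linear (tens_lift B).
Proof.
move=> a A A'; rewrite /tens_lift scaler_sumr -big_split; apply: eq_bigr => i _ /=.
rewrite scaler_sumr -big_split; apply: eq_bigr => j _ /=.
by rewrite !mxE scalerDl scalerA.
Qed.

Lemma tens_liftE (V W : vectType k) (Z : lmodType k) (B : V -> W -> Z) :
  (forall w, linear (B^~ w)) -> (forall v, linear (B v)) ->
  forall v w, tens_lift B (pure v w) = B v w.
Proof.
move=> linl linr v w; rewrite -[in RHS](v2rK v) -[in RHS](v2rK w).
rewrite [v2r v]row_sum_delta [v2r w]row_sum_delta !linear_sum /=.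
under [in RHS]eq_bigr do rewrite linearZ /=.
under [X in B _ X]eq_bigr do rewrite linearZ /=.
rewrite (lin_sumZ (linl _)); apply: eq_bigr => i _.
rewrite (lin_sumZ (linr _)) scaler_sumr; apply: eq_bigr => j _.
by rewrite scalerA /pure mxE big_ord1 mxE.
Qed.

Theorem tens_univ (V W : vectType k) (Z : lmodType k) (B : V -> W -> Z) :
  (forall w, linear (B^~ w)) -> (forall v, linear (B v)) ->
  exists F : tens V W -> Z, [/\ linear F, forall v w, F (pure v w) = B v w &
    forall G, linear G -> (forall v w, G (pure v w) = B v w) -> G =1 F].
Proof.
move=> linl linr; exists (tens_lift B); split.
- exact: tens_lift_linear.
- exact: tens_liftE.
move=> G linG GE; apply: tens_ext => //; first exact: tens_lift_linear.
by move=> v w; rewrite GE tens_liftE.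
Qed.

Definition tmap (V V' W W' : vectType k) (f : V -> V') (g : W -> W') :
  tens V W -> tens V' W' := tens_lift (fun v w => pure (f v) (g w)).

Lemma tmap_linear (V V' W W' : vectType k) (f : V -> V') (g : W -> W') :
  linear (tmap f g).
Proof. exact: tens_lift_linear. Qed.

Lemma tmap_pure (V V' W W' : vectType k) (f : V -> V') (g : W -> W') :
  linear f -> linear g -> forall v w, tmap f g (pure v w) = pure (f v) (g w).
Proof.
move=> linf ling; apply: tens_liftE => [w|v] a x y.
  by rewrite linf pure_linearl.
by rewrite ling pure_linearr.
Qed.

End Tensor.

Record finCat := FinCat {
  fob :> Type;
  fhom : fob -> fob -> finType;
  fid : forall X, fhom X X;
  fcomp : forall X Y Z, fhom Y Z -> fhom X Y -> fhom X Z;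
  fcompA : forall W X Y Z (h : fhom Y Z) (g : fhom X Y) (f : fhom W X),
    fcomp h (fcomp g f) = fcomp (fcomp h g) f;
  fcomp1f : forall X Y (f : fhom X Y), fcomp (fid Y) f = f;
  fcompf1 : forall X Y (f : fhom X Y), fcomp f (fid X) = f }.

Definition opc (C : finCat) : finCat :=
  @FinCat C (fun X Y => fhom Y X) (@fid C) (fun X Y Z g f => fcomp f g)
    (fun W X Y Z h g f => esym (fcompA f g h))
    (fun X Y f => fcompf1 f) (fun X Y f => fcomp1f f).

Record linCat (k : fieldType) := LinCat {
  lob :> Type;
  lhom : lob -> lob -> lmodType k;
  lid : forall X, lhom X X;
  lcomp : forall X Y Z, lhom Y Z -> lhom X Y -> lhom X Z;
  lcomp_linl : forall X Y Z (f : lhom X Y), linear (fun g : lhom Y Z => lcomp g f);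
  lcomp_linr : forall X Y Z (g : lhom Y Z), linear (fun f : lhom X Y => lcomp g f);
  lcompA : forall W X Y Z (h : lhom Y Z) (g : lhom X Y) (f : lhom W X),
    lcomp h (lcomp g f) = lcomp (lcomp h g) f;
  lcomp1f : forall X Y (f : lhom X Y), lcomp (lid Y) f = f;
  lcompf1 : forall X Y (f : lhom X Y), lcomp f (lid X) = f }.

Section Linearization.
Variables (k : fieldType) (C : finCat).

Definition khom (X Y : C) := free_mod k (fhom X Y).

Definition kcomp (X Y Z : C) (y : khom Y Z) (x : khom X Y) : khom X Z :=
  lext (fun g => lext (fun f => bas k (fcomp g f)) x) y.

Lemma kcomp_linl (X Y Z : C) (x : khom X Y) :
  linear (fun y : khom Y Z => kcomp y x).
Proof. exact: lext_linear. Qed.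

Lemma kcomp_linr (X Y Z : C) (y : khom Y Z) :
  linear (fun x : khom X Y => kcomp y x).
Proof. by apply: lext_linear2 => g; exact: lext_linear. Qed.

Lemma kcomp_bas (X Y Z : C) (g : fhom Y Z) (f : fhom X Y) :
  kcomp (bas k g) (bas k f) = bas k (fcomp g f).
Proof. by rewrite /kcomp !lext_bas. Qed.

Fact kcompA (W X Y Z : C) (h : khom Y Z) (g : khom X Y) (f : khom W X) :
  kcomp h (kcomp g f) = kcomp (kcomp h g) f.
Proof.
move: h; apply: lin_ext => [||h].
- exact: kcomp_linl.
- by apply: (@linear_comp k _ _ _ (fun z => kcomp z f)); exact: kcomp_linl.
move: g; apply: lin_ext => [||g].
- by apply: (@linear_comp k _ _ _ (kcomp _)) => //; [exact: kcomp_linr|exact: kcomp_linl].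
- by apply: (@linear_comp k _ _ _ (fun z => kcomp z f)); [exact: kcomp_linl|exact: kcomp_linr].
move: f; apply: lin_ext => [||f].
- by apply: (@linear_comp k _ _ _ (kcomp _)) => //; exact: kcomp_linr.
- exact: kcomp_linr.
by rewrite !kcomp_bas fcompA.
Qed.

Fact kcomp1f (X Y : C) (f : khom X Y) : kcomp (bas k (fid Y)) f = f.
Proof.
move: f; apply: lin_ext => [||f] //; first exact: kcomp_linr.
by rewrite kcomp_bas fcomp1f.
Qed.

Fact kcompf1 (X Y : C) (f : khom X Y) : kcomp f (bas k (fid X)) = f.
Proof.
move: f; apply: lin_ext => [||f] //; first exact: kcomp_linl.
by rewrite kcomp_bas fcompf1.
Qed.

Definition kcat : linCat k :=
  LinCat kcomp_linl kcomp_linr kcompA kcomp1f kcompf1.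

End Linearization.

Section LinFunctor.
Variable k : fieldType.

Record linFun (A B : linCat k) := LinFun {
  lfob :> A -> B;
  lfmap : forall X Y, lhom X Y -> lhom (lfob X) (lfob Y);
  lfmap_lin : forall X Y, linear (@lfmap X Y);
  lfmap1 : forall X, lfmap (lid X) = lid (lfob X);
  lfmapM : forall X Y Z (g : lhom Y Z) (f : lhom X Y),
    lfmap (lcomp g f) = lcomp (lfmap g) (lfmap f) }.

Definition linFun_comp (A B C : linCat k) (G : linFun B C) (F : linFun A B) :
  linFun A C.
Proof.
refine (@LinFun A C (fun X => G (F X)) (fun X Y f => lfmap G (lfmap F f)) _ _ _).
- by move=> X Y; apply: linear_comp; exact: lfmap_lin.
- by move=> X; rewrite !lfmap1.
- by move=> X Y Z g f; rewrite !lfmapM.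
Defined.

(* Modules with finite-dimensional values. *)
Record fdMod (A : linCat k) := FdMod {
  fdval :> A -> vectType k;
  fdact : forall X Y, lhom X Y -> fdval X -> fdval Y;
  fdact_linl : forall X Y (m : fdval X), linear (fun f : lhom X Y => fdact f m);
  fdact_linr : forall X Y (f : lhom X Y), linear (fdact f);
  fdact1 : forall X m, fdact (lid X) m = m;
  fdactM : forall X Y Z (g : lhom Y Z) (f : lhom X Y) m,
    fdact (lcomp g f) m = fdact g (fdact f m) }.

(* A module over the tensor product of A and B: by the universal property of
   the tensor products of morphism spaces, a k-linear functor on it amounts to
   commuting k-linear actions of A and of B. *)
Record bimod (A B : linCat k) := Bimod {
  bmval :> A -> B -> lmodType k;
  bmactl : forall X Y U, lhom X Y -> bmval X U -> bmval Y U;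
  bmactr : forall X U V, lhom U V -> bmval X U -> bmval X V;
  bmactl_linl : forall X Y U (m : bmval X U),
    linear (fun f : lhom X Y => bmactl f m);
  bmactl_linr : forall X Y U (f : lhom X Y), linear (@bmactl X Y U f);
  bmactr_linl : forall X U V (m : bmval X U),
    linear (fun f : lhom U V => bmactr f m);
  bmactr_linr : forall X U V (f : lhom U V), linear (@bmactr X U V f);
  bmactl1 : forall X U (m : bmval X U), bmactl (lid X) m = m;
  bmactr1 : forall X U (m : bmval X U), bmactr (lid U) m = m;
  bmactlM : forall X Y Z U (g : lhom Y Z) (f : lhom X Y) (m : bmval X U),
    bmactl (lcomp g f) m = bmactl g (bmactl f m);
  bmactrM : forall X U V W (g : lhom V W) (f : lhom U V) (m : bmval X U),
    bmactr (lcomp g f) m = bmactr g (bmactr f m);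
  bmactC : forall X Y U V (f : lhom X Y) (g : lhom U V) (m : bmval X U),
    bmactl f (bmactr g m) = bmactr g (bmactl f m) }.

Record bimodHom (A B : linCat k) (M N : bimod A B) := BimodHom {
  bmhom :> forall X U, M X U -> N X U;
  bmhom_lin : forall X U, linear (@bmhom X U);
  bmhoml : forall X Y U (f : lhom X Y) (m : M X U),
    bmhom (bmactl f m) = bmactl f (bmhom m);
  bmhomr : forall X U V (f : lhom U V) (m : M X U),
    bmhom (bmactr f m) = bmactr f (bmhom m) }.

(* Exactness of 0 -> M -> N -> P -> 0, computed objectwise. *)
Definition short_exact (A B : linCat k) (M N P : bimod A B)
    (f : bimodHom M N) (g : bimodHom N P) : Prop :=
  forall X U, [/\ injective (f X U),
    forall n : N X U, g X U n = 0 <-> (exists m, f X U m = n)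
    & forall p : P X U, exists n, g X U n = p].

Section FdModOfFunctor.
Variables (C : finCat) (V : C -> vectType k).
Variable act : forall X Y, fhom X Y -> V X -> V Y.
Hypothesis act_lin : forall X Y (f : fhom X Y), linear (act f).
Hypothesis act1 : forall X m, act (fid X) m = m.
Hypothesis actM : forall X Y Z (g : fhom Y Z) (f : fhom X Y) m,
  act (fcomp g f) m = act g (act f m).

Definition fdMod_of : fdMod (kcat k C).
Proof.
refine (@FdMod (kcat k C) V (fun X Y x m => lext (fun f => act f m) x) _ _ _ _).
- by move=> X Y m; exact: lext_linear.
- move=> X Y x; apply: (@lext_linear2 _ _ _ _ (fun f m => act f m)).
  exact: act_lin.
- by move=> X m; rewrite /= lext_bas act1.
have Glin (X Y : C) (x : khom k X Y) : linear (fun m => lext (fun f => act f m) x).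
  by apply: (@lext_linear2 _ _ _ _ (fun f m => act f m)); exact: act_lin.
move=> X Y Z /= g f m.
move: g; apply: lin_ext => [||g]; last first.
- move: f; apply: lin_ext => [||f]; last by rewrite kcomp_bas !lext_bas actM.
  + by apply: linear_comp; [exact: lext_linear|exact: kcomp_linr].
  + by apply: (linear_comp (Glin _ _ _)); exact: lext_linear.
- exact: lext_linear.
by apply: linear_comp; [exact: lext_linear|exact: kcomp_linl].
Defined.

End FdModOfFunctor.

Section BimodOfFunctor.
Variables (A : linCat k) (C : finCat) (M : A -> C -> lmodType k).
Variable actl : forall X Y U, lhom X Y -> M X U -> M Y U.
Variable act : forall X U V, fhom U V -> M X U -> M X V.
Hypothesis actl_linl : forall X Y U (m : M X U),
  linear (fun f : lhom X Y => actl f m).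
Hypothesis actl_linr : forall X Y U (f : lhom X Y), linear (@actl X Y U f).
Hypothesis actl1 : forall X U (m : M X U), actl (lid X) m = m.
Hypothesis actlM : forall X Y Z U (g : lhom Y Z) (f : lhom X Y) (m : M X U),
  actl (lcomp g f) m = actl g (actl f m).
Hypothesis act_lin : forall X U V (f : fhom U V), linear (@act X U V f).
Hypothesis act1 : forall X U (m : M X U), act (fid U) m = m.
Hypothesis actM : forall X U V W (g : fhom V W) (f : fhom U V) (m : M X U),
  act (fcomp g f) m = act g (act f m).
Hypothesis actC : forall X Y U V (f : lhom X Y) (g : fhom U V) (m : M X U),
  actl f (act g m) = act g (actl f m).

Definition bimod_of : bimod A (kcat k C).
Proof.
refine (@Bimod A (kcat k C) M actl (fun X U V x m => lext (fun f => act f m) x)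
  _ _ _ _ _ _ _ _ _) => //.
- by move=> X U V m; exact: lext_linear.
- move=> X U V x; apply: (@lext_linear2 _ _ _ _ (fun f m => act f m)).
  exact: act_lin.
- by move=> X U m; rewrite /= lext_bas act1.
- have Glin X (U V : C) (x : khom k U V) :
      linear (fun m : M X U => lext (fun f => act f m) x).
    by apply: (@lext_linear2 _ _ _ _ (fun f m => act f m)); exact: act_lin.
  move=> X U V W /= g f m.
  move: g; apply: lin_ext => [||g]; last first.
  + move: f; apply: lin_ext => [||f]; last by rewrite kcomp_bas !lext_bas actM.
    * by apply: linear_comp; [exact: lext_linear|exact: kcomp_linr].
    * by apply: (linear_comp (Glin _ _ _ _)); exact: lext_linear.
  + exact: lext_linear.
  by apply: linear_comp; [exact: lext_linear|exact: kcomp_linl].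
- move=> X Y U V f x m; rewrite (lin_lext _ (actl_linr f)).
  by apply: eq_lext => g /=; rewrite actC.
Defined.

End BimodOfFunctor.

(* Restriction along a k-linear functor in the first variable. *)
Definition bimod_restr (A A' B : linCat k) (F : linFun A A') (M : bimod A' B) :
  bimod A B.
Proof.
refine (@Bimod A B (fun X U => M (F X) U)
  (fun X Y U f m => bmactl (lfmap F f) m) (fun X U V f m => bmactr f m)
  _ _ _ _ _ _ _ _ _).
- move=> X Y U m; apply: (@linear_comp k _ _ _ (fun f => bmactl f m)).
    exact: bmactl_linl.
  exact: lfmap_lin.
- by move=> X Y U f; exact: bmactl_linr.
- by move=> X U V m; exact: bmactr_linl.
- by move=> X U V f; exact: bmactr_linr.
- by move=> X U m; rewrite lfmap1 bmactl1.
- by move=> X U m; rewrite bmactr1.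
- by move=> X Y Z U g f m; rewrite lfmapM bmactlM.
- by move=> X U V W g f m; rewrite bmactrM.
- by move=> X Y U V f g m; rewrite bmactC.
Defined.

Definition bimod_ext (A B : linCat k) (M : fdMod A) (N : fdMod B) : bimod A B.
Proof.
refine (@Bimod A B (fun X U => tens (M X) (N U))
  (fun X Y U f => tmap (fdact f) id) (fun X U V f => tmap id (fdact f))
  _ _ _ _ _ _ _ _ _).
- move=> X Y U m a f g; move: m; apply: tens_ext => [||v w].
  + exact: tmap_linear.
  + by move=> b x y; rewrite !tmap_linear scalerDr !scalerDr !scalerA mulrC addrACA.
  + by rewrite !tmap_pure //; try exact: fdact_linr; rewrite fdact_linl pure_linearl.
- by move=> X Y U f; exact: tmap_linear.
- move=> X U V m a f g; move: m; apply: tens_ext => [||v w].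
  + exact: tmap_linear.
  + by move=> b x y; rewrite !tmap_linear scalerDr !scalerDr !scalerA mulrC addrACA.
  + by rewrite !tmap_pure //; try exact: fdact_linr; rewrite fdact_linl pure_linearr.
- by move=> X U V f; exact: tmap_linear.
- move=> X U; apply: tens_ext => [||v w] //; first exact: tmap_linear.
  by rewrite tmap_pure //; try exact: fdact_linr; rewrite fdact1.
- move=> X U; apply: tens_ext => [||v w] //; first exact: tmap_linear.
  by rewrite tmap_pure //; try exact: fdact_linr; rewrite fdact1.
- move=> X Y Z U g f; apply: tens_ext => [||v w].
  + exact: tmap_linear.
  + by apply: linear_comp; exact: tmap_linear.
  + by rewrite !tmap_pure //; try exact: fdact_linr; rewrite fdactM.
- move=> X U V W g f; apply: tens_ext => [||v w].
  + exact: tmap_linear.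
  + by apply: linear_comp; exact: tmap_linear.
  + by rewrite !tmap_pure //; try exact: fdact_linr; rewrite fdactM.
- move=> X Y U V f g; apply: tens_ext => [||v w].
  + by apply: linear_comp; exact: tmap_linear.
  + by apply: linear_comp; exact: tmap_linear.
  + by rewrite !tmap_pure //; exact: fdact_linr.
Defined.

Definition bimod_sum (A B : linCat k) (I : eqType) (M : I -> bimod A B) :
  bimod A B.
Proof.
refine (@Bimod A B (fun X U => dirsum (fun i => M i X U))
  (fun X Y U f => dsmap (fun i => @bmactl_linr _ _ (M i) X Y U f))
  (fun X U V f => dsmap (fun i => @bmactr_linr _ _ (M i) X U V f))
  _ _ _ _ _ _ _ _ _).
- by move=> X Y U m a f g; apply: dirsumP => i /=; rewrite bmactl_linl.
- by move=> X Y U f a m n; apply: dirsumP => i /=; rewrite bmactl_linr.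
- by move=> X U V m a f g; apply: dirsumP => i /=; rewrite bmactr_linl.
- by move=> X U V f a m n; apply: dirsumP => i /=; rewrite bmactr_linr.
- by move=> X U m; apply: dirsumP => i /=; rewrite bmactl1.
- by move=> X U m; apply: dirsumP => i /=; rewrite bmactr1.
- by move=> X Y Z U g f m; apply: dirsumP => i /=; rewrite bmactlM.
- by move=> X U V W g f m; apply: dirsumP => i /=; rewrite bmactrM.
- by move=> X Y U V f g m; apply: dirsumP => i /=; rewrite bmactC.
Defined.

Section Quotient.
Variables (A B : linCat k) (M : bimod A B).
Variable W : forall X U, submodClosed (M X U).
Hypothesis Wl : forall X Y U (f : lhom X Y) (m : M X U),
  m \in W X U -> bmactl f m \in W Y U.
Hypothesis Wr : forall X U V (f : lhom U V) (m : M X U),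
  m \in W X U -> bmactr f m \in W X V.

Definition qactl X Y U (f : lhom X Y) : quotm (W X U) -> quotm (W Y U) :=
  quot_lift (fun m => quot_proj (W Y U) (bmactl f m)).

Definition qactr X U V (f : lhom U V) : quotm (W X U) -> quotm (W X V) :=
  quot_lift (fun m => quot_proj (W X V) (bmactr f m)).

Let linl X Y U (f : lhom X Y) :
  linear (fun m => quot_proj (W Y U) (bmactl f m)).
Proof. by apply: linear_comp; [exact: quot_proj_linear|exact: bmactl_linr]. Qed.

Let linr X U V (f : lhom U V) :
  linear (fun m => quot_proj (W X V) (bmactr f m)).
Proof. by apply: linear_comp; [exact: quot_proj_linear|exact: bmactr_linr]. Qed.

Let proj0 X U m : m \in W X U -> quot_proj (W X U) m = 0.
Proof.
move=> mW; rewrite -(lin0 (@quot_proj_linear _ _ (W X U))).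
by apply/quot_projP; rewrite subr0.
Qed.

Lemma qactlE X Y U (f : lhom X Y) m :
  qactl f (quot_proj (W X U) m) = quot_proj (W Y U) (bmactl f m).
Proof.
by apply: (quot_liftE (linl f)) => n nW; apply: proj0; exact: Wl.
Qed.

Lemma qactrE X U V (f : lhom U V) m :
  qactr f (quot_proj (W X U) m) = quot_proj (W X V) (bmactr f m).
Proof.
by apply: (quot_liftE (linr f)) => n nW; apply: proj0; exact: Wr.
Qed.

Definition bimod_quot : bimod A B.
Proof.
refine (@Bimod A B (fun X U => quotm (W X U)) qactl qactr _ _ _ _ _ _ _ _ _).
- move=> X Y U m a f g; rewrite -[m]quot_reprK !qactlE.
  by rewrite bmactl_linl quot_proj_linear.
- by move=> X Y U f; apply: (quot_lift_linear (linl f)) => n nW; apply: proj0; exact: Wl.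
- move=> X U V m a f g; rewrite -[m]quot_reprK !qactrE.
  by rewrite bmactr_linl quot_proj_linear.
- by move=> X U V f; apply: (quot_lift_linear (linr f)) => n nW; apply: proj0; exact: Wr.
- by move=> X U m; rewrite -[m]quot_reprK !qactlE bmactl1.
- by move=> X U m; rewrite -[m]quot_reprK !qactrE bmactr1.
- by move=> X Y Z U g f m; rewrite -[m]quot_reprK !qactlE bmactlM.
- by move=> X U V Z g f m; rewrite -[m]quot_reprK !qactrE bmactrM.
- move=> X Y U V f g m; rewrite -[m]quot_reprK.
  by rewrite qactlE !qactrE qactlE bmactC.
Defined.

End Quotient.

End LinFunctor.

Definition surjb (U X : finType) (f : {ffun U -> X}) : bool :=
  [forall x, [exists u, f u == x]].
Definition bijb (U X : finType) (f : {ffun U -> X}) : bool :=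
  injectiveb f && surjb f.

Definition fcompose (U X Y : finType) (g : {ffun X -> Y}) (f : {ffun U -> X}) :
  {ffun U -> Y} := [ffun u => g (f u)].

Lemma surjbP (U X : finType) (f : {ffun U -> X}) :
  reflect (forall x, exists u, f u = x) (surjb f).
Proof.
apply: (iffP forallP) => h x; first by have /existsP[u /eqP] := h x; exists u.
by apply/existsP; have [u <-] := h x; exists u.
Qed.

Lemma bijbP (U X : finType) (f : {ffun U -> X}) :
  reflect (injective f /\ forall x, exists u, f u = x) (bijb f).
Proof.
apply: (iffP andP) => -[/injectiveP i s]; split=> //; exact/surjbP.
Qed.

Lemma surjb_comp (U X Y : finType) (g : {ffun X -> Y}) (f : {ffun U -> X}) :
  surjb g -> surjb f -> surjb (fcompose g f).
Proof.
move=> /surjbP sg /surjbP sf; apply/surjbP => y.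
by have [x <-] := sg y; have [u <-] := sf x; exists u; rewrite ffunE.
Qed.

Lemma bijb_comp (U X Y : finType) (g : {ffun X -> Y}) (f : {ffun U -> X}) :
  bijb g -> bijb f -> bijb (fcompose g f).
Proof.
move=> /andP[/injectiveP ig sg] /andP[/injectiveP jf sf].
rewrite /bijb surjb_comp // andbT; apply/injectiveP => u v.
by rewrite !ffunE => /ig/jf.
Qed.

Lemma bijb_id (U : finType) : bijb [ffun u : U => u].
Proof.
by apply/bijbP; split=> [u v|u]; [rewrite !ffunE|exists u; rewrite ffunE].
Qed.

Lemma surjb_id (U : finType) : surjb [ffun u : U => u].
Proof. by have /andP[] := bijb_id U. Qed.

Definition surj (U X : finType) := {f : {ffun U -> X} | surjb f}.
Definition bij (U X : finType) := {f : {ffun U -> X} | bijb f}.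

Definition FS : finCat.
Proof.
refine (@FinCat finType (fun U X => surj U X) (fun U => Sub _ (surjb_id U))
  (fun U X Y g f => Sub _ (surjb_comp (valP g) (valP f))) _ _ _).
- by move=> *; apply/val_inj/ffunP => u; rewrite /= !ffunE.
- by move=> *; apply/val_inj/ffunP => u; rewrite /= !ffunE.
- by move=> *; apply/val_inj/ffunP => u; rewrite /= !ffunE.
Defined.

Definition FB : finCat.
Proof.
refine (@FinCat finType (fun U X => bij U X) (fun U => Sub _ (bijb_id U))
  (fun U X Y g f => Sub _ (bijb_comp (valP g) (valP f))) _ _ _).
- by move=> *; apply/val_inj/ffunP => u; rewrite /= !ffunE.
- by move=> *; apply/val_inj/ffunP => u; rewrite /= !ffunE.
- by move=> *; apply/val_inj/ffunP => u; rewrite /= !ffunE.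
Defined.

Section FSfiltration.
Variable k : fieldType.

Definition kFS := kcat k FS.
Definition kFB := kcat k FB.
Definition kFBop := kcat k (opc FB).

Implicit Types (U V W X Y : finType).

(* [f] if f is surjective, and 0 otherwise. *)
Definition fsbas U X (f : {ffun U -> X}) : @lhom k kFS U X :=
  if insub f is Some g then bas k (g : surj U X) else 0.

Definition fbbas U X (f : {ffun U -> X}) : @lhom k kFB U X :=
  if insub f is Some g then bas k (g : bij U X) else 0.

Lemma fsbas_val U X (f : surj U X) : fsbas (val f) = bas k f.
Proof. by rewrite /fsbas valK. Qed.

Lemma fsbasN U X (f : {ffun U -> X}) : ~~ surjb f -> fsbas f = 0.
Proof. by move=> nf; rewrite /fsbas insubN. Qed.

Definition aug_map U X : @lhom k kFS U X -> @lhom k kFB U X :=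
  lext (fun f : surj U X => fbbas (val f)).

Definition aug : linFun kFS kFB.
Proof.
refine (@LinFun k kFS kFB (fun X => X) aug_map _ _ _).
- by move=> U X; exact: lext_linear.
- move=> X; rewrite /aug_map lext_bas /fbbas /=.
  case: insubP => [f _ e|]; last by rewrite bijb_id.
  by congr bas; apply: val_inj.
move=> U X Y /= g f.
move: g; apply: lin_ext => [||g].
- exact: (linear_comp (lext_linear _) (@kcomp_linl k FS U X Y f)).
- exact: (linear_comp (@kcomp_linl k FB U X Y _) (lext_linear _)).
move: f; apply: lin_ext => [||f].
- exact: (linear_comp (lext_linear _) (@kcomp_linr k FS U X Y _)).
- exact: (linear_comp (@kcomp_linr k FB U X Y _) (lext_linear _)).
rewrite kcomp_bas /aug_map !lext_bas /fbbas.
case: (insubP _ (val g)) => [g' bg eg|nbg]; last first.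
  rewrite (lin0 (@kcomp_linl k FB U X Y _)) insubN //.
  apply: contra nbg => /= /andP[/injectiveP ifg _].
  rewrite /bijb (valP g) andbT; apply/injectiveP => x1 x2 e.
  have /surjbP sf := valP f; have [u1 e1] := sf x1; have [u2 e2] := sf x2.
  by rewrite -e1 -e2 in e *; congr (val f _); apply: ifg; rewrite !ffunE.
case: (insubP _ (val f)) => [f' bf ef|nbf]; last first.
  rewrite (lin0 (@kcomp_linr k FB U X Y _)) insubN //.
  apply: contra nbf => /= /andP[/injectiveP ifg _].
  rewrite /bijb (valP f) andbT; apply/injectiveP => u1 u2 e.
  by apply: ifg; rewrite !ffunE e.
rewrite kcomp_bas; case: insubP => [h bh eh|]; last by rewrite /= bijb_comp.
by congr bas; apply: val_inj; rewrite eh /= -ef -eg.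
Defined.

(** Restriction i^* along i : V -> U: [f] is sent to [f o i] if f o i is
    surjective and to 0 otherwise. *)

Definition res V U X (i : V -> U) : @lhom k kFS U X -> @lhom k kFS V X :=
  lext (fun f : surj U X => fsbas [ffun v => val f (i v)]).

Lemma res_linear V U X (i : V -> U) : linear (@res V U X i).
Proof. exact: lext_linear. Qed.

Lemma res_bas V U X (i : V -> U) (f : surj U X) :
  res i (bas k f) = fsbas [ffun v => val f (i v)].
Proof. exact: lext_bas. Qed.

Lemma res_fsbas V U X (i : V -> U) (f : {ffun U -> X}) :
  res i (fsbas f) = fsbas [ffun v => f (i v)].
Proof.
have [sf|nsf] := boolP (surjb f).
  by rewrite -[f]/(val (exist _ f sf : surj U X)) fsbas_val res_bas.
rewrite (fsbasN nsf) (lin0 (@res_linear V U X i)) fsbasN //.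
apply: contra nsf => /surjbP h; apply/surjbP => x.
by have [v <-] := h x; exists (i v); rewrite ffunE.
Qed.

Lemma res_id U X (x : @lhom k kFS U X) : res id x = x.
Proof.
move: x; apply: lin_ext => [||f] //; first exact: res_linear.
rewrite res_bas -[RHS]fsbas_val; congr fsbas; apply/ffunP => u; by rewrite ffunE.
Qed.

Lemma res_comp W V U X (j : W -> V) (i : V -> U) (x : @lhom k kFS U X) :
  res j (res i x) = res (i \o j) x.
Proof.
move: x; apply: lin_ext => [||f].
- by apply: linear_comp; exact: res_linear.
- exact: res_linear.
rewrite !res_bas res_fsbas; congr fsbas; apply/ffunP => w; by rewrite !ffunE.
Qed.

Lemma eq_res V U X (i j : V -> U) : i =1 j -> @res V U X i =1 res j.
Proof. by move=> e x; have -> : i = j by apply: funext. Qed.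

(* kFS^t(U, X), meaningful for t >= -1: the condition is vacuous if #|U| <= t,
   and t = -1 gives 0. *)

Definition FSt (t : int) U X : {pred @lhom k kFS U X} := fun x =>
  `[< forall V (i : V -> U), injective i -> #|U|%:Z - #|V|%:Z = t + 1 ->
      res i x = 0 >].
Arguments FSt : clear implicits.

Lemma FStP (t : int) U X (x : @lhom k kFS U X) :
  reflect (forall V (i : V -> U), injective i -> #|U|%:Z - #|V|%:Z = t + 1 ->
             res i x = 0)
          (x \in FSt t U X).
Proof. exact: asboolP. Qed.

Fact FSt_closed t U X : submod_closed (FSt t U X).
Proof.
split=> [|a x y /FStP hx /FStP hy]; apply/FStP => V i inj_i e.
  exact: (lin0 (@res_linear V U X i)).
by rewrite res_linear (hx _ _ inj_i e) (hy _ _ inj_i e) scaler0 addr0.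
Qed.

HB.instance Definition _ t U X :=
  GRing.isSubmodClosed.Build k (@lhom k kFS U X) (FSt t U X) (FSt_closed t U X).

Lemma FSt_res t d V U X (i : V -> U) x : injective i ->
  #|U|%:Z - #|V|%:Z = d -> x \in FSt t U X -> res i x \in FSt (t - d) V X.
Proof.
move=> inj_i e /FStP xt; apply/FStP => W j inj_j e'.
rewrite res_comp xt //; first exact: inj_comp.
by rewrite -(subrKA #|V|%:Z) e e' addrA addrCA subrr addr0.
Qed.

Lemma FSt_res_bij t V U X (i : V -> U) x : bijective i ->
  x \in FSt t U X -> res i x \in FSt t V X.
Proof.
move=> bij_i; rewrite -{2}[t]subr0; apply: FSt_res; first exact: bij_inj.
by rewrite (bij_eq_card bij_i) subrr.
Qed.

Notation kc := (@kcomp k FS _ _ _).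

Lemma kcomp_bas_res U X Y (y : @lhom k kFS X Y) (f : surj U X) :
  kc y (bas k f) = res (val f) y.
Proof.
move: y; apply: lin_ext => [||g]; [exact: kcomp_linl|exact: res_linear|].
by rewrite kcomp_bas res_bas -fsbas_val.
Qed.

Lemma FS0_res0 U X Y (h : U -> X) (y : @lhom k kFS X Y) :
  y \in FSt 0 X Y -> (exists x, forall u, h u != x) -> res h y = 0.
Proof.
move=> /FStP y0 [x0 hx0].
pose h' u : {x | x != x0} := exist _ (h u) (hx0 u).
rewrite (@eq_res _ _ _ h (val \o h')) // -res_comp y0 ?(lin0 (@res_linear _ _ _ _)) //.
  exact: val_inj.
rewrite card_sig; have -> : #|[pred x | x != x0]| = #|X|.-1 by rewrite -(cardC1 x0).
have : (0 < #|X|)%N by apply/card_gt0P; exists x0.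
by case: #|X| => // n _; rewrite succnK -addn1 PoszD addrAC subrr add0r.
Qed.

(* Restriction along any map i, injective or not, commutes with postcomposition
   with elements of kFS^0. *)
Lemma res_kcomp V U X Y (i : V -> U) (y : @lhom k kFS X Y) x :
  y \in FSt 0 X Y -> res i (kc y x) = kc y (res i x).
Proof.
move=> y0; move: x; apply: lin_ext => [||f].
- by apply: linear_comp; [exact: res_linear|exact: kcomp_linr].
- by apply: linear_comp; [exact: kcomp_linr|exact: res_linear].
rewrite kcomp_bas_res res_comp res_bas.
set h := [ffun v => _].
have [sh|nsh] := boolP (surjb h).
  rewrite -[h]/(val (exist _ h sh : surj V X)) fsbas_val kcomp_bas_res.
  by apply: eq_res => v; rewrite /= ffunE.
rewrite (fsbasN nsh) (lin0 (@kcomp_linr k FS V X Y y)).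
apply: (FS0_res0 y0); move: nsh; rewrite negb_forall => /existsP[x0].
rewrite negb_exists => /forallP hx0; exists x0 => v.
by have := hx0 v; rewrite ffunE.
Qed.

Lemma FSt_kcomp t U X Y y x :
  y \in FSt 0 X Y -> x \in FSt t U X -> kc y x \in FSt t U Y.
Proof.
move=> y0 /FStP xt; apply/FStP => V i inj_i e.
by rewrite res_kcomp // (xt _ _ inj_i e) (lin0 (@kcomp_linr k FS V X Y y)).
Qed.

Lemma FS0_id U : lid (l := kFS) U \in FSt 0 U U.
Proof.
apply/FStP => V i inj_i e; rewrite /= res_bas fsbasN //; apply/negP => /surjbP h.
have : (#|U| <= #|V|)%N.
  have hU u : exists v, i v == u.
    by have [v] := h u; rewrite !ffunE => <-; exists v.
  apply: (@leq_card _ _ (fun u => xchoose (hU u))) => u1 u2 e12.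
  by rewrite -(eqP (xchooseP (hU u1))) e12 (eqP (xchooseP (hU u2))).
by move: e => /eqP; rewrite add0r subr_eq addrC -PoszD addn1 => /eqP[->]; rewrite ltnn.
Qed.

Definition FStm (t : int) U X : lmodType k := subm (FSt t U X).

Definition kFS0 : linCat k.
Proof.
refine (@LinCat k finType (FStm 0) (fun U => Subm (FS0_id U))
  (fun U X Y y x => Subm (FSt_kcomp (smvalP y) (smvalP x))) _ _ _ _ _).
- by move=> U X Y f a x y; apply: val_inj; exact: kcomp_linl.
- by move=> U X Y f a x y; apply: val_inj; exact: kcomp_linr.
- by move=> U X Y Z h g f; apply: val_inj; exact: kcompA.
- by move=> U X f; apply: val_inj; exact: kcomp1f.
- by move=> U X f; apply: val_inj; exact: kcompf1.
Defined.

Definition FS0_incl : linFun kFS0 kFS.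
Proof.
by refine (@LinFun k kFS0 kFS (fun X => X) (fun X Y x => smval x) _ _ _).
Defined.

Lemma bij_bijective U V (s : bij U V) : bijective (val s).
Proof.
have /bijbP[i h] := valP s; apply: inj_card_bij => //.
have hV v : exists u, val s u == v by have [u <-] := h v; exists u.
apply: (@leq_card _ _ (fun v => xchoose (hV v))) => v1 v2 e.
by rewrite -(eqP (xchooseP (hV v1))) e (eqP (xchooseP (hV v2))).
Qed.

Definition FSt_actl t X Y U (y : FStm 0 X Y) (x : FStm t U X) : FStm t U Y :=
  Subm (FSt_kcomp (smvalP y) (smvalP x)).

Definition FSt_actr t X U V (s : bij V U) (x : FStm t U X) : FStm t V X :=
  Subm (FSt_res_bij (bij_bijective s) (smvalP x)).

Definition FSt_mod (t : int) : bimod kFS0 kFBop.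
Proof.
refine (@bimod_of k kFS0 (opc FB) (fun X U => FStm t U X)
  (@FSt_actl t) (@FSt_actr t) _ _ _ _ _ _ _ _).
- by move=> X Y U m a f g; apply: val_inj; exact: kcomp_linl.
- by move=> X Y U f a m n; apply: val_inj; exact: kcomp_linr.
- by move=> X U m; apply: val_inj; exact: kcomp1f.
- by move=> X Y Z U g f m; apply/val_inj/esym; exact: kcompA.
- by move=> X U V f a m n; apply: val_inj; exact: res_linear.
- move=> X U m; apply: val_inj; rewrite /= -[RHS]res_id; apply: eq_res => u.
  by rewrite /= ffunE.
- move=> X U V W g f m; apply: val_inj; rewrite /= res_comp; apply: eq_res => u.
  by rewrite /= ffunE.
- move=> X Y U V f g m; apply/val_inj/esym; apply: res_kcomp; exact: smvalP.
Defined.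

End FSfiltration.

Arguments FSt : clear implicits.

Section Theta.
Variable k : fieldType.
Implicit Types (U V X Y : finType).

Definition FSt_in (t t' : int) U X : {pred FStm k t U X} :=
  fun x => smval x \in FSt k t' U X.
Arguments FSt_in : clear implicits.

Fact FSt_in_closed t t' U X : submod_closed (FSt_in t t' U X).
Proof.
split=> [|a x y xt yt]; first exact: (rpred0 (FSt k t' U X)).
exact: (rpredD (rpredZ a xt) yt).
Qed.

HB.instance Definition _ t t' U X :=
  GRing.isSubmodClosed.Build k (FStm k t U X) (FSt_in t t' U X)
    (FSt_in_closed t t' U X).

Fact FSt_in_l t t' X Y U (f : @lhom k (kFS0 k) X Y) (m : FSt_mod k t X U) :
  m \in FSt_in t t' U X -> bmactl f m \in FSt_in t t' U Y.
Proof. by move=> mt; apply: (FSt_kcomp (smvalP f)). Qed.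

Fact FSt_in_r t t' X U V (f : @lhom k (kFBop k) U V) (m : FSt_mod k t X U) :
  m \in FSt_in t t' U X -> bmactr f m \in FSt_in t t' V X.
Proof.
move=> mt; rewrite /= /lext; apply: rpred_sum => s _; apply: rpredZ.
exact: (FSt_res_bij (bij_bijective s) mt).
Qed.

(* kFS^{ell/(ell-1)} *)
Definition FSgr (ell : int) : bimod (kFS0 k) (kFBop k) :=
  @bimod_quot k _ _ (FSt_mod k ell) (fun X U => FSt_in ell (ell - 1) U X)
    (@FSt_in_l ell (ell - 1)) (@FSt_in_r ell (ell - 1)).

(** The Day convolution of kFS^0 with the trivial representation of S_ell: its
    value at (U, X) is the direct sum, over the subsets S of U whose complement
    has ell elements, of kFS^0(S, X). *)

Definition cosub (ell : nat) U := {S : {set U} | #|~: S| == ell}.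

Definition elts U (S : {set U}) : finType := {u : U | u \in S}.

Definition cosub_elts ell U (S : cosub ell U) : finType := elts (val S).

Lemma cosub_card ell U (S : cosub ell U) :
  #|U|%:Z - #|cosub_elts S|%:Z = ell%:Z.
Proof.
have := cardsC (val S); rewrite (eqP (valP S)) => <-.
by rewrite card_sig PoszD addrAC subrr add0r.
Qed.

Definition dayval (ell : nat) X U : lmodType k :=
  dirsum (fun S : cosub ell U => FStm k 0 (cosub_elts S) X).

Fact cosub_im_subproof ell V U (s : bij V U) (S : cosub ell V) :
  #|~: (val s @: val S)| == ell.
Proof.
have bs := bij_bijective s.
rewrite cardsCs setCK card_imset; last exact: bij_inj.
by rewrite -(bij_eq_card bs) -(cardsC (val S)) addKn (valP S).
Qed.

Definition cosub_im ell V U (s : bij V U) (S : cosub ell V) : cosub ell U :=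
  Sub (val s @: val S) (cosub_im_subproof s S).

(* The bijection S -> s(S) induced by s. *)
Definition elts_im V U (s : bij V U) (S : {set V}) (v : elts S) :
  elts (val s @: S) := Sub (val s (val v)) (imset_f (val s) (valP v)).

Lemma elts_im_bij V U (s : bij V U) (S : {set V}) : bijective (@elts_im V U s S).
Proof.
have i := bij_inj (bij_bijective s).
apply: inj_card_bij; last by rewrite !card_sig card_imset.
by move=> u v /(congr1 val) /= /i /val_inj.
Qed.

Definition day_actl ell X Y U (y : FStm k 0 X Y) : dayval ell X U -> dayval ell Y U :=
  dsmap (fun S : cosub ell U => @bmactl_linr _ _ _ (FSt_mod k 0) X Y (cosub_elts S) y).

Definition day_actr ell X U V (s : bij V U) (m : dayval ell X U) : dayval ell X V :=
  DirSum (finsupp_fin (fun S : cosub ell V =>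
    Subm (FSt_res_bij (elts_im_bij s (val S)) (smvalP (m (cosub_im s S))))
    : FStm k 0 (cosub_elts S) X)).

Lemma eq_day_res ell X U (W : finType) (m : dayval ell X U) (S1 S2 : cosub ell U)
    (j1 : W -> cosub_elts S1) (j2 : W -> cosub_elts S2) :
  S1 = S2 -> (forall w, val (j1 w) = val (j2 w)) ->
  res j1 (smval (m S1)) = res j2 (smval (m S2)).
Proof.
move=> eS; case: S2 / eS j2 => j2 e.
by apply: eq_res => w; apply: val_inj.
Qed.

Definition day_mod (ell : nat) : bimod (kFS0 k) (kFBop k).
Proof.
refine (@bimod_of k (kFS0 k) (opc FB) (dayval ell)
  (@day_actl ell) (@day_actr ell) _ _ _ _ _ _ _ _).
- by move=> X Y U m a f g; apply: dirsumP => S; apply: val_inj; exact: kcomp_linl.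
- by move=> X Y U f a m n; apply: dirsumP => S; apply: val_inj; exact: kcomp_linr.
- by move=> X U m; apply: dirsumP => S; apply: val_inj; exact: kcomp1f.
- by move=> X Y Z U g f m; apply: dirsumP => S; apply/val_inj/esym; exact: kcompA.
- by move=> X U V f a m n; apply: dirsumP => S; apply: val_inj; exact: res_linear.
- move=> X U m; apply: dirsumP => S; apply: val_inj.
  apply: etrans (res_id _).
  apply: (@eq_day_res ell X U _ m (cosub_im (@fid FB U) S) S
           (@elts_im U U (@fid FB U) (val S)) id) => [|u]; last by rewrite /= ffunE.
  apply/val_inj/setP => u /=; apply/imsetP/idP => [[v vS ->]|uS].
    by rewrite ffunE.
  by exists u; rewrite // ffunE.
- move=> X U V W g f m; apply: dirsumP => S; apply: val_inj.
  apply: etrans (esym (res_comp _ _ _)).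
  apply: (@eq_day_res ell X U _ m (cosub_im (@fcomp FB W V U f g) S)
           (cosub_im f (cosub_im g S)) (@elts_im W U (@fcomp FB W V U f g) (val S))
           (@elts_im V U f _ \o @elts_im W V g (val S))) => [|u];
    last by rewrite /= ffunE.
  apply/val_inj/setP => u /=; apply/imsetP/imsetP => [[v vS ->]|[v /imsetP[w wS ->] ->]].
    by exists (val g v); [apply: imset_f|rewrite ffunE].
  by exists w => //; rewrite ffunE.
- move=> X Y U V f g m; apply: dirsumP => S; apply/val_inj/esym.
  by apply: res_kcomp; exact: smvalP.
Defined.

(** The map theta^ell, induced by x |-> (i_S^* x)_S. *)

Fact theta_subproof (ell : nat) X U (x : FStm k ell%:Z U X) (S : cosub ell U) :
  res (val : cosub_elts S -> U) (smval x) \in FSt k 0 (cosub_elts S) X.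
Proof.
rewrite -(subrr ell%:Z); apply: FSt_res (smvalP x); first exact: val_inj.
exact: cosub_card.
Qed.

Definition theta_pre (ell : nat) X U (x : FStm k ell%:Z U X) : dayval ell X U :=
  DirSum (finsupp_fin (fun S : cosub ell U =>
    Subm (theta_subproof x S) : FStm k 0 (cosub_elts S) X)).

Fact theta_pre_linear ell X U : linear (@theta_pre ell X U).
Proof. by move=> a x y; apply: dirsumP => S; apply: val_inj; exact: res_linear. Qed.

Fact theta_pre0 ell X U (x : FStm k ell%:Z U X) :
  x \in FSt_in ell%:Z (ell%:Z - 1) U X -> theta_pre x = 0.
Proof.
move=> /FStP x0; apply: dirsumP => S; apply: val_inj; apply: x0; first exact: val_inj.
by rewrite subrK cosub_card.
Qed.

Definition theta_map ell X U : FSgr ell%:Z X U -> day_mod ell X U :=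
  quot_lift (@theta_pre ell X U).

Lemma theta_mapE ell X U (x : FStm k ell%:Z U X) :
  theta_map (quot_proj _ x) = theta_pre x.
Proof. by apply: quot_liftE; [exact: theta_pre_linear|exact: theta_pre0]. Qed.

Definition theta (ell : nat) : bimodHom (FSgr ell%:Z) (day_mod ell).
Proof.
refine (@BimodHom k _ _ (FSgr ell%:Z) (day_mod ell) (@theta_map ell) _ _ _).
- by move=> X U; apply: quot_lift_linear; [exact: theta_pre_linear|exact: theta_pre0].
- move=> X Y U f m; rewrite -[m]quot_reprK [bmactl _ _]qactlE; last exact: FSt_in_l.
  rewrite !theta_mapE; apply: dirsumP => S; apply: val_inj.
  by apply: res_kcomp; exact: smvalP.
move=> X U V f m; rewrite -[m]quot_reprK [bmactr _ _]qactrE; last exact: FSt_in_r.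
rewrite !theta_mapE /= (lin_lext _ (@theta_pre_linear ell X V)); apply: eq_lext => s /=.
apply: dirsumP => S; apply: val_inj; rewrite /= !res_comp.
exact: eq_res.
Defined.

End Theta.

Section SpanMod.
Variables (k : fieldType) (C : finCat) (T : C -> finType).
Variable tm : forall X Y, fhom X Y -> T X -> T Y.
Hypothesis tm1 : forall X r, tm (fid X) r = r.
Hypothesis tmM : forall X Y Z (g : fhom Y Z) (f : fhom X Y) r,
  tm (fcomp g f) r = tm g (tm f r).

Definition push X Y (f : fhom X Y) : free_mod k (T X) -> free_mod k (T Y) :=
  lext (fun r => bas k (tm f r)).

Variable E : forall X, seq (free_mod k (T X)).
Hypothesis E_stable : forall X Y (f : fhom X Y) x, x \in E X -> push f x \in E Y.

Definition span_val X : vectType k := subvs_of <<E X>>%VS.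

Definition span_act X Y (f : fhom X Y) (m : span_val X) : span_val Y :=
  vsproj <<E Y>>%VS (push f (vsval m)).

Lemma push_span X Y (f : fhom X Y) x : x \in <<E X>>%VS -> push f x \in <<E Y>>%VS.
Proof.
move=> /(@coord_span _ _ _ (in_tuple (E X)))->.
rewrite /push (lin_sumZ (lext_linear _)); apply: rpred_sum => i _; apply: rpredZ.
by apply/memv_span/E_stable; rewrite mem_nth.
Qed.

Lemma span_actE X Y (f : fhom X Y) (m : span_val X) :
  vsval (span_act f m) = push f (vsval m).
Proof. by rewrite /span_act vsprojK // push_span // subvsP. Qed.

(* The submodule of k[T -] spanned by the families E. *)
Definition span_mod : fdMod (kcat k C).
Proof.
apply: (@fdMod_of k C span_val span_act).
- by move=> X Y f a m n; apply: val_inj; rewrite /= !span_actE; exact: lext_linear.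
- move=> X m; apply: val_inj; rewrite /= span_actE [RHS]free_modE.
  by apply: eq_lext => r; rewrite tm1.
- move=> X Y Z g f m; apply: val_inj; rewrite /= !span_actE.
  rewrite /push (lin_lext _ (lext_linear _)); apply: eq_lext => r /=.
  by rewrite lext_bas tmM.
Defined.

End SpanMod.

Section Sign.
Variables (k : fieldType) (a : nat).

(* The alternating sum of the orderings of X obtained from the ordering b. *)
Definition alt_ord (X : finType) (b : {ffun 'I_a -> X}) :
  free_mod k {ffun 'I_a -> X} :=
  \sum_(s : 'S_a) (-1 : k) ^+ s *: bas k [ffun i => b (s i)].

Definition sgn_gens (X : finType) : seq (free_mod k {ffun 'I_a -> X}) :=
  [seq alt_ord b | b in [pred b : {ffun 'I_a -> X} | bijb b]].

Definition ord_map (X Y : FB) (f : fhom X Y) (b : {ffun 'I_a -> X}) :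
  {ffun 'I_a -> Y} := fcompose (val f) b.

Fact sgn_gens_stable (X Y : FB) (f : fhom X Y) x :
  x \in sgn_gens X -> push (T := fun X : FB => {ffun 'I_a -> X}) ord_map f x \in sgn_gens Y.
Proof.
case/imageP => b bb ->; rewrite /push /alt_ord (lin_sumZ (lext_linear _)).
apply/imageP; exists (ord_map f b).
  by rewrite inE; apply: bijb_comp; [exact: valP|].
by apply: eq_bigr => s _; rewrite lext_bas; congr (_ *: bas k _);
  apply/ffunP => i; rewrite !ffunE.
Qed.

(** sgn_a: the line spanned by the alternating sum of the orderings of X, if X
    has a elements, and 0 otherwise. *)
Definition sgn_mod : fdMod (kFB k).
Proof.
apply: (@span_mod k FB (fun X => {ffun 'I_a -> X}) ord_map _ _ sgn_gens).
- by move=> X r; apply/ffunP => i; rewrite !ffunE.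
- by move=> X Y Z g f r; apply/ffunP => i; rewrite !ffunE.
- exact: sgn_gens_stable.
Defined.

Lemma alt_ord_perm (X : finType) (b : {ffun 'I_a -> X}) (q : 'S_a) :
  alt_ord [ffun i => b (q i)] = (-1 : k) ^+ q *: alt_ord b.
Proof.
rewrite /alt_ord scaler_sumr [RHS](reindex_inj (mulIg q)) /=; apply: eq_bigr => s _.
rewrite scalerA; have -> : (-1) ^+ q * (-1) ^+ (s * q)%g = (-1) ^+ s :> k.
  by rewrite odd_permM [X in _ * X]signr_addb mulrCA -signr_addb addbb mulr1.
by congr (_ *: bas k _); apply/ffunP => i; rewrite !ffunE permM.
Qed.

Lemma alt_ord_act (X : finType) (b : {ffun 'I_a -> X}) (p : {perm X}) : bijb b ->
  alt_ord [ffun i => p (b i)] = (-1 : k) ^+ p *: alt_ord b.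
Proof.
move=> bb; have [ts -> _] := prod_tpermP p.
elim: ts b bb => [|[x y] ts IH] b bb.
  rewrite big_nil odd_perm1 expr0 scale1r; congr alt_ord.
  by apply/ffunP => i; rewrite !ffunE perm1.
rewrite big_cons odd_permM [X in X *: _]signr_addb mulrC -scalerA.
have /bijbP[ib sb] := bb; have [i0 ex] := sb x; have [j0 ey] := sb y.
have {1}-> : [ffun i => (tperm x y * \prod_(t <- ts) tperm t.1 t.2)%g (b i)]
           = [ffun i => (\prod_(t <- ts) tperm t.1 t.2)%g
                ([ffun i => b (tperm i0 j0 i)] i)] :> {ffun 'I_a -> X}.
  apply/ffunP => i; rewrite !ffunE permM; congr (_ _).
  by rewrite -ex -ey (inj_tperm _ _ _ ib).
rewrite IH.
  congr (_ *: _); rewrite alt_ord_perm !odd_tperm.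
  by rewrite -ex -ey (inj_eq ib).
have -> : [ffun i => b (tperm i0 j0 i)] = fcompose b [ffun i => tperm i0 j0 i].
  by apply/ffunP => i; rewrite !ffunE.
apply: bijb_comp => //; apply/bijbP; split=> [u v|u].
  by rewrite !ffunE => /perm_inj.
by exists (tperm i0 j0 u); rewrite ffunE tpermK.
Qed.

(* Sanity checks: S_a acts on sgn_a by the sign, and sgn_a is a line. *)

Lemma sgn_mod_act (X : finType) (p : {perm X}) (f : bij X X) (m : sgn_mod X) :
  val f =1 p -> @fdact k (kFB k) sgn_mod X X (bas k f) m = (-1 : k) ^+ p *: m.
Proof.
move=> fp; rewrite /= lext_bas; apply: val_inj; rewrite /= span_actE; last first.
  exact: sgn_gens_stable.
rewrite (coord_span (X := in_tuple (sgn_gens X)) (subvsP m)).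
rewrite /push (lin_sumZ (lext_linear _)) scaler_sumr; apply: eq_bigr => i _.
rewrite scalerA mulrC -scalerA; congr (_ *: _).
have /imageP[b bb ->] : (in_tuple (sgn_gens X))`_i \in sgn_gens X by rewrite mem_nth.
rewrite -(alt_ord_act p bb) /alt_ord (lin_sumZ (lext_linear _)); apply: eq_bigr => s _.
by rewrite lext_bas; congr (_ *: bas k _); apply/ffunP => j; rewrite !ffunE fp.
Qed.

Lemma alt_ord_neq0 (X : finType) (b : {ffun 'I_a -> X}) : bijb b -> alt_ord b != 0.
Proof.
move=> /bijbP[ib _]; apply/eqP => /ffunP/(_ b)/eqP.
rewrite /alt_ord sum_ffunE (bigD1 1%g) //= big1 => [|s s1].
  have -> : [ffun i => b (perm_one 'I_a i)] = b :> {ffun 'I_a -> X}.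
    by apply/ffunP => i; rewrite ffunE permE.
  by rewrite !ffunE eqxx addr0 odd_perm1 expr0 scale1r oner_eq0.
rewrite !ffunE; case: eqP => [e|_]; last by rewrite scaler0.
case/eqP: s1; apply/permP => i; rewrite perm1; apply: ib.
by rewrite [in RHS]e ffunE.
Qed.

Lemma sgn_mod_dim (X : finType) : \dim {: sgn_mod X} = (#|X| == a).
Proof.
rewrite dimvf; have -> : dim (sgn_mod X) = \dim <<sgn_gens X>>%VS by [].
case: eqP => [eX|nX]; last first.
  have -> : sgn_gens X = [::].
    rewrite /sgn_gens /image_mem; case E : (enum _) => [//|b s].
    have : b \in enum [pred b : {ffun 'I_a -> X} | bijb b] by rewrite E mem_head.
    rewrite mem_enum inE => bb; case: nX.
    by rewrite -(bij_eq_card (bij_bijective (exist _ b bb))) card_ord.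
  by rewrite span_nil dimv0.
pose b : {ffun 'I_a -> X} := [ffun i => enum_val (cast_ord (esym eX) i)].
have bb : bijb b.
  apply/bijbP; split=> [i j|x].
    by rewrite !ffunE => /enum_val_inj/cast_ord_inj.
  by exists (cast_ord eX (enum_rank x)); rewrite ffunE cast_ordK enum_rankK.
suff -> : <<sgn_gens X>>%VS = <[alt_ord b]>%VS by rewrite dim_vline alt_ord_neq0.
apply/eqP; rewrite eqEsubv; apply/andP; split; last first.
  by rewrite -memvE memv_span // image_f.
apply/span_subvP => _ /imageP[c bc ->].
have /bijbP[ib sb] := bb; have /bijbP[ic _] := bc.
have hq i : exists j, b j == c i by have [j <-] := sb (c i); exists j.
have q_inj : injective (fun i => xchoose (hq i)).
  move=> i j e; apply: ic; rewrite -(eqP (xchooseP (hq i))) e.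
  exact: eqP (xchooseP (hq j)).
have -> : c = [ffun i => b (perm q_inj i)].
  by apply/ffunP => i; rewrite ffunE permE (eqP (xchooseP (hq i))).
by rewrite alt_ord_perm memvZ // memv_line.
Qed.

End Sign.

Section Specht.
Variables (k : fieldType) (la : seq nat).

(* Cells (i, j) of the Young diagram of the partition la. *)
Definition cell : finType := {i : 'I_(size la) & 'I_(nth 0%N la i)}.
Definition cell_row (c : cell) : 'I_(size la) := tag c.
Definition cell_col (c : cell) : nat := tagged c.

Definition col_stab (p : {perm cell}) : bool :=
  [forall c, cell_col (p c) == cell_col c].

(* A tableau t is given by the position t u of each entry u, the corresponding
   tabloid by the row of each entry. *)
Definition polytabloid (U : finType) (t : {ffun U -> cell}) :
  free_mod k {ffun U -> 'I_(size la)} :=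
  \sum_(p : {perm cell} | col_stab p)
     (-1 : k) ^+ p *: bas k [ffun u => cell_row (p (t u))].

Definition specht_gens (U : finType) : seq (free_mod k {ffun U -> 'I_(size la)}) :=
  [seq polytabloid t | t in [pred t : {ffun U -> cell} | bijb t]].

Definition row_map (U V : opc FB) (s : fhom U V) (r : {ffun U -> 'I_(size la)}) :
  {ffun V -> 'I_(size la)} := fcompose r (val s).

Fact specht_gens_stable (U V : opc FB) (s : fhom U V) x :
  x \in specht_gens U ->
  push (T := fun U : opc FB => {ffun U -> 'I_(size la)}) row_map s x \in specht_gens V.
Proof.
case/imageP => t bt ->; rewrite /push /polytabloid (lin_sumZ (lext_linear _)).
apply/imageP; exists (fcompose t (val s)).
  by rewrite inE; apply: bijb_comp => //; exact: valP.
by apply: eq_bigr => p _; rewrite lext_bas; congr (_ *: bas k _);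
  apply/ffunP => i; rewrite !ffunE.
Qed.

(** The Specht module S_la, as a kFB^op-module supported on sets with |la|
    elements. *)
Definition specht_mod : fdMod (kFBop k).
Proof.
apply: (@span_mod k (opc FB) (fun U => {ffun U -> 'I_(size la)}) row_map _ _
  specht_gens).
- by move=> X r; apply/ffunP => i; rewrite !ffunE.
- by move=> X Y Z g f r; apply/ffunP => i; rewrite !ffunE.
- exact: specht_gens_stable.
Defined.

End Specht.

(* Sanity check: S_(b) is the trivial representation. *)
Lemma specht_row_act (k : fieldType) (b : nat) (U : finType) (s : bij U U)
    (m : specht_mod k [:: b] U) :
  @fdact k (kFBop k) (specht_mod k [:: b]) U U (bas k s) m = m.
Proof.
rewrite /= lext_bas; apply: val_inj; rewrite /= span_actE; last first.
  exact: (@specht_gens_stable k [:: b]).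
rewrite [RHS]free_modE; apply: eq_lext => r; congr (bas k _).
by apply/ffunP => u; rewrite [LHS]ord1 [RHS]ord1.
Qed.

Definition hook (ell a : nat) : seq nat := ell :: nseq a 1%N.

(* The direct sum of the sgn_a [x] S_(ell, 1^a), over kFB and kFB^op. *)
Definition hook_sum (k : fieldType) (ell : nat) : bimod (kFB k) (kFBop k) :=
  bimod_sum (fun a : nat => bimod_ext (sgn_mod k a) (specht_mod k (hook ell a))).

Definition hook_coker (k : fieldType) (ell : nat) : bimod (kFS0 k) (kFBop k) :=
  bimod_restr (linFun_comp (aug k) (FS0_incl k)) (hook_sum k ell).

(* Main.v *)
(* Write k[X^U] for the span of all maps U -> X. As a functor of U under
   restriction it splits: after choosing x0 in X, an element of k[X^S] killed by
   every restriction to S minus a point lifts to U by sending U \ S to x0, and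
   the lift restricts to 0 on the other subsets of size |S|. So theta^ell is onto
   at (U, X) as soon as every element of kFS^0(S, X) comes from an element of
   k[X^S] whose restrictions vanish modulo maps missing some x <> x0. The
   obstruction is a class in the first Koszul cohomology of kFS(-, X \ x0) on S.
   Induction on X shows that the i-th Koszul cohomology of kFS(-, Y) on S is 0
   for i > 0 unless |S| = |Y| + i; hence theta^ell is onto unless |S| = |X|.

   If |S| = |X| = a, the target of theta^ell has as basis the partial bijections
   from U onto X, and theta^ell sends f to the sum of its sections. Modulo these
   sums the basis is alternating in X (as f1 + f2 - f3 shows, for three
   surjections differing on two fibres), and it satisfies one linear relation for
   each x in X. Polytabloids of shape (ell, 1^a) are alternating along the first
   column and satisfy the Garnir relations, so that the Young symmetrizer gives
   maps both ways between the cokernel and sgn_a [x] S_(ell, 1^a), mutually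
   inverse up to a positive integer. *)
Require Import Defs.
From HB Require Import structures.
From mathcomp Require Import all_boot all_order all_fingroup all_algebra.
From mathcomp Require Import boolp.

Set Implicit Arguments.
Unset Strict Implicit.
Unset Printing Implicit Defensive.

Import GRing.Theory VectorInternalTheory.
Local Open Scope ring_scope.

Arguments FSt : clear implicits.

(** * Koszul complexes of partial maps *)

(** The hook sum vanishes off the diagonal |U| = ell + |X|, because sgn_a is supported on |X| = a
    and S_(ell,1^a) on |U| = ell + a. Exactness there says that theta^ell is bijective, and
    injectivity holds everywhere for a formal reason. On the diagonal kFS^0(S, X) is all of kFS(S,
    X), so that both ends of the comparison have explicit generators. Maps defined on different
    subsets S must be compared throughout: in the Koszul complex, in the Day convolution and in the
    hook modules. Encoding each of them as a partial map with values in [option X] places them all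
    in one finite type and avoids transport between the types of elements of varying subsets. *)

Lemma natr_neq0 (k : fieldType) (n : nat) :
  [pchar k] =i pred0 -> (0 < n)%N -> n%:R != 0 :> k.
Proof.
move=> char0 n0; apply/negP => /(natf0_pchar n0)[q].
by rewrite char0.
Qed.

Lemma eq_opp0 (k : fieldType) (V : lmodType k) (v : V) :
  [pchar k] =i pred0 -> v = - v -> v = 0.
Proof.
move=> char0 e; have : 2%:R *: v = 0 by rewrite scaler_nat mulr2n {2}e subrr.
by move/eqP; rewrite scaler_eq0 (negPf (natr_neq0 char0 _)) //= => /eqP.
Qed.

Section Koszul.
Variables (k : fieldType) (S X : finType).
Hypothesis char0 : [pchar k] =i pred0.

Implicit Types (phi : {ffun S -> option X}) (Y : {set X}) (s t : S) (x : X).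
Implicit Types (c b : {ffun S -> option X} -> k).

Definition upd phi s (o : option X) : {ffun S -> option X} :=
  [ffun v => if v == s then o else phi v].

Definition undef phi : {set S} := [set s | phi s == None].

Definition pimg phi : {set X} := [set x | [exists s, phi s == Some x]].

(** The sign of contracting s out of the exterior monomial on A, for the order of S given by
    [enum_rank]. *)
Definition ksign s (A : {set S}) : k :=
  (-1) ^+ #|[set v in A | (enum_rank v < enum_rank s)%N]|.

(* A partial map stands for a map on its domain T, in degree |S \ T|; a cochain c
   is given by its coefficients, so that restriction becomes a sum over fibres. *)
Definition kdiff Y c phi : k :=
  \sum_(s in undef phi) ksign s (undef phi) * \sum_(x in Y) c (upd phi s (Some x)).

Lemma pimgP phi x : reflect (exists s, phi s = Some x) (x \in pimg phi).
Proof. by rewrite inE; apply: (iffP existsP) => -[s e]; exists s; apply/eqP. Qed.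

Lemma updE phi s o v : upd phi s o v = if v == s then o else phi v.
Proof. by rewrite ffunE. Qed.

Lemma upd_same phi s o o' : upd (upd phi s o) s o' = upd phi s o'.
Proof. by apply/ffunP => v; rewrite !ffunE; case: eqP. Qed.

Lemma updC phi s t o o' : s != t -> upd (upd phi s o) t o' = upd (upd phi t o') s o.
Proof.
move=> st; apply/ffunP => v; rewrite !ffunE.
by case: (eqVneq v t) => // ->; rewrite eq_sym (negPf st).
Qed.

Lemma upd_id phi s : upd phi s (phi s) = phi.
Proof. by apply/ffunP => v; rewrite ffunE; case: eqP => [->|]. Qed.

Lemma undef_upd phi s x : undef (upd phi s (Some x)) = undef phi :\ s.
Proof. by apply/setP => v; rewrite !inE updE; case: (v =P s). Qed.

Lemma undef_updN phi s : undef (upd phi s None) = s |: undef phi.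
Proof. by apply/setP => v; rewrite !inE updE; case: (v =P s). Qed.

Lemma pimg_upd phi s x : s \in undef phi -> pimg (upd phi s (Some x)) = x |: pimg phi.
Proof.
rewrite inE => /eqP es; apply/setP => y; rewrite in_setU1.
apply/pimgP/orP => [[v]|[/eqP->|/pimgP[v ev]]].
- by rewrite updE; case: eqP => [_ [->]|_ e]; [left|right; apply/pimgP; exists v].
- by exists s; rewrite updE eqxx.
by exists v; rewrite updE; case: eqP => // evs; rewrite evs es in ev.
Qed.

Lemma ksign2 s (A : {set S}) : ksign s A * ksign s A = 1.
Proof. by rewrite -expr2 sqrr_sign. Qed.

(** Removing the later of two elements does not affect the sign of the earlier one; removing the
    earlier one flips the sign of the later. *)
Lemma ksign_swap s t (A : {set S}) : s \in A -> t \in A -> s != t ->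
  ksign s A * ksign t (A :\ s) = - (ksign t A * ksign s (A :\ t)).
Proof.
wlog lst : s t / (enum_rank s < enum_rank t)%N => [IH sA tA st|].
  have [lst|lts|/val_inj/enum_rank_inj est] := ltngtP (enum_rank s) (enum_rank t).
  - exact: IH.
  - by rewrite (IH t s) ?opprK // eq_sym.
  - by rewrite est eqxx in st.
move=> sA tA st.
have -> : ksign s (A :\ t) = ksign s A.
  congr (_ ^+ _); apply: eq_card => v; rewrite !inE.
  by case: (eqVneq v t) => [->|] //=; rewrite ltnNge (ltnW lst) andbF.
have -> : ksign t A = - ksign t (A :\ s).
  rewrite /ksign (cardsD1 s) inE sA lst /= exprS mulN1r; congr (- (_ ^+ _)).
  by apply: eq_card => v; rewrite !inE andbA.
by rewrite mulNr opprK mulrC.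
Qed.

(** Filling two undefined points in either order gives the same map with opposite signs, so the
    double sum over ordered pairs is its own negative, hence 0 as 2 is invertible. *)
Lemma kdiff_kdiff Y c phi : kdiff Y (kdiff Y c) phi = 0.
Proof.
pose G (i j : S * X) := ksign i.1 (undef phi) * ksign j.1 (undef phi :\ i.1) *
   c (upd (upd phi i.1 (Some i.2)) j.1 (Some j.2)).
pose P (i : S * X) := (i.1 \in undef phi) && (i.2 \in Y).
have -> : kdiff Y (kdiff Y c) phi
    = \sum_(i | P i) \sum_(j | P j && (i.1 != j.1)) G i j.
  rewrite -[RHS](pair_big_dep (mem (undef phi)) (fun _ x => x \in Y)
    (fun s x => \sum_(j | P j && (s != j.1)) G (s, x) j)) /=.
  apply: eq_bigr => s sU; rewrite mulr_sumr; apply: eq_bigr => x xY.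
  rewrite /kdiff undef_upd mulr_sumr.
  rewrite (eq_bigl (fun j => ((j.1 \in undef phi :\ s) && (j.2 \in Y)))); last first.
    by move=> j; rewrite /P !inE (eq_sym s) andbC andbA.
  rewrite -(pair_big_dep (mem (undef phi :\ s)) (fun _ x => x \in Y)
    (fun t y => G (s, x) (t, y))) /=.
  apply: eq_bigr => t tU; rewrite mulrA mulr_sumr; apply: eq_bigr => y yY.
  by rewrite /G.
apply: (eq_opp0 (V := k^o) char0).
rewrite {1}(exchange_big_dep P) /= => [|i j _ /andP[]//]; rewrite -sumrN.
apply: eq_bigr => j Pj; rewrite -sumrN; apply: eq_big => i.
  by rewrite Pj eq_sym.
move=> /and3P[Pi _ nij]; have [/andP[iU _] /andP[jU _]] := (Pi, Pj).
by rewrite /G -mulNr -ksign_swap // (updC _ _ _ nij).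
Qed.

Lemma eq_kdiff Y c b phi :
  (forall s x, s \in undef phi -> x \in Y ->
     c (upd phi s (Some x)) = b (upd phi s (Some x))) ->
  kdiff Y c phi = kdiff Y b phi.
Proof.
by move=> e; apply: eq_bigr => s sU; congr (_ * _); apply: eq_bigr => x; exact: e.
Qed.

Lemma kdiffB Y c b phi :
  kdiff Y (fun psi => c psi - b psi) phi = kdiff Y c phi - kdiff Y b phi.
Proof. by rewrite /kdiff -sumrB; apply: eq_bigr => s _; rewrite sumrB mulrBr. Qed.

(* The partial maps S -> Y2 that index the degree i part of the Koszul complex of
   k[Y2^S] modulo the maps that do not hit all of Y1. *)
Definition between Y1 Y2 i phi :=
  [&& Y1 \subset pimg phi, pimg phi \subset Y2 & #|undef phi| == i].

Lemma between_upd Y1 Y2 i phi s x : between Y1 Y2 i.+1 phi ->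
  s \in undef phi -> x \in Y2 -> between Y1 Y2 i (upd phi s (Some x)).
Proof.
case/and3P => Y1i iY2 /eqP ei sU xY; rewrite /between pimg_upd // undef_upd.
apply/and3P; split; first exact: subset_trans Y1i (subsetUr _ _).
  by rewrite subUset sub1set xY.
by move: ei; rewrite (cardsD1 s) sU add1n => -[->].
Qed.

Lemma between_updN Y1 x0 i phi s : x0 \notin Y1 -> between Y1 (x0 |: Y1) i phi ->
  phi s = Some x0 -> between Y1 (x0 |: Y1) i.+1 (upd phi s None).
Proof.
move=> x0Y /and3P[Y1i iY2 /eqP ei] es; apply/and3P; split.
- apply/subsetP => x xY; have /pimgP[v ev] := subsetP Y1i x xY.
  apply/pimgP; exists v; rewrite updE; case: eqP => // evs.
  by move: x0Y xY; rewrite -evs ev in es; case: es => -> /negPf->.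
- apply/(subset_trans _ iY2)/subsetP => x /pimgP[v].
  by rewrite updE; case: eqP => // _ ev; apply/pimgP; exists v.
by rewrite undef_updN cardsU1 inE es ei.
Qed.

(** * Acyclicity modulo the maps that miss a point of Y *)

Section Contraction.
Variables (Y : {set X}) (x0 : X) (i : nat) (c : {ffun S -> option X} -> k).
Hypothesis x0Y : x0 \notin Y.
Let Y2 := x0 |: Y.
Hypothesis cocy : forall phi, between Y Y2 i.+1 phi -> kdiff Y2 c phi = 0.

(* One makes the difference vanish on the maps undefined at some element of R,
   adding the elements of R one at a time. *)
Lemma kdiff_contract_on (R : seq S) : exists b, forall phi,
  between Y Y2 i phi -> has (mem (undef phi)) R -> c phi = kdiff Y2 b phi.
Proof.
elim: R => [|s0 R [b IH]]; first by exists (fun _ => 0).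
pose c1 phi := c phi - kdiff Y2 b phi.
have c1_cocy phi : between Y Y2 i.+1 phi -> kdiff Y2 c1 phi = 0.
  by move=> /cocy e; rewrite kdiffB e kdiff_kdiff subr0.
have c1R phi : between Y Y2 i phi -> has (mem (undef phi)) R -> c1 phi = 0.
  by move=> bphi /(IH _ bphi) e; rewrite /c1 e subrr.
(* The homotopy forgets s0 when its value is x0. As x0 is not in Y, this keeps the condition that Y
   be covered. *)
pose b1 phi := if phi s0 == Some x0 then
  ksign s0 (undef (upd phi s0 None)) * c1 (upd phi s0 None) else 0.
exists (fun phi => b phi - - b1 phi) => phi bphi phiR; rewrite kdiffB.
suff e1 : c1 phi = kdiff Y2 b1 phi.
  have -> : kdiff Y2 (fun psi => - b1 psi) phi = - kdiff Y2 b1 phi.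
    rewrite -[RHS]sub0r -[in RHS](_ : kdiff Y2 (fun=> 0) phi = 0).
      by rewrite -kdiffB; apply: eq_kdiff => *; rewrite sub0r.
    by rewrite /kdiff big1 // => s _; rewrite big1 ?mulr0.
  by rewrite opprK -e1 /c1 addrC subrK.
have [s0U|s0U] := boolP (s0 \in undef phi).
  rewrite /kdiff (bigD1 s0) //= [X in _ + X]big1 => [|s /andP[sU ns]]; last first.
    rewrite big1 ?mulr0 // => x _; rewrite /b1 updE (eq_sym s0) (negPf ns).
    by move: s0U; rewrite inE => /eqP->.
  rewrite addr0 (bigD1 x0) ?setU11 //= big1 => [|x /andP[_ nx]]; last first.
    by rewrite /b1 updE eqxx /eq_op /= (negPf nx).
  rewrite /b1 updE !eqxx addr0 upd_same.
  have -> : upd phi s0 None = phi.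
    by rewrite -[RHS](upd_id _ s0); congr upd; apply/esym/eqP; rewrite inE in s0U.
  by rewrite mulrA ksign2 mul1r.
have {}phiR : has (mem (undef phi)) R by move: phiR; rewrite /= (negPf s0U).
rewrite c1R //; apply/esym.
have [es0|ns0] := eqVneq (phi s0) (Some x0); last first.
  rewrite /kdiff big1 // => s sU; rewrite big1 ?mulr0 // => x _.
  rewrite /b1 updE; case: (s0 =P s) => [ess|_]; first by rewrite ess sU in s0U.
  by rewrite (negPf ns0).
have bphi' := between_updN x0Y bphi es0.
have /hasP[s1 s1R /= s1U] := phiR.
have ns01 : s0 != s1 by apply: contraNneq s0U => ->.
have s1U' : s1 \in undef (upd phi s0 None) by rewrite undef_updN in_setU1 s1U orbT.
(* In the cocycle condition at phi with s0 forgotten, filling any point other than s1 leaves s1 in R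
   undefined, where [c1] vanishes; only the terms at s1 remain. *)
have sum0 : \sum_(x in Y2) c1 (upd (upd phi s0 None) s1 (Some x)) = 0.
  have := c1_cocy _ bphi'; rewrite /kdiff (bigD1 s1) //= [X in _ + X]big1.
    rewrite addr0 => /(congr1 (fun z => ksign s1 (undef (upd phi s0 None)) * z)).
    by rewrite mulrA ksign2 mul1r mulr0.
  move=> s /andP[sU ns]; rewrite big1 ?mulr0 // => x xY; apply: c1R.
    exact: between_upd.
  by apply/hasP; exists s1 => //=; rewrite undef_upd in_setD1 s1U' eq_sym ns.
rewrite /kdiff big1 // => s sU; have ns0 : s != s0 by apply: contraNneq s0U => <-.
under eq_bigr => x _.
  rewrite /b1 updE (eq_sym s0) (negPf ns0) es0 eqxx updC //.
  rewrite undef_upd; over.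
rewrite -mulr_sumr; have [->|ns1] := eqVneq s s1; first by rewrite sum0 !mulr0.
rewrite big1 ?mulr0 // => x xY; apply: c1R.
  by apply: between_upd => //; rewrite undef_updN in_setU1 sU orbT.
by apply/hasP; exists s1 => //=; rewrite undef_upd in_setD1 s1U' eq_sym ns1.
Qed.

Lemma kdiff_contract : (0 < i)%N -> exists b, forall phi,
  between Y Y2 i phi -> c phi = kdiff Y2 b phi.
Proof.
move=> i0; have [b hb] := kdiff_contract_on (enum S); exists b => phi bphi.
apply: hb => //; have /and3P[_ _ /eqP ei] := bphi.
by move: i0; rewrite -ei => /card_gt0P[s sU]; apply/hasP; exists s; rewrite ?mem_enum.
Qed.

End Contraction.

(** Exactness in degree i of the Koszul complex of kFS(-, Y): [between Y Y] means that the image is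
    exactly Y. *)
Definition kexact Y i := forall c,
  (forall phi, between Y Y i.+1 phi -> kdiff Y c phi = 0) ->
  exists b, forall phi, between Y Y i phi -> c phi = kdiff Y b phi.

(* Extend c by zero to the maps missing x0; the defect is a cocycle for Y, in
   one degree higher. *)
Lemma kdiff_extend Y x0 i c : x0 \notin Y -> kexact Y i.+1 ->
  (forall phi, between (x0 |: Y) (x0 |: Y) i.+1 phi -> kdiff (x0 |: Y) c phi = 0) ->
  exists2 b, forall phi, between (x0 |: Y) (x0 |: Y) i phi -> b phi = c phi &
    forall phi, between Y (x0 |: Y) i.+1 phi -> kdiff (x0 |: Y) b phi = 0.
Proof.
move=> x0Y exY cocy.
pose c0 phi := if x0 \in pimg phi then c phi else 0.
have c0_cocy phi : x0 \in pimg phi -> kdiff (x0 |: Y) c0 phi = kdiff (x0 |: Y) c phi.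
  by move=> hx; apply: eq_kdiff => s x sU xY; rewrite /c0 pimg_upd // in_setU1 hx orbT.
have pimgY phi j : between Y Y j phi -> x0 \notin pimg phi.
  by case/and3P => _ iY _; apply: contra x0Y => /(subsetP iY).
have Y_upd phi j s : between Y Y j.+1 phi -> s \in undef phi ->
    between (x0 |: Y) (x0 |: Y) j (upd phi s (Some x0)).
  move=> bphi sU; have /and3P[Yi iY /eqP ei] := bphi.
  rewrite /between pimg_upd // (_ : pimg phi = Y) ?subxx /=; last first.
    by apply/eqP; rewrite eqEsubset iY.
  by move: ei; rewrite undef_upd (cardsD1 s) sU add1n => -[->].
(* In d d c0 = 0 the terms with value x0 drop out, because d c0 = d c = 0 on the maps that hit x0;
   what remains is the differential over Y of the defect d c0. *)
have [phi bphi|b hb] := exY (kdiff (x0 |: Y) c0).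
  have := kdiff_kdiff (x0 |: Y) c0 phi; rewrite {1}/kdiff => e; apply: etrans e.
  apply: eq_bigr => s sU; congr (_ * _); rewrite [RHS]big_setU1 //=.
  rewrite [X in _ = X + _](_ : _ = 0) ?add0r //.
  rewrite c0_cocy ?pimg_upd ?setU11 //; apply: cocy; exact: Y_upd.
(* On maps missing x0 the defect is the differential of b over Y, so the value -b there cancels
   it. *)
exists (fun phi => if x0 \in pimg phi then c phi else - b phi).
  by move=> phi /and3P[Yi _ _]; rewrite (subsetP Yi) ?setU11.
move=> phi bphi; have /and3P[Yi iY ei] := bphi.
have [hx|hx] := boolP (x0 \in pimg phi).
  rewrite -(cocy phi); last by rewrite /between subUset sub1set hx Yi iY.
  by apply: eq_kdiff => s x sU xY; rewrite pimg_upd // in_setU1 hx orbT.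
have bY : between Y Y i.+1 phi.
  rewrite /between Yi ei andbT /=; apply/subsetP => x xi.
  by have := subsetP iY x xi; rewrite in_setU1; case: eqP => // ex; rewrite -ex xi in hx.
have e0 : kdiff (x0 |: Y) c0 phi - kdiff Y b phi = 0 by rewrite (hb _ bY) subrr.
rewrite -[RHS]e0 /kdiff -sumrB; apply: eq_bigr => s sU; rewrite -mulrBr; congr (_ * _).
rewrite !big_setU1 //= /c0 !pimg_upd // !setU11 -addrA -sumrB; congr (_ + _).
apply: eq_bigr => x xY; rewrite pimg_upd // in_setU1 (negPf hx) orbF.
by case: eqP => [ex|_]; [rewrite ex xY in x0Y|rewrite sub0r].
Qed.

(** Removing x0 from Y raises the degree by one, so the excluded value |Y| + i is the same all along
    the induction. *)
Lemma kexact_neq Y i : (0 < i)%N -> #|S| != (#|Y| + i)%N -> kexact Y i.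
Proof.
move: {2}#|Y| (leqnn #|Y|) => n; elim: n Y i => [|n IH] Y i.
  (* For empty Y the only map is the nowhere defined one, in degree |S|; there is nothing to check
     in degree i. *)
  rewrite leqn0 cards_eq0 => /eqP-> i0; rewrite cards0 add0n => nS c _.
  exists (fun=> 0) => phi /and3P[_ i0' /eqP ei]; case/eqP: nS; rewrite -ei.
  apply/esym/eq_card => s; rewrite !inE; case e : (phi s) => [x|] //.
  by have /(subsetP i0') : x \in pimg phi by [apply/pimgP; exists s]; rewrite inE.
move=> le i0 nS c cocy; have [Y0|[x0 x0Y]] := set_0Vmem Y.
  by apply: (IH Y i _ i0 nS) => //; rewrite Y0 cards0.
have eY := setD1K x0Y; have x0N : x0 \notin Y :\ x0 by rewrite setD11.
have cY : #|Y| = #|Y :\ x0|.+1 by rewrite (cardsD1 x0) x0Y.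
have exY : kexact (Y :\ x0) i.+1.
  by apply: IH => //; [rewrite -ltnS -cY|rewrite addnS -addSn -cY].
have [phi bphi|c' ec c'_cocy] := @kdiff_extend _ _ _ c x0N exY.
  by rewrite eY in bphi *; apply: cocy.
have [b hb] := kdiff_contract x0N c'_cocy i0.
exists b => phi bphi; rewrite -ec ?eY // hb; first by rewrite eY.
rewrite eY; have /and3P[Yi iY ei] := bphi.
by rewrite /between iY ei (subset_trans (subD1set _ _) Yi).
Qed.

End Koszul.

(** * Injectivity, and surjectivity off the diagonal *)

Section Coefficients.
Variable k : fieldType.
Implicit Types (S U V X Y : finType).

Lemma fsbasE U X (f : {ffun U -> X}) (g : surj U X) :
  fsbas k f g = (f == val g)%:R.
Proof.
rewrite /fsbas; case: insubP => [h _ <-|nf]; first by rewrite ffunE eq_sym.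
by rewrite ffunE; case: eqP => // e; rewrite e (valP g) in nf.
Qed.

Lemma resE V U X (i : V -> U) (x : @lhom k (kFS k) U X) (g : surj V X) :
  res i x g = \sum_(f : surj U X | [ffun v => val f (i v)] == val g) x f.
Proof.
rewrite /res /lext sum_ffunE [RHS]big_mkcond; apply: eq_bigr => f _.
by rewrite ffunE fsbasE /GRing.scale /=; case: eqP => _; rewrite ?mulr1 ?mulr0.
Qed.

Definition updf U X (h : {ffun U -> X}) (s : U) (x : X) : {ffun U -> X} :=
  [ffun v => if v == s then x else h v].

(** The sum is a coefficient of the restriction of m to S minus s, which is 0. The condition on h
    makes the restricted map surjective, hence a basis element. *)
Lemma FS0_sum (S X : finType) (m : @lhom k (kFS k) S X) (h : {ffun S -> X}) (s : S) :
  m \in FSt k 0 S X -> (forall x, exists2 v, v != s & h v = x) ->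
  \sum_(g : surj S X | [forall v, (v != s) ==> (val g v == h v)]) m g = 0.
Proof.
move=> /FStP m0 hs; pose T : finType := {v : S | v != s}.
have sg : surjb [ffun v : T => h (val v)].
  by apply/surjbP => x; have [v vs <-] := hs x; exists (exist _ v vs); rewrite ffunE.
have cT : #|S|%:Z - #|T|%:Z = 0 + 1.
  rewrite add0r card_sig (_ : #|[pred v | v != s]| = #|S|.-1); last by rewrite -(cardC1 s).
  have : (0 < #|S|)%N by apply/card_gt0P; exists s.
  by case: #|S| => // n _; rewrite succnK -addn1 PoszD addrAC subrr add0r.
pose g0 : surj T X := exist _ [ffun v : T => h (val v)] sg.
have := congr1 (fun y : @lhom k (kFS k) T X => y g0) (m0 T val val_inj cT).
rewrite resE ffunE => e; rewrite -[RHS]e.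
apply: eq_bigl => g; apply/forallP/eqP => [hg|/ffunP hg v].
  by apply/ffunP => v; rewrite !ffunE; apply/eqP; exact: (implyP (hg (val v)) (valP v)).
by apply/implyP => vs; have := hg (exist _ v vs); rewrite !ffunE => ->.
Qed.

(** This is [kdiff_extend] in degree 0 with Y = X minus x0: on total maps m is a cocycle by
    [FS0_sum]. The function c gives the element of k[X^S] to be lifted. *)
Lemma FS0_extend (S X : finType) (x0 : X) (m : @lhom k (kFS k) S X) :
  [pchar k] =i pred0 -> #|S| != #|X| -> m \in FSt k 0 S X ->
  exists2 c : {ffun S -> X} -> k, forall g : surj S X, c (val g) = m g &
    forall (h : {ffun S -> X}) s,
      (forall x, x != x0 -> exists2 v, v != s & h v = x) ->
      \sum_x c (updf h s x) = 0.
Proof.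
move=> char0 nSX m0; pose tot (h : {ffun S -> X}) : {ffun S -> option X} := [ffun v => Some (h v)].
have tot_inj : injective tot.
  by move=> h h' /ffunP e; apply/ffunP => v; have := e v; rewrite !ffunE => -[].
pose c phi := \sum_(g : surj S X | tot (val g) == phi) m g.
pose Y := [set~ x0]; have eY : x0 |: Y = setT by rewrite setUCr.
have x0Y : x0 \notin Y by rewrite !inE eqxx.
(* The excluded case |S| = |Y| + 1 is |S| = |X|. *)
have exY : kexact k S Y 1.
  apply: kexact_neq => //; rewrite cardsC1 addn1 prednK //.
  by apply/card_gt0P; exists x0.
have [phi|b eb b0] := kdiff_extend char0 (i := 0) (c := c) x0Y exY.
  rewrite eY => /and3P[iT _ /cards1P[s es]].
  have phiN v : v != s -> exists x, phi v = Some x.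
    move=> vs; have : v \notin undef phi by rewrite es inE.
    by rewrite inE; case: (phi v) => [x _|] //; exists x.
  have [h hphi] : exists h : {ffun S -> X}, forall v, v != s -> phi v = Some (h v).
    exists [ffun v => odflt x0 (phi v)] => v /phiN[x ex].
    by rewrite ffunE ex.
  have phis : phi s = None by apply/eqP; have := set11 s; rewrite -es inE.
  rewrite /kdiff es big_set1 (_ : \sum_(x in _) _ = 0) ?mulr0 //.
  rewrite -[RHS](FS0_sum (h := h) (s := s) m0) => [|x]; last first.
    have /pimgP[v ev] := subsetP iT x (in_setT x).
    have vs : v != s by apply: contra_eq_neq ev => ->; rewrite phis.
    by exists v => //; move: ev; rewrite hphi // => -[].
  rewrite [RHS](partition_big (fun g : surj S X => val g s) predT) //=.
  apply: eq_big => [x|x _]; first by rewrite inE.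
  apply: eq_bigl => g; apply/eqP/andP => [/ffunP eg|[/forallP eg /eqP ex]].
    split; last by have := eg s; rewrite !ffunE eqxx => -[->].
    by apply/forallP => v; apply/implyP => vs; have := eg v;
      rewrite !ffunE (negPf vs) hphi // => -[->].
  apply/ffunP => v; rewrite !ffunE; case: eqP => [->|/eqP vs]; first by rewrite ex.
  by rewrite hphi // (eqP (implyP (eg v) vs)).
rewrite eY in eb b0.
exists (fun h => b (tot h)) => [g|h s hs].
  rewrite eb; last first.
    apply/and3P; split; rewrite ?subsetT //.
      apply/subsetP => x _; have /surjbP/(_ x)[v ev] := valP g.
      by apply/pimgP; exists v; rewrite ffunE ev.
    by rewrite cards_eq0; apply/eqP/setP => v; rewrite !inE ffunE.
  rewrite /c (bigD1 g) //= big1 ?addr0 // => g' /andP[/eqP/tot_inj/val_inj->].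
  by rewrite eqxx.
have /b0 : between Y setT 1 (upd (tot h) s None).
  apply/and3P; split; rewrite ?subsetT //.
    apply/subsetP => x; rewrite in_setC1 => /hs[v vs ev]; apply/pimgP; exists v.
    by rewrite updE (negPf vs) ffunE ev.
  apply/cards1P; exists s; apply/setP => v; rewrite !inE updE ffunE.
  by case: (v == s).
rewrite /kdiff (_ : undef _ = [set s]); last first.
  by apply/setP => v; rewrite !inE updE ffunE; case: (v == s).
rewrite big_set1 => /(congr1 (fun z => ksign k s [set s] * z)).
rewrite mulrA ksign2 mul1r mulr0 => e; rewrite -[RHS]e.
apply: eq_big => [x|x _]; first by rewrite inE.
by congr b; rewrite upd_same; apply/ffunP => v; rewrite !ffunE; case: (v == s).
Qed.

Lemma updfE U X (h : {ffun U -> X}) s x v :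
  updf h s x v = if v == s then x else h v.
Proof. by rewrite ffunE. Qed.

Lemma big_surj (V : nmodType) U X (P : pred {ffun U -> X}) (F : {ffun U -> X} -> V) :
  \sum_(f : surj U X | P (val f)) F (val f) = \sum_(f | surjb f && P f) F f.
Proof.
rewrite [RHS](reindex_omap (val : surj U X -> _) insub) => [|f /andP[sf _]].
  by apply: eq_bigl => f; rewrite valK eqxx andbT (valP f).
by rewrite insubT.
Qed.

Definition restrf U X (S : {set U}) (h : {ffun U -> X}) : {ffun elts S -> X} :=
  [ffun v => h (val v)].

Lemma card_elts U (S : {set U}) : #|elts S| = #|S|.
Proof. exact: card_sig. Qed.

Lemma cosub_cardN ell U (S : cosub ell U) : #|U| = (ell + #|cosub_elts S|)%N.
Proof.
by rewrite -(cardsC (val S)) (eqP (valP S)) addnC card_sig.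
Qed.

Lemma surjb_restr U X (S : {set U}) (h : {ffun U -> X}) :
  surjb (restrf S h) -> surjb h.
Proof.
by move=> /surjbP sh; apply/surjbP => x; have [v <-] := sh x; exists (val v); rewrite ffunE.
Qed.

(** Restricting the lift to S different from [S0] sums over the values at some point s of [S0]
    outside S, and such sums vanish by the choice of c. *)
Lemma day_lift1 ell U X (S0 : cosub ell U) (m : @lhom k (kFS k) (cosub_elts S0) X) :
  [pchar k] =i pred0 -> #|U| != (ell + #|X|)%N -> m \in FSt k 0 (cosub_elts S0) X ->
  exists2 x : @lhom k (kFS k) U X, res (val : cosub_elts S0 -> U) x = m
    & forall S : cosub ell U, S != S0 -> res (val : cosub_elts S -> U) x = 0.
Proof.
move=> char0 nU m0.
have nS : #|cosub_elts S0| != #|X| by rewrite (cosub_cardN S0) eqn_add2l in nU.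
(* If X is empty then [S0] is not, since their sizes differ; there are no surjections and m = 0. *)
case: (pickP (mem X)) => [x0 _|X0]; last first.
  have cX : #|X| = 0%N by apply: eq_card0 => x; have := X0 x.
  have {}nS : (0 < #|cosub_elts S0|)%N by rewrite lt0n -cX.
  have /card_gt0P[v _] := nS; exists 0; last by move=> S _; exact: lin0 (@res_linear _ _ _ _ _).
  rewrite (lin0 (@res_linear _ _ _ _ _)); apply/ffunP => g.
  by have := X0 (val g v).
have [c cm c0] := FS0_extend x0 char0 nS m0.
pose off (h : {ffun U -> X}) := [forall u, (u \notin val S0) ==> (h u == x0)].
pose F (h : {ffun U -> X}) := if off h then c (restrf (val S0) h) else 0.
pose x : @lhom k (kFS k) U X := [ffun h : surj U X => F (val h)].
have resF (S : cosub ell U) (g : surj (cosub_elts S) X) :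
    res (val : cosub_elts S -> U) x g
      = \sum_(h | (restrf (val S) h == val g) && off h) c (restrf (val S0) h).
  rewrite resE; under eq_bigr do rewrite ffunE.
  rewrite (big_surj (fun h => restrf (val S) h == val g) F) /F -big_mkcondr /=.
  apply: eq_bigl => h; rewrite -andbA andb_idl // => /andP[/eqP e _].
  by apply: (@surjb_restr _ _ (val S)); rewrite e (valP g).
exists x => [|S nSS]; apply/ffunP => g; rewrite resF.
  pose h0 : {ffun U -> X} := [ffun u => if insub u is Some v then val g v else x0].
  rewrite (big_pred1 h0) => [|h].
    rewrite -cm; congr c; apply/ffunP => v; rewrite !ffunE.
    by rewrite valK.
  apply/andP/eqP => [[/eqP eg /forallP hoff]|->].
    apply/ffunP => u; rewrite ffunE; case: insubP => [v _ <-|nu].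
      by rewrite -eg ffunE.
    exact/eqP/(implyP (hoff u)).
  split; first by apply/eqP/ffunP => v; rewrite !ffunE valK.
  by apply/forallP => u; apply/implyP => nu; rewrite ffunE insubN.
have [s sS0 sS] : exists2 s, s \in val S0 & s \notin val S.
  apply/subsetPn; apply: contra nSS => sub; apply/eqP/val_inj/esym/eqP.
  rewrite eqEcard sub /= -(card_elts (val S)) -(card_elts (val S0)).
  by rewrite -(leq_add2l ell) -(cosub_cardN S) -(cosub_cardN S0).
pose Q h := (restrf (val S) h == val g) && off h.
have Qupd h y : Q h -> Q (updf h s y).
  case/andP => /eqP eg /forallP hoff; apply/andP; split.
    rewrite -eg; apply/eqP/ffunP => v; rewrite !ffunE; case: eqP => // e.
    by move: sS; rewrite -e (valP v).
  apply/forallP => u; apply/implyP => nu; rewrite updfE; case: (u =P s) => [e|_].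
    by rewrite e sS0 in nu.
  exact: (implyP (hoff u)).
(* Maps that differ only at s are grouped together; the representative of a group has value x0 at
   s. *)
rewrite [LHS](partition_big (fun h => updf h s x0) Q) /= => [|h]; last exact: Qupd.
rewrite [RHS]ffunE; apply: big1 => h' Qh'.
have updupd h y y' : updf (updf h s y) s y' = updf h s y'.
  by apply/ffunP => v; rewrite !ffunE; case: eqP.
rewrite (reindex_onto (fun y => updf h' s y) (fun h => h s)) /=; last first.
  move=> h /andP[_ /eqP <-]; rewrite updupd; apply/ffunP => v; rewrite ffunE.
  by case: eqP => [->|].
have [h's|h's] := eqVneq (h' s) x0; last first.
  apply: big_pred0 => y; apply/negbTE; rewrite !negb_and updupd; apply/orP; left.
  apply/orP; right; apply: contraNneq h's => <-; by rewrite updfE eqxx.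
have hup : updf h' s x0 = h'.
  by apply/ffunP => v; rewrite ffunE; case: eqP => // ->; rewrite h's.
(* A value y other than x0 is attained on S, so away from s, and inside [S0], because everything
   outside [S0] goes to x0. The value x0 itself need not be attained, which is why [FS0_extend] asks
   only for x != x0. *)
rewrite -[RHS](c0 (restrf (val S0) h') (exist _ s sS0)) => [|y ny]; last first.
  have /andP[/eqP eg /forallP hoff] := Qh'.
  have /surjbP/(_ y)[v ev] := valP g.
  have hv : h' (val v) = y by rewrite -ev -eg ffunE.
  have vS0 : val v \in val S0.
    by apply: contraNT ny => nv; rewrite -hv; exact: (implyP (hoff _)).
  exists (exist _ (val v) vS0); last by rewrite ffunE.
  by rewrite -val_eqE /=; apply: contraNneq sS => <-; exact: (valP v).
apply: eq_big => [y|y _].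
  by rewrite -/(Q _) Qupd // updupd hup updfE !eqxx.
congr c; apply/ffunP => v; rewrite !ffunE /=.
by rewrite -val_eqE.
Qed.

(** An injection missing ell + 1 points factors through its image enlarged by one point, a set S
    missing ell points; inside S it misses just one, and elements of kFS^0 restrict to 0. *)
Lemma FSt_cosub ell U X (x : @lhom k (kFS k) U X) :
  (forall S : cosub ell U, res (val : cosub_elts S -> U) x \in FSt k 0 (cosub_elts S) X) ->
  x \in FSt k ell%:Z U X.
Proof.
move=> hx; apply/FStP => V i inj_i cV.
have cU : #|U| = (#|V| + ell.+1)%N.
  by apply/eqP; rewrite -eqz_nat PoszD -addn1 PoszD -cV addrC subrK.
have ci : #|~: [set i v | v : V]| = ell.+1.
  by apply/eqP; rewrite -(eqn_add2l #|[set i v | v : V]|) cardsC card_imset // cU.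
have /card_gt0P[s sN] : (0 < #|~: [set i v | v : V]|)%N by rewrite ci.
pose A := s |: [set i v | v : V].
have cA : #|~: A| == ell.
  rewrite setCU setIC -setDE; move/eqP: ci; rewrite (cardsD1 s) sN add1n.
  by rewrite eqSS.
pose S : cosub ell U := exist _ A cA.
have iA v : i v \in A by rewrite in_setU1 imset_f ?orbT.
pose j v : cosub_elts S := exist _ (i v) (iA v).
rewrite (@eq_res _ _ _ _ i (val \o j)) // -res_comp.
have /FStP := hx S; apply; first by move=> u v /(congr1 val) /inj_i.
have := cosub_cardN S; rewrite cU addnC addSn => /eqP.
rewrite -addnS eqn_add2l => /eqP <-.
by rewrite -addn1 PoszD addrAC subrr add0r.
Qed.

Lemma theta_pre_surj ell U X (m : dayval k ell X U) :
  [pchar k] =i pred0 -> #|U| != (ell + #|X|)%N ->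
  exists x : FStm k ell%:Z U X, theta_pre x = m.
Proof.
move=> char0 nU.
have /fin_all_exists2[y ym y0] (S : cosub ell U) := day_lift1 char0 nU (smvalP (m S)).
pose x := \sum_(S : cosub ell U) (1 : k) *: y S.
have ex (S : cosub ell U) : res (val : cosub_elts S -> U) x = smval (m S).
  rewrite /x (lin_sumZ (@res_linear _ _ _ _ _)) (bigD1 S) //= scale1r ym.
  by rewrite big1 ?addr0 // => S' nS; rewrite y0 ?scaler0 // eq_sym.
have xF : x \in FSt k ell%:Z U X.
  by apply: FSt_cosub => S; rewrite ex smvalP.
by exists (Subm xF); apply: dirsumP => S; apply: val_inj; rewrite /= ex.
Qed.

(** An injection missing ell points factors through the inclusion of its image, so it kills x as
    soon as all the components of theta do. *)
Lemma theta_inj ell U X : injective (theta k ell X U).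
Proof.
have linT := bmhom_lin (theta k ell) (X := X) (U := U).
move=> q r e; apply/eqP; rewrite -subr_eq0; apply/eqP.
have {e} : theta k ell X U (q - r) = 0 by rewrite (linB linT) e subrr.
move: (q - r) => {q r} q; rewrite -[q]quot_reprK; set x := quot_repr q.
rewrite /= theta_mapE => e0.
rewrite -(lin0 (@quot_proj_linear _ _ _)); apply/quot_projP; rewrite subr0.
apply/FStP => V i inj_i; rewrite subrK => cV.
have cA : #|~: [set i v | v : V]| == ell.
  rewrite -(eqn_add2l #|[set i v | v : V]|) cardsC card_imset // -eqz_nat PoszD -cV.
  by rewrite addrC subrK.
pose S : cosub ell U := exist _ [set i v | v : V] cA.
have iA v : i v \in [set i v | v : V] by rewrite imset_f.
pose j v : cosub_elts S := exist _ (i v) (iA v).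
rewrite (@eq_res _ _ _ _ i (val \o j)) // -res_comp.
have /(congr1 (fun d : dayval k ell X U => smval (d S))) /= -> := e0.
exact: lin0 (@res_linear _ _ _ _ _).
Qed.

End Coefficients.

(** * Young symmetrizers of hooks *)

Section SymSums.
Variables (k : fieldType) (C : finType).
Hypothesis char0 : [pchar k] =i pred0.
Implicit Types (D : {set C}) (c d : C) (x y z : {perm C}).

(** Coset decomposition of Sym(c |: D) under Sym(D): the coset of a permutation is given by the
    point d that it sends to c. *)
Lemma perm_on_setU1 D c d x : c \notin D -> d \in c |: D ->
  perm_on (c |: D) (tperm c d * x)%g && ((tperm c d * x)^-1%g c == d) = perm_on D x.
Proof.
move=> cD dD; rewrite (canF_eq (permKV _)) permM tpermR.
have tD : perm_on (c |: D) (tperm c d).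
  apply: subset_trans (tperm_on c d) _; by rewrite subUset !sub1set setU11.
apply/andP/idP => [[txD /eqP xc]|xD]; last first.
  split; last by rewrite (out_perm xD).
  by apply: perm_onM => //; apply: subset_trans xD (subsetUr _ _).
have xD : perm_on (c |: D) x.
  by rewrite -[x](mulKg (tperm c d)) tpermV perm_onM.
apply/subsetP => e ex; have := subsetP xD e ex; rewrite in_setU1 => /predU1P[ec|//].
by move: ex; rewrite inE ec -xc eqxx.
Qed.

Lemma big_perm_on_setU1 (V : nmodType) D c (F : {perm C} -> V) : c \notin D ->
  \sum_(y | perm_on (c |: D) y) F y
    = \sum_(d in c |: D) \sum_(x | perm_on D x) F (tperm c d * x)%g.
Proof.
move=> cD; rewrite (partition_big (fun y : {perm C} => y^-1%g c) (mem (c |: D))) /=.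
  apply: eq_bigr => d dD; rewrite (reindex_inj (mulgI (tperm c d))) /=.
  by apply: eq_bigl => x; rewrite perm_on_setU1.
by move=> y yD; rewrite (perm_closed _ (perm_onV yD)) setU11.
Qed.

Section Antisymmetric.
Variables (V : lmodType k) (F : {perm C} -> V).

(** Composing x with the transposition of c and x c gives a permutation fixing c, to which induction
    on |D| applies. *)
Lemma antisym_perm D :
  (forall y c d, c \in D -> d \in D -> c != d -> F (y * tperm c d)%g = - F y) ->
  forall x y, perm_on D x -> F (y * x)%g = (-1) ^+ x *: F y.
Proof.
move: {2}#|D| (erefl #|D|) => n; elim: n D => [|n IH] D.
  move=> /cards0_eq D0 _ x y xD; rewrite (perm_on_id xD) ?D0 ?cards0 //.
  by rewrite mulg1 odd_perm1 scale1r.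
move=> cD aF x y xD; have /card_gt0P[c cinD] : (0 < #|D|)%N by rewrite cD.
have cD' : #|D :\ c| = n by move: cD; rewrite (cardsD1 c) cinD => -[].
have aF' y' c' d' : c' \in D :\ c -> d' \in D :\ c -> c' != d' ->
    F (y' * tperm c' d')%g = - F y'.
  by move=> /setD1P[_ ?] /setD1P[_ ?]; exact: aF.
pose d := x c; have dD : d \in D by rewrite perm_closed.
pose x' := (x * tperm c d)%g.
have x'c : x' c = c by rewrite permM tpermR.
have tD : perm_on D (tperm c d).
  by apply: subset_trans (tperm_on c d) _; rewrite subUset !sub1set cinD.
have x'D : perm_on (D :\ c) x'.
  apply/subsetP => e ex; rewrite in_setD1 (subsetP (perm_onM xD tD)) // andbT.
  by apply: contraTneq ex => ->; rewrite inE x'c eqxx.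
have ex : x = (x' * tperm c d)%g by rewrite /x' -mulgA tperm2 mulg1.
have [dc|dc] := eqVneq c d.
  by rewrite ex -dc tperm1 mulg1; exact: IH x'D.
rewrite {1}ex mulgA aF // (IH _ cD' aF' _ _ x'D) ex odd_permM odd_tperm dc.
by rewrite addbT signrN scaleNr.
Qed.

End Antisymmetric.

Lemma card_perm_on_gt0 D : (0 < #|perm_on D|)%N.
Proof. by apply/card_gt0P; exists 1%g; exact: perm_on1. Qed.

Lemma tperm_comm3 c d e : d != c -> d != e ->
  (tperm c e * tperm c d = tperm d e * tperm c e)%g.
Proof.
by move=> dc de; rewrite conjgCV tpermV tpermJ tpermL tpermD 1?eq_sym // tpermC.
Qed.

Lemma perm_on_mulC D1 D2 x y z : [disjoint D1 & D2] -> perm_on D1 x -> perm_on D2 y ->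
  (z * x * y = z * y * x)%g.
Proof. by move=> dis xD yD; rewrite -!mulgA (perm_onC xD yD dis). Qed.

Lemma tperm_perm_on D c d : c \in D -> d \in D -> perm_on D (tperm c d).
Proof. by move=> cD dD; apply: subset_trans (tperm_on c d) _; rewrite subUset !sub1set cD. Qed.

(* Young symmetrizers of a hook: c0 is its corner, D the rest of its first column
   and R the rest of its first row. *)
Section Hook.
Variables (c0 : C) (D : {set C}).
Hypothesis c0D : c0 \notin D.
Let col := c0 |: D.
Let R := ~: col.
Let row := c0 |: R.

Let c0R : c0 \notin R.
Proof. by rewrite !inE eqxx. Qed.

Let RcolN : [disjoint R & col].
Proof. by rewrite -setI_eq0 setIC setICr. Qed.

Let rowDN : [disjoint row & D].
Proof.
rewrite -setI_eq0; apply/eqP/setP => c; rewrite !inE.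
have [->|] := eqVneq c c0; first by rewrite (negPf c0D).
by case: (c \in D).
Qed.

Let DrowN : [disjoint D & row].
Proof. by rewrite disjoint_sym. Qed.

Let DS x : perm_on D x -> perm_on col x.
Proof. by move=> xD; apply: subset_trans xD (subsetUr _ _). Qed.

Let RS x : perm_on R x -> perm_on row x.
Proof. by move=> xD; apply: subset_trans xD (subsetUr _ _). Qed.

(** The product of the hook lengths, a! (ell - 1)! (ell + a) for the shape (ell, 1^a): the factor by
    which the square of the Young symmetrizer exceeds the symmetrizer. *)
Definition hook_const : nat := (#|perm_on D| * #|perm_on R| * #|C|)%N.

Lemma hook_const_gt0 : (0 < hook_const)%N.
Proof. by rewrite !muln_gt0 !card_perm_on_gt0; apply/card_gt0P; exists c0. Qed.

Let hook_constE : hook_const = (#|perm_on D| * #|perm_on R| * (#|row| + #|D|))%N.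
Proof.
rewrite /hook_const -(cardsC col) [#|row|](cardsU1 c0) (negPf c0R) [#|col|](cardsU1 c0).
by rewrite c0D addnAC -/R.
Qed.

Section Column.
Variables (V : lmodType k) (g : {perm C} -> V).
Hypothesis g_row : forall y x, perm_on row x -> g (y * x)%g = g y.

(** When g y is the tabloid of a fixed tableau permuted by y, this is the polytabloid. *)
Definition col_antisym y : V :=
  \sum_(x | perm_on col x) (-1) ^+ x *: g (y * x)%g.

Lemma col_antisymM y x : perm_on col x ->
  col_antisym (y * x)%g = (-1) ^+ x *: col_antisym y.
Proof.
move=> xcol; rewrite /col_antisym [in RHS](reindex_inj (mulgI x)) /= scaler_sumr.
apply: eq_big => z; first by apply/idP/idP => h;
  rewrite ?perm_onM // -[z](mulKg x) perm_onM // perm_onV.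
by rewrite odd_permM signr_addb !scalerA mulrA -expr2 sqrr_sign mul1r mulgA.
Qed.

Lemma col_antisym_row y x : perm_on R x -> col_antisym (y * x)%g = col_antisym y.
Proof.
move=> xR; apply: eq_bigr => z zcol; congr (_ *: _).
by rewrite (perm_on_mulC _ RcolN xR zcol) g_row // RS.
Qed.

(** The antisymmetrization of g over the column and c together is 0, because c and the corner lie in
    one row: their transposition fixes g and has sign -1. Splitting this sum by the point sent to c
    gives the relation. *)
Lemma garnir y c : c \in R ->
  col_antisym y = \sum_(d in col) col_antisym (y * tperm c d)%g.
Proof.
move=> cR; have cN : c \notin col by rewrite inE in cR.
have c0c : c0 != c by apply: contraNneq cN => <-; rewrite setU11.
have : \sum_(z | perm_on (c |: col) z) (-1) ^+ z *: g (y * z)%g = 0.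
  apply: (eq_opp0 char0); rewrite {1}(reindex_inj (mulIg (tperm c0 c))) /= -sumrN.
  have tcol : perm_on (c |: col) (tperm c0 c).
    by apply: tperm_perm_on; rewrite !inE eqxx ?orbT.
  apply: eq_big => z.
    apply/idP/idP => h; last by rewrite perm_onM.
    by rewrite -[z](mulgK (tperm c0 c)) tpermV perm_onM.
  move=> _; rewrite odd_permM odd_tperm c0c addbT signrN scaleNr mulgA.
  rewrite [g (_ * tperm _ _)%g]g_row //.
  by apply: tperm_perm_on; rewrite ?setU11 // in_setU1 cR orbT.
rewrite big_perm_on_setU1 // big_setU1 //= tperm1.
under eq_bigr do rewrite mul1g.
move/eqP; rewrite addr_eq0 => /eqP; rewrite -/(col_antisym y) => ->.
rewrite -sumrN; apply: eq_bigr => d dcol; rewrite -sumrN; apply: eq_bigr => x _.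
have cd : c != d by apply: contraNneq cN => ->.
by rewrite odd_permM odd_tperm cd addTb signrN scaleNr opprK mulgA.
Qed.

(** Sym(D) and Sym(R) only contribute the factors |D|! and |R|!, leaving transpositions of [c0] with
    d in the column and with c in the row. The case c = c0 gives |col| copies of the right-hand
    side, and each c in R gives one more by [garnir]: |C| in all. *)
Lemma col_row_col y :
  \sum_(z | perm_on row z) \sum_(x | perm_on col x)
     (-1) ^+ x *: col_antisym (y * x * z)%g = hook_const%:R *: col_antisym y.
Proof.
transitivity (\sum_(z | perm_on row z) #|perm_on D|%:R *:
  \sum_(d in col) (-1) ^+ (c0 != d) *: col_antisym (y * tperm c0 d * z)%g).
  apply: eq_bigr => z zrow; rewrite big_perm_on_setU1 // scaler_sumr.
  apply: eq_bigr => d _; rewrite scaler_nat -sumr_const; apply: eq_bigr => x xD.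
  rewrite mulgA (perm_on_mulC _ DrowN xD zrow) col_antisymM ?DS // scalerA odd_permM.
  by rewrite odd_tperm signr_addb -mulrA -expr2 sqrr_sign mulr1.
rewrite -scaler_sumr big_perm_on_setU1 //.
transitivity (#|perm_on D|%:R *: \sum_(c in row) #|perm_on R|%:R *: (\sum_(d in col)
   (-1) ^+ (c0 != d) *: col_antisym (y * tperm c0 d * tperm c0 c)%g)).
  congr (_ *: _); apply: eq_bigr => c _; rewrite scaler_nat -sumr_const.
  apply: eq_bigr => x xR; apply: eq_bigr => d _; congr (_ *: _).
  by rewrite mulgA (col_antisym_row _ xR).
rewrite -scaler_sumr scalerA hook_constE !natrM -[in RHS]scalerA; congr (_ *: _).
rewrite /row big_setU1 //= natrD cardsU1 c0R natrD !scalerDl scale1r addrAC.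
congr (_ + _); last first.
  rewrite scaler_nat -sumr_const; apply: eq_bigr => c cR; rewrite (garnir _ cR).
  have cN : c \notin col by rewrite inE in cR.
  rewrite /col !big_setU1 //= eqxx expr0 scale1r tperm1 mulg1 [tperm c c0]tpermC.
  congr (_ + _); apply: eq_bigr => d dD.
  have c0d : c0 != d by apply: contraNneq c0D => ->.
  have cc0 : c != c0 by apply: contraNneq cN => ->; rewrite setU11.
  have cd : c != d by apply: contraNneq cN => ->; rewrite setU1r.
  (* Commuting the two transpositions brings the one inside the column to the right, where it
     becomes a sign. *)
  rewrite -mulgA tperm_comm3 // mulgA [in LHS]col_antisymM.
    by rewrite odd_tperm c0d scalerA -expr2 sqrr_sign scale1r.
  by apply: tperm_perm_on; rewrite ?setU11 ?setU1r.
rewrite /col big_setU1 //= eqxx expr0 scale1r tperm1 !mulg1; congr (_ + _).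
rewrite scaler_nat -sumr_const; apply: eq_bigr => d dD.
have c0d : c0 != d by apply: contraNneq c0D => ->.
rewrite mulg1 col_antisymM.
  by rewrite odd_tperm c0d scalerA -expr2 sqrr_sign scale1r.
by apply: tperm_perm_on; rewrite ?setU11 ?setU1r.
Qed.

End Column.

Section Row.
Variables (V : lmodType k) (A : {perm C} -> V).
Hypothesis A_row : forall y x, perm_on row x -> A (y * x)%g = A y.
Hypothesis A_D : forall y c d, c \in D -> d \in D -> c != d ->
  A (y * tperm c d)%g = - A y.
Hypothesis A_sum : forall y d, d \in D ->
  A y + \sum_(c in row) A (y * tperm c d)%g = 0.

(** Antisymmetry is available only in D; [A_sum] replaces the exchange with the corner. The coset d
    = c0 gives |row| copies of A y by row invariance, and each d in D gives one by [A_sum], so |row|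
    + |D| = |C| again. *)
Lemma row_col_row y :
  \sum_(z | perm_on row z) \sum_(x | perm_on col x) (-1) ^+ x *: A (y * z * x)%g
    = hook_const%:R *: A y.
Proof.
transitivity (\sum_(z | perm_on row z) #|perm_on D|%:R *:
  \sum_(d in col) (-1) ^+ (c0 != d) *: A (y * z * tperm c0 d)%g).
  apply: eq_bigr => z zrow; rewrite big_perm_on_setU1 // scaler_sumr.
  apply: eq_bigr => d _; rewrite scaler_nat -sumr_const; apply: eq_bigr => x xD.
  rewrite mulgA (antisym_perm A_D _ xD) scalerA odd_permM odd_tperm signr_addb.
  by rewrite -mulrA -expr2 sqrr_sign mulr1.
rewrite -scaler_sumr exchange_big /= hook_constE -mulnA natrM -scalerA; congr (_ *: _).
rewrite /col big_setU1 //= mulnDr natrD scalerDl; congr (_ + _).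
  under eq_bigr => z zrow do rewrite tperm1 mulg1 A_row // eqxx scale1r.
  rewrite sumr_const -scaler_nat; congr (_%:R *: _).
  rewrite -sum1_card big_perm_on_setU1 //= -[RHS]mulnC -sum_nat_const.
  by apply: eq_bigr => c _; rewrite sum1_card.
rewrite natrM mulrC -scalerA scaler_nat -sumr_const; apply: eq_bigr => d dD.
have c0d : c0 != d by apply: contraNneq c0D => ->.
rewrite c0d -scaler_sumr scaleN1r big_perm_on_setU1 //.
transitivity (- \sum_(c in row) #|perm_on R|%:R *: A (y * tperm c d)%g).
  congr (- _); apply: eq_bigr => c crow; rewrite scaler_nat -sumr_const.
  apply: eq_bigr => x xR; rewrite mulgA.
  have tcol : perm_on col (tperm c0 d) by apply: tperm_perm_on; rewrite ?setU11 ?setU1r.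
  rewrite (perm_on_mulC _ RcolN xR tcol) A_row ?RS //.
  have [->|cc0] := eqVneq c c0; first by rewrite tperm1 mulg1.
  have cd : c != d by apply: contraTneq crow => ->; rewrite (disjointFl rowDN).
  rewrite -mulgA tperm_comm3 ?[d == _]eq_sym // mulgA [tperm d c]tpermC.
  by apply: A_row; apply: tperm_perm_on; rewrite ?setU11.
rewrite -scaler_sumr -scalerN; congr (_ *: _); apply/eqP.
by rewrite eq_sym -addr_eq0 A_sum.
Qed.

End Row.
End Hook.
End SymSums.

(** * Cells of a hook *)

(* Row i+1 of the hook has index i; row 0 has none. *)
Definition leg_index (ell a : nat) (i : 'I_(size (hook ell a))) : option 'I_a :=
  omap (cast_ord (size_nseq a 1%N)) (unlift (ord0 : 'I_(size (nseq a 1%N)).+1) i).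

Section HookCells.
Variables (ell a : nat).
Hypothesis ell_gt0 : (0 < ell)%N.
Local Notation la := (hook ell a).
Local Notation C := (cell la).
Implicit Types (c : C).

Definition corner : C := @existT _ (fun i : 'I_(size la) => 'I_(nth 0%N la i))
  (ord0 : 'I_(size (nseq a 1%N)).+1) (Ordinal ell_gt0).

Definition leg_row (i : 'I_a) : 'I_(size la) :=
  lift (ord0 : 'I_(size (nseq a 1%N)).+1) (cast_ord (esym (size_nseq a 1%N)) i).

Fact leg_subproof (i : 'I_a) : (0 < nth 0%N la (leg_row i))%N.
Proof. by rewrite /= nth_nseq ltn_ord. Qed.

Definition leg (i : 'I_a) : C := @existT _ (fun i : 'I_(size la) => 'I_(nth 0%N la i))
  (leg_row i) (Ordinal (leg_subproof i)).

Lemma leg_index_row i : leg_index (leg_row i) = Some i.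
Proof. by rewrite /leg_index /leg_row liftK /= cast_ordKV. Qed.

Lemma leg_indexN (i : 'I_(size la)) : leg_index i = None ->
  i = (ord0 : 'I_(size (nseq a 1%N)).+1).
Proof. by rewrite /leg_index; case: unliftP. Qed.

Lemma leg_indexS (i : 'I_(size la)) j : leg_index i = Some j -> i = leg_row j.
Proof.
by rewrite /leg_index /leg_row; case: unliftP => //= j' -> [<-]; rewrite cast_ordK.
Qed.

Lemma leg_index_corner : leg_index (cell_row corner) = None.
Proof. by rewrite /leg_index unlift_none. Qed.

Lemma leg_uniq c i : leg_index (cell_row c) = Some i -> c = leg i.
Proof.
case: c => r j /leg_indexS; rewrite /cell_row /= => er; rewrite er in j *.
congr existT; apply/val_inj.
have hn : nth 0%N la (leg_row i) = 1%N by rewrite /= nth_nseq ltn_ord.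
by have := leq_trans (ltn_ord j) (eq_leq hn); rewrite ltnS leqn0 => /eqP.
Qed.

Definition legs : {set C} := [set leg i | i in 'I_a].

Lemma mem_legs c : (c \in legs) = (leg_index (cell_row c) != None).
Proof.
apply/imsetP/idP => [[i _ ->]|]; first by rewrite leg_index_row.
by case e : (leg_index _) => [i|] // _; exists i => //; apply: leg_uniq.
Qed.

Lemma leg_inj : injective leg.
Proof.
by move=> i j /(congr1 (fun c => leg_index (cell_row c))); rewrite !leg_index_row => -[].
Qed.

Lemma corner_legs : corner \notin legs.
Proof. by rewrite mem_legs leg_index_corner. Qed.

Lemma mem_hook_col c : (c \in corner |: legs) = (cell_col c == 0%N).
Proof.
rewrite in_setU1 mem_legs; case e : (leg_index _) => [i|] /=.
  by rewrite (leg_uniq e) orbT.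
rewrite orbF; case: c e => r j /leg_indexN; rewrite /cell_row /= => er; rewrite er in j *.
apply/eqP/eqP => [/(congr1 (@cell_col _))|] //.
by rewrite /cell_col /= => ej; congr existT; apply/val_inj.
Qed.

Lemma row0_eq c d : c \notin legs -> d \notin legs -> cell_row c = cell_row d.
Proof. by rewrite !mem_legs !negbK => /eqP/leg_indexN-> /eqP/leg_indexN->. Qed.

Lemma cell_eq c d : cell_row c = cell_row d -> cell_col c = cell_col d -> c = d.
Proof.
case: c d => r j [r' j']; rewrite /cell_row /cell_col /= => er.
by rewrite -er in j' * => ej; congr existT; apply/val_inj.
Qed.

(** Every column but the first has a single cell, which a column-preserving permutation must fix. *)
Lemma col_stab_hook (p : {perm C}) : col_stab p = perm_on (corner |: legs) p.
Proof.
apply/forallP/subsetP => [hp c|hp c].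
  rewrite mem_hook_col; apply: contraR => nc; apply/eqP/cell_eq; last exact/eqP.
  have leg0 d : cell_col d != 0%N -> d \notin legs.
    by apply: contra; rewrite -mem_hook_col => dl; rewrite setU1r.
  by apply: row0_eq; apply: leg0 => //; rewrite (eqP (hp c)).
have [hc|hc] := boolP (c \in corner |: legs); last by rewrite (out_perm _ hc) //; exact/subsetP.
have := hc; rewrite -(perm_closed c (introT subsetP hp)) !mem_hook_col.
by move: hc; rewrite mem_hook_col => /eqP-> /eqP->.
Qed.

Lemma mem_hook_row c : (c \in corner |: ~: (corner |: legs)) = (c \notin legs).
Proof.
by rewrite in_setU1 in_setC in_setU1; case: eqP => [->|//]; rewrite (negPf corner_legs).
Qed.

Lemma cell_row_perm (x : {perm C}) c :
  perm_on (corner |: ~: (corner |: legs)) x -> cell_row (x c) = cell_row c.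
Proof.
move=> xrow; have [hc|hc] := boolP (c \in corner |: ~: (corner |: legs)).
  by apply: row0_eq; rewrite -mem_hook_row ?perm_closed.
by rewrite (out_perm xrow hc).
Qed.

Lemma card_hook : #|C| = (ell + a)%N.
Proof.
rewrite -(cardsC legs) card_imset ?card_ord; last exact: leg_inj.
rewrite addnC; congr (_ + _)%N.
rewrite -[RHS]card_ord -[RHS](card_imset _ (f := fun j : 'I_ell =>
  @existT _ (fun i : 'I_(size la) => 'I_(nth 0%N la i))
    (ord0 : 'I_(size (nseq a 1%N)).+1) j)).
  apply: eq_card => c; rewrite in_setC mem_legs negbK.
  apply/eqP/imsetP => [|[j _ ->]]; last by rewrite /leg_index unlift_none.
  case: c => r j /leg_indexN; rewrite /cell_row /= => er; rewrite er in j *.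
  by exists j.
by move=> i j /(congr1 (@cell_col _)); exact: val_inj.
Qed.

End HookCells.

(** * Coordinates on the Day convolution *)

Lemma free_modEl (k : fieldType) (H : finType) (c : k) (x y : free_mod k H) (h : H) :
  (c *: x + y) h = c *: (x h : k^o) + y h.
Proof. by rewrite !ffunE. Qed.

Section DayCoefficients.
Variables (k : fieldType) (ell : nat).
Implicit Types (U V X Y : finType).

(** The domain S can be read off from the partial map, so this encodes the pair (S, g). *)
Definition ext_none U X (S : {set U}) (g : {ffun elts S -> X}) : {ffun U -> option X} :=
  [ffun u => omap g (insub u)].

(** At most one pair (S, g) contributes; the double sum makes the coordinate total in phi, with
    value 0 when no pair does. *)
Definition dcoef X U (m : dayval k ell X U) (phi : {ffun U -> option X}) : k :=
  \sum_(S : cosub ell U) \sum_(g : surj (cosub_elts S) X | ext_none (val g) == phi)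
     smval (m S) g.

Definition onto_partial X U (phi : {ffun U -> option X}) :=
  (#|undef phi| == ell) && (pimg phi == setT).

Lemma undef_ext U X (S : {set U}) (g : {ffun elts S -> X}) :
  undef (ext_none g) = ~: S.
Proof.
by apply/setP => u; rewrite !inE ffunE; case: insubP => [v -> _|->].
Qed.

Lemma ext_none_inj U X (S : {set U}) : injective (@ext_none U X S).
Proof.
move=> g h /ffunP e; apply/ffunP => v; have := e (val v).
by rewrite !ffunE valK /= => -[].
Qed.

Lemma onto_partial_ext X U (S : cosub ell U) (g : surj (cosub_elts S) X) :
  onto_partial (ext_none (val g)).
Proof.
rewrite /onto_partial undef_ext (valP S) /=; apply/eqP/setP => x; rewrite in_setT.
have /surjbP/(_ x)[v <-] := valP g; apply/pimgP; exists (val v).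
by rewrite ffunE valK.
Qed.

Lemma onto_partialP X U (phi : {ffun U -> option X}) : onto_partial phi ->
  exists S : cosub ell U, exists g : surj (cosub_elts S) X, phi = ext_none (val g).
Proof.
case/andP => cphi /eqP iphi.
have cS : #|~: ~: undef phi| == ell by rewrite setCK.
pose S : cosub ell U := exist _ (~: undef phi) cS; exists S.
have Sphi (v : cosub_elts S) : exists x, phi (val v) == Some x.
  by have := valP v; rewrite !inE; case: (phi _) => [x _|] //; exists x.
pose g : {ffun cosub_elts S -> X} := [ffun v => xchoose (Sphi v)].
have gphi v : phi (val v) = Some (g v) by rewrite ffunE; exact/eqP/(xchooseP (Sphi v)).
have sg : surjb g.
  apply/surjbP => x; have /pimgP[u eu] : x \in pimg phi by rewrite iphi.
  have uS : u \in val S by rewrite !inE eu.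
  by exists (exist _ u uS); have := gphi (exist _ u uS); rewrite /= eu => -[].
exists (exist _ g sg); apply/ffunP => u; rewrite ffunE /=.
case: insubP => [v _ <-|]; first by rewrite gphi.
by rewrite !inE negbK => /eqP.
Qed.

Lemma dcoefE X U (m : dayval k ell X U) (S : cosub ell U) (g : surj (cosub_elts S) X) :
  dcoef m (ext_none (val g)) = smval (m S) g.
Proof.
rewrite /dcoef (bigD1 S) //= [X in _ + X]big1 ?addr0 => [|S' nS]; last first.
  rewrite big_pred0 // => g'; apply: contraNF nS => /eqP/(congr1 (@undef _ _)).
  by rewrite !undef_ext => /setC_inj/val_inj->.
rewrite (big_pred1 g) // => g'; apply/eqP/eqP => [|->//].
by move/ext_none_inj/val_inj.
Qed.

Lemma dcoef0 X U (m : dayval k ell X U) phi : ~~ onto_partial phi -> dcoef m phi = 0.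
Proof.
move=> nphi; rewrite /dcoef big1 // => S _; rewrite big_pred0 // => g.
by apply: contraNF nphi => /eqP <-; exact: onto_partial_ext.
Qed.

Lemma dcoef_inj X U (m n : dayval k ell X U) :
  (forall phi, onto_partial phi -> dcoef m phi = dcoef n phi) -> m = n.
Proof.
move=> e; apply: dirsumP => S; apply/val_inj/ffunP => g.
by rewrite -[LHS]dcoefE -[RHS]dcoefE; apply/e/onto_partial_ext.
Qed.

Lemma dcoef_linear X U phi : linear (fun m : dayval k ell X U => dcoef m phi : k^o).
Proof.
move=> c m n; rewrite /dcoef scaler_sumr -big_split; apply: eq_bigr => S _ /=.
rewrite scaler_sumr -big_split; apply: eq_bigr => g _ /=.
exact: free_modEl.
Qed.

Definition sub_partial X U (phi : {ffun U -> option X}) (f : {ffun U -> X}) :=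
  [forall u, (phi u == None) || (phi u == Some (f u))].

Lemma dcoef_theta X U (x : FStm k ell%:Z U X) phi : onto_partial phi ->
  dcoef (theta_pre x) phi
    = \sum_(f : surj U X | sub_partial phi (val f)) (smval x : khom k _ _) f.
Proof.
case/onto_partialP => S [g ->]; rewrite dcoefE /= resE; apply: eq_bigl => f.
apply/eqP/forallP => [e u|h].
  rewrite ffunE; case: insubP => [v _ <-|//].
  by rewrite /= (_ : sval g v = sval f (val v)) ?eqxx //; move/ffunP: e => /(_ v); rewrite ffunE.
apply/ffunP => v; have := h (val v); rewrite !ffunE valK /=.
by case/eqP.
Qed.

Definition map_partial X Y U (h : X -> Y) (phi : {ffun U -> option X}) : {ffun U -> option Y} :=
  [ffun u => omap h (phi u)].

Lemma dcoef_actl X Y U (f : FStm k 0 X Y) (m : dayval k ell X U) psi :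
  dcoef (day_actl f m) psi
    = \sum_(h : surj X Y) smval f h *
        \sum_(phi | map_partial (val h) phi == psi) dcoef m phi.
Proof.
pose G (S : cosub ell U) (g : surj (cosub_elts S) X) (h : surj X Y) :=
  map_partial (val h) (ext_none (val g)) == psi.
transitivity (\sum_(S : cosub ell U) \sum_(h : surj X Y) \sum_(g | G S g h)
    smval f h * smval (m S) g).
  apply: eq_bigr => S _; rewrite [LHS](_ : _ = \sum_(g' : surj _ Y |
     ext_none (val g') == psi) \sum_(h : surj X Y) \sum_(g : surj (cosub_elts S) X)
     smval f h * smval (m S) g * (fcompose (val h) (val g) == val g')%:R).
    rewrite exchange_big; apply: eq_bigr => h _; rewrite exchange_big /= [RHS]big_mkcond.
    apply: eq_bigr => g _; rewrite -big_distrr /=.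
    pose hg : surj (cosub_elts S) Y :=
      exist _ (fcompose (val h) (val g)) (surjb_comp (valP h) (valP g)).
    have eG : G S g h = (ext_none (fcompose (val h) (val g)) == psi).
      congr (_ == _); apply/ffunP => u; rewrite !ffunE.
      by case: insubP => [v _ _|//]; rewrite /= ffunE.
    rewrite eG; case: ifP => [e|ne].
      rewrite (bigD1 hg) //= eqxx big1 ?addr0 ?mulr1 // => g'.
      case/andP => _ ng; case: eqP => // eg; case/eqP: ng.
      by apply: val_inj; exact: esym eg.
    rewrite big1 ?mulr0 // => g' eg'; case: eqP => // eg.
    by rewrite eg eg' in ne.
  apply: eq_bigr => g' _; rewrite /= /kcomp /lext sum_ffunE; apply: eq_bigr => h _.
  rewrite ffunE sum_ffunE [LHS]mulr_sumr; apply: eq_bigr => g _.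
  rewrite !ffunE -[RHS]mulrA; congr (_ * (_ * _)).
  by rewrite -val_eqE /= eq_sym.
rewrite exchange_big; apply: eq_bigr => h _.
rewrite /dcoef [in RHS]exchange_big mulr_sumr; apply: eq_bigr => S _ /=.
rewrite (exchange_big_dep predT) //= -mulr_sumr; congr (_ * _).
rewrite big_mkcond /=; apply: eq_bigr => g _; rewrite /G; case: ifP => e.
  rewrite (big_pred1 (ext_none (val g))) // => phi; rewrite [RHS]eq_sym.
  by case: (ext_none (val g) =P phi) => [<-|]; rewrite ?andbT ?andbF // e.
by rewrite big_pred0 // => phi; case: (ext_none (val g) =P phi) => [<-|]; rewrite ?andbT ?andbF.
Qed.

Lemma bij_inv U V (s : bij U V) : exists2 r : V -> U, cancel r (val s) & cancel (val s) r.
Proof. by have [r] := bij_bijective s; exists r. Qed.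

Lemma onto_partial_comp X U V (s : bij V U) (psi : {ffun U -> option X}) :
  onto_partial (fcompose psi (val s)) = onto_partial psi.
Proof.
have [r rK sK] := bij_inv s; have si := can_inj sK; congr (_ && _).
  rewrite -(card_imset _ si); congr (_ == _); apply: eq_card => u.
  apply/imsetP/idP => [[v]|]; first by rewrite !inE ffunE => h ->.
  by rewrite inE => hu; exists (r u); rewrite ?inE ?ffunE rK.
congr (_ == _); apply/setP => x; apply/pimgP/pimgP => [[v]|[u]].
  by rewrite ffunE => h; exists (val s v).
by move=> h; exists (r u); rewrite ffunE rK.
Qed.

(** Every partial map on V is some psi composed with s, so this form gives all coordinates without
    the inverse of s. *)
Lemma dcoef_actr X U V (s : bij V U) (m : dayval k ell X U) psi :
  dcoef (day_actr s m) (fcompose psi (val s)) = dcoef m psi.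
Proof.
have [hpsi|hpsi] := boolP (onto_partial psi); last first.
  by rewrite !dcoef0 // onto_partial_comp.
have [r rK sK] := bij_inv s.
have := hpsi; rewrite -(onto_partial_comp s) => /onto_partialP[S [g eg]].
rewrite eg dcoefE /=.
have [j jK Kj] := elts_im_bij s (val S).
have sf : surjb [ffun u => val g (j u)].
  apply/surjbP => x; have /surjbP/(_ x)[v <-] := valP g.
  by exists (elts_im s v); rewrite ffunE jK.
pose f0 : surj (cosub_elts (cosub_im s S)) X := exist _ [ffun u => val g (j u)] sf.
have -> : psi = ext_none (val f0).
  apply/ffunP => u; have /ffunP/(_ (r u)) := eg; rewrite ffunE rK => ->.
  rewrite !ffunE; case: insubP => [v vS ev|nv].
    rewrite insubT /=; first by rewrite -(rK u) imset_f.
    move=> uS; rewrite ffunE; congr (Some (val g _)).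
    by rewrite -[LHS]jK; congr j; apply/val_inj; rewrite /= ev rK.
  rewrite insubN //; apply: contra nv => /imsetP[v vS ->]; by rewrite sK.
rewrite dcoefE resE; apply: big_pred1 => f; apply/eqP/eqP => [e|->].
  apply/val_inj/ffunP => u; rewrite !ffunE -[in LHS](Kj u).
  by move/ffunP: e => /(_ (j u)); rewrite ffunE.
by apply/ffunP => v; rewrite !ffunE jK.
Qed.

(** * The diagonal case |U| = ell + |X| *)

Section EqualSize.
Variables (X U : finType).
Hypothesis eU : #|U| = (ell + #|X|)%N.

(** Here |S| = |X|, so no surjection onto X survives the removal of a point. *)
Fact FS0_small (S : cosub ell U) (x : @lhom k (kFS k) (cosub_elts S) X) :
  x \in FSt k 0 (cosub_elts S) X.
Proof.
have eS : #|cosub_elts S| = #|X|.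
  by apply/eqP; rewrite -(eqn_add2l ell) -cosub_cardN eU.
apply/FStP => V i inj_i; rewrite eS => eV; apply/ffunP => g.
have /surjbP sg := valP g.
have hg y : exists v, val g v == y by have [v <-] := sg y; exists v.
have : (#|X| <= #|V|)%N.
  apply: (@leq_card _ _ (fun y => xchoose (hg y))) => y z e.
  by rewrite -(eqP (xchooseP (hg y))) e (eqP (xchooseP (hg z))).
by move: eV => /eqP; rewrite add0r subr_eq addrC -PoszD addn1 => /eqP[->]; rewrite ltnn.
Qed.

Definition day_of (F : {ffun U -> option X} -> k) : dayval k ell X U :=
  DirSum (finsupp_fin (fun S : cosub ell U =>
    Subm (@FS0_small S [ffun g : surj (cosub_elts S) X => F (ext_none (val g))])
    : FStm k 0 (cosub_elts S) X)).

Lemma dcoef_day_of F phi : onto_partial phi -> dcoef (day_of F) phi = F phi.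
Proof. by case/onto_partialP => S [g ->]; rewrite dcoefE /= ffunE. Qed.

Definition day_bas phi := day_of (fun psi => (psi == phi)%:R).

Lemma dcoef_day_bas phi psi : onto_partial psi -> dcoef (day_bas phi) psi = (psi == phi)%:R.
Proof. exact: dcoef_day_of. Qed.

Lemma day_bas0 phi : ~~ onto_partial phi -> day_bas phi = 0.
Proof.
move=> nphi; apply: dcoef_inj => psi hpsi; rewrite dcoef_day_bas //.
rewrite (lin0 (@dcoef_linear X U psi)); case: eqP => // e.
by rewrite -e hpsi in nphi.
Qed.

Lemma day_basE m : m = \sum_phi dcoef m phi *: day_bas phi.
Proof.
apply: dcoef_inj => psi hpsi; rewrite (lin_sumZ (@dcoef_linear X U psi)).
rewrite (bigD1 psi) //= dcoef_day_bas // eqxx big1 ?addr0 => [|phi ne].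
  by rewrite /GRing.scale /= mulr1.
by rewrite dcoef_day_bas // eq_sym (negPf ne) scaler0.
Qed.

(** The domain has |U| - ell = |X| points, and a surjection between sets of equal size is
    injective. *)
Lemma onto_partial_inj (phi : {ffun U -> option X}) u v x :
  onto_partial phi -> phi u = Some x -> phi v = Some x -> u = v.
Proof.
case/andP => /eqP cphi /eqP iphi eu ev.
have /imset_injP inj : #|phi @: (~: undef phi)| == #|~: undef phi|.
  rewrite (_ : phi @: _ = [set Some x | x : X]).
    rewrite card_imset; last by move=> ? ? [].
    by rewrite -(eqn_add2l ell) -eU -cphi cardsC.
  apply/setP => o; apply/imsetP/imsetP => [[w]|[y _ ->]].
    by rewrite !inE; case: (phi w) => // y _ ->; exists y.
  have /pimgP[w ew] : y \in pimg phi by rewrite iphi.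
  by exists w; rewrite ?inE ew.
by apply: inj; rewrite ?inE ?eu ?ev.
Qed.

End EqualSize.
End DayCoefficients.

(** * The map to the hook modules *)

Lemma lin_sum (k : fieldType) (V W : lmodType k) (F : V -> W) (I : Type) (r : seq I)
    (P : pred I) (v : I -> V) :
  linear F -> F (\sum_(i <- r | P i) v i) = \sum_(i <- r | P i) F (v i).
Proof.
move=> linF; elim/big_rec2: _ => [|i y x _ <-]; first exact: lin0.
by rewrite linD.
Qed.

Section HookMap.
Variables (k : fieldType) (ell : nat).
Implicit Types (U V W X Y : finType) (a : nat).

(** The dictionary between the two sides: an ordering b of X and a tabloid of shape (ell, 1^a) on U
    give a partial bijection, undefined on the first row and sending the entry of leg cell i to b
    i. *)
Definition hook_partial a X U (b : {ffun 'I_a -> X})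
  (r : {ffun U -> 'I_(size (hook ell a))}) : {ffun U -> option X} :=
  [ffun u => omap b (leg_index (r u))].

Definition rows a U (t : {ffun U -> cell (hook ell a)}) :
  {ffun U -> 'I_(size (hook ell a))} := [ffun u => cell_row (t u)].

Definition sgn_vec a X (b : {ffun 'I_a -> X}) : sgn_mod k a X :=
  vsproj <<sgn_gens k a X>>%VS (alt_ord k b).

Definition specht_vec a U (t : {ffun U -> cell (hook ell a)}) :
    specht_mod k (hook ell a) U :=
  vsproj <<specht_gens k (hook ell a) U>>%VS (polytabloid k t).

Definition hook_term a X U (b : {ffun 'I_a -> X}) (t : {ffun U -> cell (hook ell a)}) :
    tens (sgn_mod k a X) (specht_mod k (hook ell a) U) :=
  pure (sgn_vec b) (specht_vec t).

(* Summing over all orderings b of X and all tableaux t on U avoids any choice,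
   which makes naturality a mere reindexing. *)
Definition hook_map_at a X U (m : dayval k ell X U) :
    tens (sgn_mod k a X) (specht_mod k (hook ell a) U) :=
  \sum_(b | bijb b) \sum_(t | bijb t) dcoef m (hook_partial b (rows t)) *: hook_term b t.

Lemma bijb_card U V (f : {ffun U -> V}) : bijb f -> #|U| = #|V|.
Proof. by move=> bf; apply: (bij_eq_card (bij_bijective (exist _ f bf : bij U V))). Qed.

Lemma hook_map_at0 a X U (m : dayval k ell X U) : a != #|X| -> hook_map_at a m = 0.
Proof.
move=> na; rewrite /hook_map_at big_pred0 // => b; apply: contraNF na => /bijb_card.
by rewrite card_ord => ->.
Qed.

Fact hook_map_subproof X U (m : dayval k ell X U) : finsupp (fun a => hook_map_at a m).
Proof.
by exists [:: #|X|] => a; rewrite inE => na; exact: hook_map_at0.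
Qed.

Definition hook_map X U (m : dayval k ell X U) : hook_sum k ell X U :=
  DirSum (hook_map_subproof m).

Lemma hook_map_at_linear a X U : linear (@hook_map_at a X U).
Proof.
move=> c m n; rewrite /hook_map_at scaler_sumr -big_split; apply: eq_bigr => b _ /=.
rewrite scaler_sumr -big_split; apply: eq_bigr => t _ /=.
by rewrite dcoef_linear scalerDl scalerA.
Qed.

Lemma sgn_vecE a X (b : {ffun 'I_a -> X}) : bijb b -> vsval (sgn_vec b) = alt_ord k b.
Proof. by move=> bb; rewrite vsprojK // memv_span // image_f. Qed.

Lemma specht_vecE a U (t : {ffun U -> cell (hook ell a)}) : bijb t ->
  vsval (specht_vec t) = polytabloid k t.
Proof. by move=> bt; rewrite vsprojK // memv_span // image_f. Qed.

Lemma sgn_vec_act a X Y (h : bij X Y) (b : {ffun 'I_a -> X}) : bijb b ->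
  @fdact k (kFB k) (sgn_mod k a) X Y (bas k h) (sgn_vec b)
    = sgn_vec (fcompose (val h) b).
Proof.
move=> bb; rewrite /= lext_bas; apply: val_inj; rewrite /= span_actE; last first.
  exact: sgn_gens_stable.
rewrite sgn_vecE // sgn_vecE ?bijb_comp ?(valP h) //.
rewrite /push /alt_ord (lin_sumZ (lext_linear _)); apply: eq_bigr => s _.
by rewrite lext_bas; congr (_ *: bas k _); apply/ffunP => i; rewrite !ffunE.
Qed.

Lemma specht_vec_act a U V (s : bij V U) (t : {ffun U -> cell (hook ell a)}) : bijb t ->
  @fdact k (kFBop k) (specht_mod k (hook ell a)) U V (bas k s) (specht_vec t)
    = specht_vec (fcompose t (val s)).
Proof.
move=> bt; rewrite /= lext_bas; apply: val_inj; rewrite /= span_actE; last first.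
  exact: (@specht_gens_stable k (hook ell a)).
rewrite specht_vecE // specht_vecE ?bijb_comp ?(valP s) //.
rewrite /push /polytabloid (lin_sumZ (lext_linear _)); apply: eq_bigr => p _.
by rewrite lext_bas; congr (_ *: bas k _); apply/ffunP => i; rewrite !ffunE.
Qed.

Lemma big_bijb_compl (Z : nmodType) U V W (h : bij V W) (F : {ffun U -> W} -> Z) :
  \sum_(t : {ffun U -> V} | bijb t) F (fcompose (val h) t) = \sum_(t | bijb t) F t.
Proof.
have [r rK hK] := bij_inv h.
have e1 (t : {ffun U -> V}) : [ffun u => r (fcompose (val h) t u)] = t.
  by apply/ffunP => u; rewrite !ffunE hK.
have e2 (t : {ffun U -> W}) : fcompose (val h) [ffun u => r (t u)] = t.
  by apply/ffunP => u; rewrite !ffunE rK.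
rewrite [RHS](reindex_onto (fun t : {ffun U -> V} => fcompose (val h) t)
  (fun t => [ffun u => r (t u)])) => [|t _]; last exact: e2.
apply: eq_bigl => t; rewrite e1 eqxx andbT; apply/idP/idP => [bt|/bijbP[i s]].
  by apply: bijb_comp bt; exact: valP.
apply/bijbP; split=> [u v e|v]; first by apply: i; rewrite !ffunE e.
by have [u] := s (val h v); rewrite ffunE => /(can_inj hK) <-; exists u.
Qed.

Lemma big_bijb_compr (Z : nmodType) U V W (s : bij V U) (F : {ffun V -> W} -> Z) :
  \sum_(t : {ffun U -> W} | bijb t) F (fcompose t (val s)) = \sum_(t | bijb t) F t.
Proof.
have [r rK sK] := bij_inv s.
have e1 (t : {ffun U -> W}) : [ffun u => fcompose t (val s) (r u)] = t.
  by apply/ffunP => u; rewrite !ffunE rK.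
have e2 (t : {ffun V -> W}) : fcompose [ffun u => t (r u)] (val s) = t.
  by apply/ffunP => u; rewrite !ffunE sK.
rewrite [RHS](reindex_onto (fun t : {ffun U -> W} => fcompose t (val s))
  (fun t => [ffun u => t (r u)])) => [|t _]; last exact: e2.
apply: eq_bigl => t; rewrite e1 eqxx andbT; apply/idP/idP => [bt|/bijbP[i sj]].
  by apply: bijb_comp => //; exact: valP.
apply/bijbP; split=> [u v e|w].
  by rewrite -(rK u) -(rK v); congr (val s _); apply: i; rewrite !ffunE !rK.
by have [v <-] := sj w; exists (val s v); rewrite ffunE.
Qed.

Local Notation hook_ext a := (bimod_ext (sgn_mod k a) (specht_mod k (hook ell a))).

Lemma hook_term_actl a X Y U (h : bij X Y) (b : {ffun 'I_a -> X})
    (t : {ffun U -> cell (hook ell a)}) : bijb b ->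
  bmactl (b := hook_ext a) (bas k h : @lhom k (kFB k) X Y) (hook_term b t)
    = hook_term (fcompose (val h) b) t.
Proof.
move=> bb; rewrite /hook_term -(sgn_vec_act h bb).
by apply: tmap_pure => //; exact: (@fdact_linr _ _ (sgn_mod k a)).
Qed.

Lemma hook_term_actr a X U V (s : bij V U) (b : {ffun 'I_a -> X})
    (t : {ffun U -> cell (hook ell a)}) : bijb t ->
  bmactr (b := hook_ext a) (bas k s : @lhom k (kFBop k) U V) (hook_term b t)
    = hook_term b (fcompose t (val s)).
Proof.
move=> bt; rewrite /hook_term -(specht_vec_act s bt).
by apply: tmap_pure => //; exact: (@fdact_linr _ _ (specht_mod k (hook ell a))).
Qed.

Lemma hook_partial_compr a X U V (b : {ffun 'I_a -> X})
    (t : {ffun U -> cell (hook ell a)}) (s : {ffun V -> U}) :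
  hook_partial b (rows (fcompose t s)) = fcompose (hook_partial b (rows t)) s.
Proof. by apply/ffunP => v; rewrite !ffunE. Qed.

Lemma hook_partial_compl a X Y U (b : {ffun 'I_a -> X})
    (r : {ffun U -> 'I_(size (hook ell a))}) (h : {ffun X -> Y}) :
  hook_partial (fcompose h b) r = map_partial h (hook_partial b r).
Proof. by apply/ffunP => v; rewrite !ffunE; case: leg_index => //= i; rewrite ffunE. Qed.

Lemma hook_map_actr X U V (f : @lhom k (kFBop k) U V) (m : dayval k ell X U) :
  hook_map (bmactr (b := day_mod k ell) f m) = bmactr (b := hook_sum k ell) f (hook_map m).
Proof.
apply: dirsumP => a.
change (hook_map_at a (bmactr (b := day_mod k ell) f m)
  = bmactr (b := hook_ext a) f (hook_map_at a m)).
move: f; apply: lin_ext => [||s].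
- apply: (linear_comp (@hook_map_at_linear a X V)); exact: lext_linear.
- exact: (bmactr_linl (b := hook_ext a) (X := X) (hook_map_at a m)).
have -> : bmactr (b := day_mod k ell) (bas k s : @lhom k (kFBop k) U V) m = day_actr s m.
  exact: lext_bas.
rewrite /hook_map_at.
have lin := bmactr_linr (b := hook_ext a) (X := X) (bas k s : @lhom k (kFBop k) U V).
rewrite (lin_sum _ _ _ lin); apply: eq_bigr => b _.
rewrite (lin_sumZ lin) -(big_bijb_compr s); apply: eq_bigr => t bt.
by rewrite hook_partial_compr dcoef_actr hook_term_actr.
Qed.

Lemma hook_partial_inj a X U (b : {ffun 'I_a -> X}) (t : {ffun U -> cell (hook ell a)}) u v x :
  bijb b -> bijb t -> hook_partial b (rows t) u = Some x ->
  hook_partial b (rows t) v = Some x -> u = v.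
Proof.
move=> /bijbP[bi _] /bijbP[ti _]; rewrite !ffunE.
case eu: (leg_index _) => [i|] //= -[<-]; case ev: (leg_index _) => [j|] //= -[/bi ij].
by apply: ti; rewrite (leg_uniq eu) (leg_uniq ev) ij.
Qed.

(** The augmentation enters here. The coordinates read by [hook_map] are injective partial maps to
    Y; if such a map is h composed with a partial map onto X, then h is injective. Thus the
    non-bijective h contribute 0 on both sides. *)
Lemma hook_map_actl X Y U (f : @lhom k (kFS0 k) X Y) (m : dayval k ell X U) :
  hook_map (bmactl (b := day_mod k ell) f m)
    = bmactl (b := hook_coker k ell) f (hook_map m : hook_coker k ell X U).
Proof.
apply: dirsumP => a.
change (hook_map_at a (day_actl f m)
  = bmactl (b := hook_ext a) (aug_map (smval f)) (hook_map_at a m)).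
rewrite [aug_map _](_ : _ = lext (fun h => fbbas k (val h)) (smval f)) //.
have linl := bmactl_linl (b := hook_ext a) (hook_map_at a m) (Y := Y).
rewrite [RHS](lin_lext _ linl) /lext /=.
rewrite {1}/hook_map_at.
transitivity (\sum_(h : surj X Y) smval f h *:
   \sum_(b : {ffun 'I_a -> Y} | bijb b) \sum_(t : {ffun U -> cell (hook ell a)} | bijb t)
     (\sum_(phi | map_partial (val h) phi == hook_partial b (rows t)) dcoef m phi)
       *: hook_term b t).
  under [RHS]eq_bigr do rewrite scaler_sumr.
  rewrite [RHS]exchange_big; apply: eq_bigr => b _.
  under [RHS]eq_bigr do rewrite scaler_sumr.
  rewrite [RHS]exchange_big; apply: eq_bigr => t _.
  by rewrite dcoef_actl scaler_suml; apply: eq_bigr => h _; rewrite scalerA.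
apply: eq_bigr => h _; congr (_ *: _); rewrite /fbbas.
have [bh|nbh] := boolP (bijb (val h)); last first.
  rewrite insubN // [RHS](lin0 linl); apply: big1 => b bb; apply: big1 => t bt.
  rewrite big1 ?scale0r // => phi /eqP ephi.
  have [hphi|] := boolP (onto_partial ell phi); last exact: dcoef0.
  case/negP: nbh; rewrite /bijb (valP h) andbT; apply/injectiveP => x1 x2 e.
  have /andP[_ /eqP iphi] := hphi.
  have /pimgP[u1 e1] : x1 \in pimg phi by rewrite iphi.
  have /pimgP[u2 e2] : x2 \in pimg phi by rewrite iphi.
  have ev u x : phi u = Some x -> hook_partial b (rows t) u = Some (val h x).
    by rewrite -ephi ffunE => ->.
  have eu : u1 = u2.
    by apply: (hook_partial_inj bb bt (ev _ _ e1)); rewrite e; exact: ev.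
  by move: e2; rewrite -eu e1 => -[].
rewrite insubT /=; set h' : bij X Y := Sub _ _.
have [r rK hK] := bij_inv h'.
have linr := bmactl_linr (b := hook_ext a) (U := U) (bas k h' : @lhom k (kFB k) X Y).
rewrite [RHS](_ : _ = bmactl (b := hook_ext a) (bas k h' : @lhom k (kFB k) X Y)
  (hook_map_at a m)) //.
rewrite /hook_map_at (lin_sum _ _ _ linr) -(big_bijb_compl h'); apply: eq_bigr => b bb.
rewrite (lin_sumZ linr); apply: eq_bigr => t bt.
rewrite hook_term_actl //; congr (_ *: _).
rewrite hook_partial_compl; apply: big_pred1 => phi; apply/eqP/eqP => [/ffunP e|->//].
apply/ffunP => u; have := e u; rewrite [map_partial _ _ _]ffunE [X in _ = X]ffunE.
by case: (phi u) (hook_partial _ _ u) => [x|] [y|] //= [/(can_inj hK)->].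
Qed.

Definition hook_hom : bimodHom (day_mod k ell) (hook_coker k ell).
Proof.
refine (@BimodHom k _ _ (day_mod k ell) (hook_coker k ell) hook_map _ _ _).
- move=> X U c m n; apply: dirsumP => a; exact: hook_map_at_linear.
- exact: hook_map_actl.
- exact: hook_map_actr.
Defined.

End HookMap.

(** * Tableaux *)

Lemma span_imageP (K : fieldType) (V : vectType K) (T : finType) (P : pred T) (f : T -> V) v :
  v \in <<image f P>>%VS -> exists c : T -> K, v = \sum_(x | P x) c x *: f x.
Proof.
rewrite span_def big_map big_enum => /memv_sumP[w wf ->].
have hc x : exists c, P x -> w x = c *: f x.
  case: (boolP (P x)) => [Px|_]; last by exists 0.
  by have /vlineP[c ->] := wf x Px; exists c.
have [c hc'] := fin_all_exists hc; exists c.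
by apply: eq_bigr => x Px; rewrite hc'.
Qed.

Section PermAction.
Variables (A B : finType).
Implicit Types (z : {perm B}) (t : {ffun A -> B}).

Definition permf z t : {ffun A -> B} := [ffun u => z (t u)].

Lemma permf1 t : permf 1%g t = t.
Proof. by apply/ffunP => u; rewrite ffunE perm1. Qed.

Lemma permfM z1 z2 t : permf (z1 * z2)%g t = permf z2 (permf z1 t).
Proof. by apply/ffunP => u; rewrite !ffunE permM. Qed.

Lemma bijb_permf z t : bijb (permf z t) = bijb t.
Proof.
have imp z' t' : bijb t' -> bijb (permf z' t').
  move=> /bijbP[i s]; apply/bijbP; split=> [u v|c].
    by rewrite !ffunE => /perm_inj/i.
  by have [u eu] := s (z'^-1%g c); exists u; rewrite ffunE eu permKV.
by apply/idP/idP => [/(imp z^-1%g)|/imp//]; rewrite -permfM mulgV permf1.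
Qed.

Lemma permf_inj t : bijb t -> injective (permf^~ t).
Proof.
move=> /bijbP[_ s] z1 z2 /ffunP e; apply/permP => c.
by have [u <-] := s c; have := e u; rewrite !ffunE.
Qed.

Lemma permf_trans t0 t : bijb t0 -> bijb t -> exists z, permf z t0 = t.
Proof.
move=> b0 bt; have [r rK tK] := bij_inv (exist _ t0 b0 : bij A B).
have /bijbP[ti _] := bt.
have zi : injective (fun c => t (r c)) by move=> c d /ti /(can_inj rK).
by exists (perm zi); apply/ffunP => u; rewrite ffunE permE; congr (t _); exact: tK.
Qed.

Lemma big_permf (V : nmodType) (F : {ffun A -> B} -> V) t0 : bijb t0 ->
  \sum_(t | bijb t) F t = \sum_z F (permf z t0).
Proof.
move=> b0; rewrite -(big_imset _ (in2W (permf_inj b0))) /=; apply: eq_bigl => t.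
apply/idP/imsetP => [bt|[z _ ->]]; last by rewrite bijb_permf.
by have [z <-] := permf_trans b0 bt; exists z.
Qed.

End PermAction.

Section Tableaux.
Variables (k : fieldType) (ell : nat).
Hypothesis ell_gt0 : (0 < ell)%N.
Hypothesis char0 : [pchar k] =i pred0.
Implicit Types (U V W X Y : finType) (a : nat).

Section Fixed.
Variables (a : nat) (X U : finType).
Local Notation C := (cell (hook ell a)).
Local Notation corner := (corner a ell_gt0).
Local Notation legs := (legs ell a).
Local Notation col := (corner |: legs).
Local Notation row := (corner |: ~: (corner |: legs)).
Implicit Types (t : {ffun U -> C}) (b : {ffun 'I_a -> X}) (x y z : {perm C}).

Definition tabloid_vec t : free_mod k {ffun U -> 'I_(size (hook ell a))} := bas k (rows t).

Lemma rows_permf_row x t : perm_on row x -> rows (permf x t) = rows t.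
Proof. by move=> xrow; apply/ffunP => u; rewrite !ffunE (cell_row_perm _ xrow). Qed.

(** A leg cell is alone in its row, so a permutation preserving the rows fixes it. *)
Lemma rows_permf_eq x t : bijb t -> rows (permf x t) = rows t -> perm_on row x.
Proof.
move=> /bijbP[_ st] /ffunP e; apply/subsetP => c; apply: contraR.
rewrite mem_hook_row negbK mem_legs; case ec: leg_index => [i|] // _.
have [u eu] := st c; have := e u; rewrite !ffunE eu => er.
have ex : leg_index (cell_row (x c)) = Some i by rewrite er.
by apply/eqP; rewrite [LHS](leg_uniq ex) [RHS](leg_uniq ec).
Qed.

Lemma polytabloid_permf y t :
  polytabloid k (permf y t) = col_antisym corner legs (fun z => tabloid_vec (permf z t)) y.
Proof.
apply: eq_big => [p|p _]; first by rewrite (col_stab_hook ell_gt0).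
congr (_ *: bas k _); apply/ffunP => u; by rewrite !ffunE permM.
Qed.

Lemma tabloid_vec_row t y x : perm_on row x ->
  tabloid_vec (permf (y * x)%g t) = tabloid_vec (permf y t).
Proof. by move=> xrow; rewrite /tabloid_vec permfM rows_permf_row. Qed.

(** Extends [hook_term k b] linearly to all tabloid vectors, through the projection onto the Specht
    module, so that linear identities between polytabloids carry over to the tensor product. *)
Definition hook_lin b (w : free_mod k {ffun U -> 'I_(size (hook ell a))}) :
    tens (sgn_mod k a X) (specht_mod k (hook ell a) U) :=
  pure (sgn_vec k b)
    (vsproj <<specht_gens k (hook ell a) U>>%VS w : specht_mod k (hook ell a) U).

Lemma hook_lin_linear b : linear (hook_lin b).
Proof. by move=> c v w; rewrite /hook_lin linearP pure_linearr. Qed.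

Lemma hook_term_col b t x : perm_on col x ->
  hook_term k b (permf x t) = (-1) ^+ x *: hook_term k b t.
Proof.
move=> xcol; rewrite /hook_term /specht_vec -!/(hook_lin b _).
rewrite -(linZ (hook_lin_linear b)) -[t in RHS]permf1 -[x in LHS]mul1g !polytabloid_permf.
by rewrite (col_antisymM (c0 := corner)).
Qed.

Lemma hook_term_row_col b t :
  \sum_(z | perm_on row z) \sum_(x | perm_on col x)
      (-1) ^+ x *: hook_term k b (permf z (permf x t))
    = (hook_const corner legs)%:R *: hook_term k b t.
Proof.
rewrite /hook_term /specht_vec -!/(hook_lin b _).
rewrite -(linZ (hook_lin_linear b)) -[t in RHS]permf1 polytabloid_permf.
rewrite -(col_row_col char0 (corner_legs a ell_gt0) (tabloid_vec_row t)).
rewrite (lin_sum _ _ _ (hook_lin_linear b)); apply: eq_bigr => z _.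
rewrite (lin_sumZ (hook_lin_linear b)); apply: eq_bigr => x _.
by rewrite -polytabloid_permf mul1g permfM.
Qed.

Lemma hook_partial_onto b t : bijb b -> bijb t -> onto_partial ell (hook_partial b (rows t)).
Proof.
move=> /bijbP[bi bs] bt; apply/andP; split.
  have -> : undef (hook_partial b (rows t)) = t @^-1: (~: legs).
    apply/setP => u; rewrite !inE mem_legs negbK !ffunE.
    by case: (leg_index _).
  have /bijbP[ti ts] := bt; rewrite -(card_imset _ ti).
  have -> : t @: (t @^-1: ~: legs) = ~: legs.
    apply/setP => c; apply/imsetP/idP => [[u]|hc]; first by rewrite inE => hu ->.
    by have [u eu] := ts c; exists u => //; rewrite inE eu.
  have := cardsC legs; rewrite card_hook // [X in (X + _)%N]card_imset ?card_ord //;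
    last exact: leg_inj.
  by rewrite addnC => /eqP; rewrite eqn_add2r.
apply/eqP/setP => x; rewrite in_setT; apply/pimgP.
have [i <-] := bs x; have /bijbP[_ ts] := bt; have [u eu] := ts (leg ell i).
by exists u; rewrite !ffunE eu leg_index_row.
Qed.

Lemma perm_on_col_tperm i : perm_on col (tperm corner (leg ell i)).
Proof.
by apply: tperm_perm_on; rewrite ?setU11 // setU1r // mem_legs leg_index_row.
Qed.

(* Swapping the corner, holding u, with the other entry of the first column that
   f sends to f u is a sign-reversing involution. *)
Lemma sum_sub_partial b (f : {ffun U -> X}) : bijb b ->
  \sum_(t : {ffun U -> C} | bijb t && sub_partial (hook_partial b (rows t)) f) hook_term k b t = 0.
Proof.
move=> bb; have [r rK bK] := bij_inv (exist _ b bb : bij 'I_a X).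
(* Sorting the tableaux by the value x of f at the corner entry fixes the leg cell to exchange with
   the corner, the one labelled x by b; the involution is then a single transposition. *)
pose corner_val t := omap f [pick u | t u == corner].
rewrite (partition_big corner_val predT) //=; apply: big1 => -[x|] _; last first.
  apply: big_pred0 => t; apply/negbTE; apply/negP => /andP[/andP[/bijbP[_ st] _]].
  rewrite /corner_val; case: pickP => // nu _.
  by have [u eu] := st corner; have := nu u; rewrite eu eqxx.
pose i := r x; pose tau := tperm corner (leg ell i).
pose P t := bijb t && sub_partial (hook_partial b (rows t)) f && (corner_val t == Some x).
have Ptau t : P t -> P (permf tau t).
  case/andP => /andP[bt /forallP sub] /eqP ct; have /bijbP[ti ts] := bt.
  have [u1 eu1] := ts (leg ell i).
  have fu1 : f u1 = x.
    have := sub u1; rewrite !ffunE eu1 leg_index_row /= => /eqP[<-].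
    exact: rK.
  have ct' u : t u = corner -> f u = x.
    move=> eu; move: ct; rewrite /corner_val; case: pickP => [v /eqP ev|/(_ u)].
      by case=> <-; congr (f _); apply: ti; rewrite eu.
    by rewrite eu eqxx.
  rewrite /P bijb_permf bt /=; apply/andP; split.
    apply/forallP => u; rewrite !ffunE.
    have [ec|nc] := eqVneq (t u) corner.
      by rewrite ec tpermL leg_index_row /= (rK x : b i = x) (ct' u ec) eqxx ?orbT.
    have [el|nl] := eqVneq (t u) (leg ell i).
      by rewrite el tpermR leg_index_corner.
    by rewrite tpermD ?[_ == t u]eq_sym //; have := sub u; rewrite !ffunE.
  rewrite /corner_val; case: pickP => [u|/(_ u1)]; last by rewrite ffunE eu1 tpermR eqxx.
  rewrite ffunE (canF_eq (tpermK _ _)) tpermL => /eqP e.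
  by rewrite /= (_ : u = u1) ?fu1 //; apply: ti; rewrite e.
have tauK t : permf tau (permf tau t) = t by rewrite -permfM tperm2 permf1.
apply: (eq_opp0 char0); rewrite {1}(reindex_inj (can_inj tauK)) /= -sumrN.
apply: eq_big => t; first by apply/idP/idP => [/Ptau|/Ptau //]; rewrite tauK.
move=> _; rewrite hook_term_col ?perm_on_col_tperm // odd_tperm.
by rewrite (_ : corner != leg ell i) ?scaleN1r.
Qed.

Lemma hook_map_at_theta (x : FStm k ell%:Z U X) : hook_map_at a (theta_pre x) = 0.
Proof.
apply: big1 => b bb.
under eq_bigr => t bt do rewrite (dcoef_theta x (hook_partial_onto bb bt)) scaler_suml.
rewrite (exchange_big_dep predT) //=; apply: big1 => f _.
by rewrite -scaler_sumr sum_sub_partial // scaler0.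
Qed.

Section Coordinates.
Hypothesis eU : #|U| = (ell + #|X|)%N.
Local Notation day_bas := (day_bas k eU).

(** As b1 is injective, the partial map determines the rows, so the tableaux in the sum are the row
    permutations of t1. *)
Lemma sum_partial_eq b1 t1 : bijb b1 -> bijb t1 ->
  \sum_(t : {ffun U -> C} | bijb t && (hook_partial b1 (rows t) == hook_partial b1 (rows t1)))
     hook_term k b1 t
    = \sum_(z | perm_on row z) hook_term k b1 (permf z t1).
Proof.
move=> bb bt; rewrite big_mkcondr (big_permf _ bt) [RHS]big_mkcond /=.
apply: eq_bigr => z _; congr (if _ then _ else _); apply/eqP/idP => [e|zrow].
  apply: (rows_permf_eq bt); apply/ffunP => u; have := e.
  move=> /ffunP/(_ u); rewrite [LHS]ffunE [RHS]ffunE.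
  have /bijbP[bi _] := bb.
  case e1 : (leg_index _) => [i|]; case e2 : (leg_index _) => [j|] //=.
    by case=> /bi ij; rewrite (leg_indexS e1) ij -(leg_indexS e2).
  by rewrite (leg_indexN e1) (leg_indexN e2).
by rewrite rows_permf_row.
Qed.

Lemma sgn_vec_permf b (s : {perm X}) : bijb b ->
  sgn_vec k (permf s b) = (-1) ^+ s *: sgn_vec k b.
Proof. by move=> bb; rewrite /sgn_vec alt_ord_act // linearZ. Qed.

Lemma hook_partial_tperm b t i j : bijb b ->
  hook_partial (permf (tperm (b i) (b j)) b) (rows t)
    = hook_partial b (rows (permf (tperm (leg ell i) (leg ell j)) t)).
Proof.
move=> /bijbP[bi _]; apply/ffunP => u; rewrite !ffunE.
case e : (leg_index _) => [l|] /=.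
  rewrite (leg_uniq e) -(inj_tperm _ _ _ (@leg_inj ell a)) leg_index_row /= ffunE.
  by rewrite -(inj_tperm _ _ _ bi).
rewrite tpermD; first by rewrite e.
  by apply: contra_eq_neq e => <-; rewrite leg_index_row.
by apply: contra_eq_neq e => <-; rewrite leg_index_row.
Qed.

Lemma leg_tperm_col i j : perm_on col (tperm (leg ell i) (leg ell j)).
Proof. by apply: tperm_perm_on; rewrite setU1r // mem_legs leg_index_row. Qed.

(* Permuting the values of b amounts to permuting the legs of the tableaux. *)
Lemma sum_partial_permf b1 psi (s : {perm X}) : bijb b1 ->
  \sum_(t : {ffun U -> C} | bijb t && (hook_partial (permf s b1) (rows t) == psi))
     hook_term k (permf s b1) t
  = \sum_(t : {ffun U -> C} | bijb t && (hook_partial b1 (rows t) == psi)) hook_term k b1 t.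
Proof.
move=> bb; pose F (s : {perm X}) := (-1) ^+ s *:
  \sum_(t : {ffun U -> C} | bijb t && (hook_partial (permf s b1) (rows t) == psi))
     hook_term k (permf s b1) t.
have aF (y : {perm X}) c d : c \in [set: X] -> d \in [set: X] -> c != d ->
    F (y * tperm c d)%g = - F y.
  move=> _ _ ncd; have by1 : bijb (permf y b1) by rewrite bijb_permf.
  have /bijbP[_ sy] := by1; have [i ei] := sy c; have [j ej] := sy d.
  rewrite /F odd_permM odd_tperm ncd addbT signrN scaleNr permfM; congr (- (_ *: _)).
  have tau_inj : injective (permf (tperm (leg ell i) (leg ell j)) : {ffun U -> C} -> _).
    by apply: can_inj (permf (tperm (leg ell i) (leg ell j))) _ => t;
      rewrite -permfM tperm2 permf1.
  rewrite [RHS](reindex_inj tau_inj) /=; apply: eq_big => t.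
    by rewrite bijb_permf -ei -ej hook_partial_tperm.
  move=> _; rewrite hook_term_col ?leg_tperm_col // /hook_term.
  rewrite sgn_vec_permf // (linZ (pure_linearl _)) !odd_tperm ncd; congr (_ *: _).
  congr (_ ^+ _); apply/esym/eqP; rewrite eqb1; apply: contraNneq ncd => /(@leg_inj ell a) ij.
  by rewrite -ei -ej ij.
have := antisym_perm aF 1%g (x := s); rewrite mul1g => /(_ _).
rewrite /F permf1 odd_perm1 scale1r => e.
have {}e := e (introT subsetP (fun c _ => in_setT c)).
have := congr1 (fun v => (-1) ^+ s *: v) e.
by rewrite !scalerA -expr2 sqrr_sign !scale1r.
Qed.

Lemma hook_map_at_bas b1 t1 : bijb b1 -> bijb t1 ->
  hook_map_at a (day_bas (hook_partial b1 (rows t1)))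
    = #|{perm X}|%:R *: \sum_(z | perm_on row z) hook_term k b1 (permf z t1).
Proof.
move=> bb bt; rewrite /hook_map_at (big_permf _ bb) scaler_nat -sumr_const.
apply: eq_bigr => s _; rewrite -(sum_partial_eq bb bt) -(sum_partial_permf _ s bb).
rewrite [RHS]big_mkcondr /=; apply: eq_bigr => t btt.
rewrite dcoef_day_bas; last by apply: hook_partial_onto; rewrite ?bijb_permf.
by case: ifP; rewrite ?scale1r ?scale0r.
Qed.

(** The map back. The sign and Specht modules are subspaces of the spans of orderings and of
    tabloids, and a pair (ordering, tabloid) gives a partial bijection by [hook_partial]. *)
Definition hook_lift (A : tens (sgn_mod k a X) (specht_mod k (hook ell a) U)) :
    dayval k ell X U :=
  tens_lift (fun (v : sgn_mod k a X) (w : specht_mod k (hook ell a) U) =>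
    lext (fun c => lext (fun r => day_bas (hook_partial c r)) (vsval w)) (vsval v)) A.

Lemma hook_lift_linear : linear hook_lift.
Proof. exact: tens_lift_linear. Qed.

Lemma hook_lift_term b t : bijb b -> bijb t ->
  hook_lift (hook_term k b t) = \sum_(s : 'S_a) (-1) ^+ s *:
    \sum_(x | perm_on col x) (-1) ^+ x *:
      day_bas (hook_partial [ffun i => b (s i)] (rows (permf x t))).
Proof.
move=> bb bt; rewrite /hook_lift tens_liftE => [|w c v v'|v]; last first.
- have lv := @lext_linear2 _ _ _ _ (fun c w =>
    lext (fun r => day_bas (hook_partial c r)) w) _ (vsval v).
  move=> c w w'; rewrite linearP; apply: lv => h; exact: lext_linear.
- by rewrite linearP; exact: lext_linear.
rewrite sgn_vecE // specht_vecE // /alt_ord (lin_sumZ (lext_linear _)).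
apply: eq_bigr => s _; congr (_ *: _); rewrite lext_bas /polytabloid.
rewrite (lin_sumZ (lext_linear _)); apply: eq_big => [x|x _].
  by rewrite (col_stab_hook ell_gt0).
rewrite lext_bas; congr (_ *: day_bas (hook_partial _ _)).
by apply/ffunP => u; rewrite !ffunE.
Qed.

(** The factors count the orderings summed over in [hook_map_at], the terms of [alt_ord], and the
    quasi-idempotence of the Young symmetrizer. *)
Definition hook_scale : nat := (#|{perm X}| * #|'S_a| * hook_const corner legs)%N.

Lemma hook_scale_neq0 : hook_scale%:R != 0 :> k.
Proof.
apply: natr_neq0 => //; rewrite /hook_scale muln_gt0 hook_const_gt0 andbT muln_gt0.
by apply/andP; split; apply/card_gt0P; exists 1%g.
Qed.

Lemma bijb_precomp b (s : 'S_a) : bijb b -> bijb [ffun i => b (s i)].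
Proof.
move=> /bijbP[bi bs]; apply/bijbP; split=> [i j|y].
  by rewrite !ffunE => /bi/perm_inj.
by have [i <-] := bs y; exists (s^-1%g i); rewrite ffunE permKV.
Qed.

Lemma hook_map_lift_term b t : bijb b -> bijb t ->
  hook_map_at a (hook_lift (hook_term k b t)) = hook_scale%:R *: hook_term k b t.
Proof.
move=> bb bt; have lin := @hook_map_at_linear k ell a X U.
rewrite hook_lift_term // (lin_sumZ lin).
have e (s : 'S_a) : hook_map_at a (\sum_(x | perm_on col x) (-1) ^+ x *:
      day_bas (hook_partial [ffun i => b (s i)] (rows (permf x t))))
    = (-1) ^+ s *: (#|{perm X}|%:R *: ((hook_const corner legs)%:R *: hook_term k b t)).
  rewrite (lin_sumZ lin) -hook_term_row_col exchange_big !scaler_sumr /=.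
  apply: eq_bigr => x _; rewrite hook_map_at_bas ?bijb_permf ?bijb_precomp //.
  rewrite (eq_bigr (fun z => (-1) ^+ s *: hook_term k b (permf z (permf x t)))).
    rewrite -!scaler_sumr !scalerA; congr (_ *: _).
    by rewrite [LHS]mulrC [in LHS](mulrC (_ ^+ x)).
  by move=> z _; rewrite /hook_term /sgn_vec alt_ord_perm linearZ (linZ (pure_linearl _)).
transitivity (\sum_(s : 'S_a)
    #|{perm X}|%:R *: ((hook_const corner legs)%:R *: hook_term k b t)).
  by apply: eq_bigr => s _; rewrite (e s) [LHS]scalerA -expr2 sqrr_sign scale1r.
rewrite sumr_const -scaler_nat /hook_scale !natrM !scalerA; congr (_ * _ *: _).
by rewrite mulrC.
Qed.

End Coordinates.

Lemma hook_term_ext (Z : lmodType k)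
    (F G : tens (sgn_mod k a X) (specht_mod k (hook ell a) U) -> Z) :
  linear F -> linear G ->
  (forall b t, bijb b -> bijb t -> F (hook_term k b t) = G (hook_term k b t)) ->
  forall A, F A = G A.
Proof.
move=> linF linG e; apply: tens_ext => // v w.
have [c ec] := span_imageP (subvsP v); have [d ed] := span_imageP (subvsP w).
have -> : v = \sum_(b | bijb b) c b *: sgn_vec k b.
  by rewrite -[LHS]vsvalK ec linear_sum; apply: eq_bigr => b _; rewrite linearZ.
have -> : w = \sum_(t | bijb t) d t *: specht_vec k t.
  by rewrite -[LHS]vsvalK ed linear_sum; apply: eq_bigr => t _; rewrite linearZ.
rewrite (lin_sumZ (pure_linearl _)) !(lin_sumZ linF) !(lin_sumZ linG).
apply: eq_bigr => b bb; congr (_ *: _).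
rewrite (lin_sumZ (pure_linearr _)) (lin_sumZ linF) (lin_sumZ linG).
by apply: eq_bigr => t bt; rewrite e.
Qed.

End Fixed.
End Tableaux.

(** * The cokernel of theta *)

Section Cokernel.
Variables (k : fieldType) (ell : nat) (X U : finType).
Hypothesis ell_gt0 : (0 < ell)%N.
Hypothesis eU : #|U| = (ell + #|X|)%N.
Variables (Z : lmodType k) (q : dayval k ell X U -> Z).
Hypothesis linq : linear q.
Hypothesis q_theta : forall x : FStm k ell%:Z U X, q (theta_pre x) = 0.
Implicit Types (phi psi : {ffun U -> option X}) (x y : X) (u v w : U).

(** The class of the partial bijection phi modulo the image of theta, or under any other linear map
    q that kills this image. *)
Let lam phi : Z := q (day_bas k eU phi).

Let lam0 phi : ~~ onto_partial ell phi -> lam phi = 0.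
Proof. by move=> nphi; rewrite /lam day_bas0 // (lin0 linq). Qed.

(** By [FS0_small] every surjection lies in kFS^ell(U, X), and theta sends it to the sum of its
    sections, which are the onto partial maps contained in it. *)
Let lam_sub (f : {ffun U -> X}) : surjb f ->
  \sum_(psi | onto_partial ell psi && sub_partial psi f) lam psi = 0.
Proof.
move=> sf; pose g : surj U X := exist _ f sf.
have gF : bas k g \in FSt k ell%:Z U X by apply: FSt_cosub => S; exact: FS0_small.
rewrite -[RHS](q_theta (Subm gF)) [theta_pre _](day_basE eU) (lin_sumZ linq).
rewrite big_mkcond /=; apply: eq_bigr => psi _.
have [hpsi|npsi] := boolP (onto_partial ell psi); last by rewrite day_bas0 ?(lin0 linq) ?scaler0.
rewrite dcoef_theta //= big_mkcond (bigD1 g) //= big1 ?addr0 => [|h nh].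
  by rewrite ffunE eqxx; case: ifP; rewrite ?scale1r ?scale0r.
by rewrite ffunE (negPf nh) if_same.
Qed.

(** The family has to list all sections of f; it may contain other partial maps inside f, since
    [lam] is 0 on those. *)
Let lam_family (f : {ffun U -> X}) (I : finType) (P : pred I)
    (F : I -> {ffun U -> option X}) :
  surjb f -> {in P &, injective F} -> (forall i, P i -> sub_partial (F i) f) ->
  (forall psi, onto_partial ell psi -> sub_partial psi f -> exists2 i, P i & psi = F i) ->
  \sum_(i | P i) lam (F i) = 0.
Proof.
move=> sf injF subF hF; rewrite -[RHS](lam_sub sf) -(big_imset lam injF) /=.
rewrite (bigID (fun psi => onto_partial ell psi)) /= [X in _ + X]big1 ?addr0;
  last by move=> psi /andP[_ /lam0].
apply: eq_bigl => psi; rewrite andbC; apply: andb_id2l => hpsi.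
apply/imsetP/idP => [[i Pi ->]|sub]; first exact: subF.
by have [i Pi e] := hF _ hpsi sub; exists i.
Qed.

Lemma sub_partialE phi (f : {ffun U -> X}) u x : sub_partial phi f -> phi u = Some x -> f u = x.
Proof. by move=> /forallP/(_ u) => h e; move: h; rewrite e => /eqP[]. Qed.

(** The relation of the surjection that sends all undefined points of phi to x: its other fibres are
    single points, so a section is a choice of u over x. *)
Let lam_fill phi w x : onto_partial ell phi -> phi w = Some x ->
  \sum_(u in w |: undef phi) lam (upd (upd phi w None) u (Some x)) = 0.
Proof.
move=> hphi ew; pose f : {ffun U -> X} := [ffun u => odflt x (phi u)].
have inj := onto_partial_inj eU hphi; have /andP[_ /eqP iphi] := hphi.
apply: (@lam_family f _ (mem (w |: undef phi)) (fun u => upd (upd phi w None) u (Some x))).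
- apply/surjbP => y; have /pimgP[u eu] : y \in pimg phi by rewrite iphi.
  by exists u; rewrite ffunE eu.
- move=> u v _ _ /ffunP/(_ u); rewrite !updE eqxx; case: eqP => // _.
  by case: eqP => // nuw /esym eu; case: nuw; apply: inj eu ew.
- move=> u; rewrite inE => hu; apply/forallP => v; rewrite !updE !ffunE.
  have [->|_] := eqVneq v u.
    by move: hu; rewrite in_setU1 inE => /predU1P[->|/eqP->]; rewrite ?ew eqxx orbT.
  by case: (v == w) => //; case: (phi v) => //= y; rewrite eqxx orbT.
move=> psi hpsi sub; have /andP[_ /eqP ipsi] := hpsi.
have injpsi := onto_partial_inj eU hpsi.
have /pimgP[u eu] : x \in pimg psi by rewrite ipsi.
have phi_of v z : psi v = Some z -> z != x -> phi v = Some z.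
  move=> ev nz; have := sub_partialE sub ev; rewrite ffunE; case: (phi v) => [z'|] /=.
    by move=> ->.
  by move=> e; rewrite e eqxx in nz.
exists u.
  rewrite inE in_setU1 inE; have := sub_partialE sub eu; rewrite ffunE.
  case e : (phi u) => [y|]; rewrite ?eqxx ?orbT //= => ey.
  by rewrite (inj u w x) ?eqxx // e ey.
apply/ffunP => v; rewrite !updE; have [->//|nvu] := eqVneq v u.
case ev : (psi v) => [z|].
  have nz : z != x by apply: contra_neq nvu => ezx; apply: injpsi ev _; rewrite ezx.
  have evp := phi_of _ _ ev nz.
  by case: eqP => // evw; rewrite evw ew in evp; case: evp nz => ->; rewrite eqxx.
have [//|nvw] := eqVneq v w; case evp : (phi v) => [z|] //.
have /pimgP[v' ev'] : z \in pimg psi by rewrite ipsi.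
have nz : z != x by apply: contra_neq nvw => ezx; apply: inj evp _; rewrite ezx.
by have := inj _ _ _ (phi_of _ _ ev' nz) evp => evv; rewrite evv ev in ev'.
Qed.

(** The relation of the surjection with fibre {p, w} over x, the undefined points of phi over y, and
    single points elsewhere; a section chooses i over x and r over y. *)
Let lam_pair phi p w x y : onto_partial ell phi -> phi p = Some x -> phi w = Some y ->
  x != y ->
  \sum_(i in [set p; w]) \sum_(r in undef phi)
    lam (upd (upd (upd (upd phi p None) w None) i (Some x)) r (Some y)) = 0.
Proof.
move=> hphi ep ew nxy; pose f : {ffun U -> X} := [ffun u => if u == w then x else odflt y (phi u)].
have inj := onto_partial_inj eU hphi; have /andP[/eqP uphi /eqP iphi] := hphi.
have npw : p != w by apply: contra_neq nxy => epw; move: ep; rewrite epw ew => -[].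
set phi0 := upd _ w None.
have phi0E v : phi0 v = if (v == p) || (v == w) then None else phi v.
  by rewrite !updE; case: (v == w); rewrite ?orbT ?orbF.
clearbody phi0.
have pwN i : i \in [set p; w] -> phi i != None.
  by rewrite !inE => /orP[]/eqP->; rewrite ?ep ?ew.
have phi0x v : phi0 v != Some x.
  rewrite phi0E; case: ifP => // /negbT; rewrite negb_or => /andP[nv _].
  by apply: contra_neq nv => ev; exact: inj ev ep.
have phi0y v : phi0 v != Some y.
  rewrite phi0E; case: ifP => // /negbT; rewrite negb_or => /andP[_ nv].
  by apply: contra_neq nv => ev; exact: inj ev ew.
pose P (i : U * U) := (i.1 \in [set p; w]) && (i.2 \in undef phi).
pose F (i : U * U) := upd (upd phi0 i.1 (Some x)) i.2 (Some y).
rewrite (pair_big_dep (mem [set p; w]) (fun _ r => r \in undef phi)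
  (fun i r => lam (F (i, r)))) /=.
have n12 i : P i -> i.1 != i.2.
  case/andP => /pwN h; rewrite inE => /eqP e; by apply: contra_neq h => ->.
apply: (@lam_family f _ P F).
(* The point w has moved from y to x, but y is still attained: there are ell > 0 undefined
   points. *)
- apply/surjbP => z; have [->|nz] := eqVneq z y.
    have /card_gt0P[r] : (0 < #|undef phi|)%N by rewrite uphi.
    rewrite inE => /eqP er; exists r; rewrite ffunE er.
    by case: eqP => // erw; rewrite erw ew in er.
  have /pimgP[u eu] : z \in pimg phi by rewrite iphi.
  exists u; rewrite ffunE eu; case: eqP => // euw.
  by rewrite euw ew in eu; case: eu nz => ->; rewrite eqxx.
- move=> i j Pi Pj /ffunP e; have e1 := e i.1; have e2 := e i.2.
  rewrite /F !updE eqxx (negPf (n12 _ Pi)) in e1; rewrite /F !updE eqxx in e2.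
  have eq1 : i.1 = j.1.
    move: e1; case: eqP => [_ [] exy|_]; first by rewrite exy eqxx in nxy.
    by case: eqP => // _ /esym/eqP; rewrite (negPf (phi0x _)).
  have eq2 : i.2 = j.2.
    move: e2; case: eqP => // _; case: eqP => [_ [] exy|_]; first by rewrite exy eqxx in nxy.
    by move=> /esym/eqP; rewrite (negPf (phi0y _)).
  by rewrite [i]surjective_pairing [j]surjective_pairing eq1 eq2.
- move=> i Pi; have /andP[P1] := Pi; rewrite inE => /eqP P2.
  apply/forallP => v; rewrite /F !updE ffunE.
  have [->|_] := eqVneq v i.2.
    have -> : (i.2 == w) = false by apply/eqP => e; rewrite e ew in P2.
    by rewrite P2 eqxx orbT.
  have [->|_] := eqVneq v i.1.
    by move: P1; rewrite !inE => /orP[]/eqP->; rewrite ?eqxx ?(negPf npw) ?ep /= ?eqxx ?orbT.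
  rewrite phi0E; case: (v == w); rewrite ?orbT ?orbF //.
  by case: (v == p) => //; case: (phi v) => //= z; rewrite eqxx orbT.
move=> psi hpsi sub; have /andP[_ /eqP ipsi] := hpsi.
have injpsi := onto_partial_inj eU hpsi.
have /pimgP[i ei] : x \in pimg psi by rewrite ipsi.
have /pimgP[r er] : y \in pimg psi by rewrite ipsi.
have phi_of v z : psi v = Some z -> z != x -> z != y -> phi v = Some z.
  move=> ev nzx nzy; have := sub_partialE sub ev; rewrite ffunE.
  case: eqP => [_ e|_]; first by rewrite e eqxx in nzx.
  by case: (phi v) => [z' /= ->|/= e] //; rewrite e eqxx in nzy.
exists (i, r).
  apply/andP; split=> /=; rewrite !inE.
    have := sub_partialE sub ei; rewrite ffunE; case: eqP => [|_]; first by rewrite orbT.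
    case e : (phi i) => [z|] /= ez; last by rewrite ez eqxx in nxy.
    by rewrite ez in e; rewrite (inj _ _ _ e ep) eqxx.
  have := sub_partialE sub er; rewrite ffunE; case: eqP => [_ ez|nrw].
    by rewrite ez eqxx in nxy.
  case e : (phi r) => [z|] //= ez; rewrite ez in e.
  by case: nrw; exact: inj e ew.
apply/ffunP => v; rewrite /F !updE /=; have [->//|nvr] := eqVneq v r.
have [->//|nvi] := eqVneq v i.
have nzx z : psi v = Some z -> z != x.
  by move=> ev; apply: contra_neq nvi => ez; apply: injpsi ev _; rewrite ez.
have nzy z : psi v = Some z -> z != y.
  by move=> ev; apply: contra_neq nvr => ez; apply: injpsi ev _; rewrite ez.
case ev : (psi v) => [z|].
  have evp := phi_of _ _ ev (nzx _ ev) (nzy _ ev).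
  rewrite phi0E; case: ifP => // /orP[]/eqP evq; rewrite evq in evp.
    by have := nzx _ ev; rewrite ep in evp; case: evp => ->; rewrite eqxx.
  by have := nzy _ ev; rewrite ew in evp; case: evp => ->; rewrite eqxx.
case e0 : (phi0 v) => [z|] //; have nx := phi0x v; have ny := phi0y v.
rewrite e0 in nx ny; have evp : phi v = Some z.
  by move: e0; rewrite phi0E; case: ifP.
have /pimgP[v' ev'] : z \in pimg psi by rewrite ipsi.
have evp' := phi_of _ _ ev' nx ny.
by rewrite (inj _ _ _ evp' evp) ev in ev'.
Qed.

Let onto_map_partial (s : {perm X}) phi :
  onto_partial ell (map_partial s phi) = onto_partial ell phi.
Proof.
congr (_ && _).
  by congr (#|pred_of_set _| == _); apply/setP => u; rewrite !inE ffunE; case: (phi u).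
apply/eqP/eqP => e; apply/setP => x; rewrite in_setT; apply/pimgP.
  have /pimgP[u] : s x \in pimg (map_partial s phi) by rewrite e.
  by rewrite ffunE; case eu : (phi u) => [y|] //= -[/perm_inj <-]; exists u.
have /pimgP[u eu] : s^-1%g x \in pimg phi by rewrite e.
by exists u; rewrite ffunE eu /= permKV.
Qed.

(** With phi p = x and phi w = y, fill y in phi and in its transform psi, which exchanges the values
    at p and w. The two relations add up to [lam phi + lam psi] plus exactly the sum that [lam_pair]
    shows to be 0. *)
Let lam_tperm phi x y : x != y -> lam (map_partial (tperm x y) phi) = - lam phi.
Proof.
move=> nxy; have [hphi|nphi] := boolP (onto_partial ell phi); last first.
  by rewrite !lam0 ?oppr0 // onto_map_partial.
have inj := onto_partial_inj eU hphi; have /andP[_ /eqP iphi] := hphi.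
have /pimgP[p ep] : x \in pimg phi by rewrite iphi.
have /pimgP[w ew] : y \in pimg phi by rewrite iphi.
have npw : p != w by apply: contra_neq nxy => epw; move: ep; rewrite epw ew => -[].
have nwp : w != p by rewrite eq_sym.
pose psi := map_partial (tperm x y) phi.
have hpsi : onto_partial ell psi by rewrite onto_map_partial.
have epp : psi p = Some y by rewrite ffunE ep /= tpermL.
have eww : psi w = Some x by rewrite ffunE ew /= tpermR.
have epsi v : v != p -> v != w -> psi v = phi v.
  move=> nvp nvw; rewrite ffunE; case ev : (phi v) => [z|] //=.
  rewrite tpermD //; [apply: contra_neq nvp => e|apply: contra_neq nvw => e];
    by rewrite -e in ev; apply: inj ev _.
pose phi0 := upd (upd phi p None) w None.
pose lam2 i j := lam (upd (upd phi0 i (Some x)) j (Some y)).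
have undef_psi : undef psi = undef phi.
  by apply/setP => v; rewrite !inE ffunE; case: (phi v).
have wN : w \notin undef phi by rewrite inE ew.
have pN : p \notin undef phi by rewrite inE ep.
have e1 : lam phi + \sum_(r in undef phi) lam2 p r = 0.
  rewrite -[RHS](lam_fill hphi ew) big_setU1 //=; congr (_ + _).
    by rewrite upd_same -ew upd_id.
  apply: eq_bigr => r _; rewrite /lam2 /phi0; congr (lam (upd _ _ _)).
  by rewrite (updC _ _ _ npw) upd_same -ep -(updC _ _ _ npw) upd_id.
have e2 : lam psi + \sum_(r in undef phi) lam2 w r = 0.
  rewrite -[RHS](lam_fill hpsi epp) undef_psi big_setU1 //=; congr (_ + _).
    by rewrite upd_same -epp upd_id.
  apply: eq_bigr => r _; rewrite /lam2 /phi0; congr (lam (upd _ _ _)).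
  rewrite upd_same; apply/ffunP => v; rewrite !updE.
  have [->|nvw] := eqVneq v w; first by rewrite (negPf nwp) eww.
  by have [//|nvp] := eqVneq v p; rewrite epsi.
have := lam_pair hphi ep ew nxy; rewrite big_setU1 ?inE //= big_set1 => e3.
apply/eqP; rewrite -addr_eq0 -/psi addrC -[X in X == _]addr0 -[X in _ + X]e3.
by rewrite addrACA e1 e2 addr0.
Qed.

Section Bas.
Variable a : nat.
Local Notation C := (cell (hook ell a)).
Local Notation corner := (corner a ell_gt0).
Local Notation legs := (legs ell a).
Local Notation col := (corner |: legs).
Local Notation row := (corner |: ~: (corner |: legs)).
Implicit Types (t : {ffun U -> C}) (b : {ffun 'I_a -> X}).

Let hook_partial_permf b (s : {perm X}) (r : {ffun U -> 'I_(size (hook ell a))}) :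
  hook_partial (permf s b) r = map_partial s (hook_partial b r).
Proof. by apply/ffunP => u; rewrite !ffunE; case: (leg_index _) => //= i; rewrite ffunE. Qed.

(** An instance of [row_col_row]: row invariance holds since partial maps only see rows,
    antisymmetry in the legs is [lam_tperm], and [A_sum] is [lam_fill], the undefined points being
    the entries of the first row. *)
Let lam_row_col b t : bijb b -> bijb t ->
  \sum_(z | perm_on row z) \sum_(x | perm_on col x)
      (-1) ^+ x *: lam (hook_partial b (rows (permf x (permf z t))))
    = (hook_const corner legs)%:R *: lam (hook_partial b (rows t)).
Proof.
move=> bb bt; pose A (y : {perm C}) := lam (hook_partial b (rows (permf y t))).
have A_row (y x : {perm C}) : perm_on row x -> A (y * x)%g = A y.
  by move=> xrow; rewrite /A permfM rows_permf_row.
have A_D (y : {perm C}) c d : c \in legs -> d \in legs -> c != d ->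
    A (y * tperm c d)%g = - A y.
  move=> /imsetP[i _ ->] /imsetP[j _ ->] nij; rewrite /A permfM.
  rewrite -hook_partial_tperm // hook_partial_permf lam_tperm //.
  have /bijbP[bi _] := bb; by rewrite (inj_eq bi); apply: contraNneq nij => ->.
have A_sum (y : {perm C}) d : d \in legs ->
    A y + \sum_(c in row) A (y * tperm c d)%g = 0.
  move=> /imsetP[i _ ->]; pose ty := permf y t.
  have bty : bijb ty by rewrite bijb_permf.
  have /bijbP[ti ts] := bty; have [w ew] := ts (leg ell i).
  pose phi := hook_partial b (rows ty).
  have ephi : phi w = Some (b i) by rewrite 2!ffunE ew leg_index_row.
  have hphi : onto_partial ell phi by exact: hook_partial_onto.
  have wN : w \notin undef phi by rewrite inE ephi.
  rewrite -[RHS](lam_fill hphi ephi) [RHS]big_setU1 //= upd_same -ephi upd_id; congr (_ + _).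
  have erow : row = [set ty u | u in undef phi].
    apply/setP => c; rewrite mem_hook_row mem_legs negbK; apply/eqP/imsetP.
      have [u <-] := ts c => e; exists u => //.
      by rewrite inE 2!ffunE e.
    case=> u; rewrite inE => hu ->; move: hu; rewrite 2!ffunE.
    by case: (leg_index _).
  rewrite erow (big_imset _ (in2W ti)) /=; apply: eq_bigr => u uN.
  rewrite /A permfM -/ty; congr lam; apply/ffunP => v; rewrite !updE ephi.
  rewrite [LHS]ffunE [rows _ v]ffunE [permf _ _ v]ffunE.
  have tuN : leg_index (cell_row (ty u)) = None.
    by move: uN; rewrite inE 2!ffunE; case: (leg_index _).
  have [->|nvu] := eqVneq v u; first by rewrite tpermL leg_index_row.
  have [->|nvw] := eqVneq v w; first by rewrite ew tpermR tuN.
  have nul : leg ell i != ty v by rewrite -ew (inj_eq ti) eq_sym.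
  have nuv : ty u != ty v by rewrite (inj_eq ti) eq_sym.
  by rewrite tpermD // [RHS]ffunE [rows _ _]ffunE.
have := row_col_row (corner_legs a ell_gt0) A_row A_D A_sum 1%g.
rewrite /A permf1 => <-; apply: eq_bigr => z _; apply: eq_bigr => x _.
by rewrite mul1g permfM.
Qed.

Let lam_alt b (r : {ffun U -> 'I_(size (hook ell a))}) : bijb b ->
  \sum_(s : 'S_a) (-1) ^+ s *: lam (hook_partial [ffun i => b (s i)] r)
    = #|'S_a|%:R *: lam (hook_partial b r).
Proof.
move=> /bijbP[bi _]; pose F (s : 'S_a) := lam (hook_partial [ffun i => b (s i)] r).
have aF (y : 'S_a) (c d : 'I_a) : c \in [set: 'I_a] -> d \in [set: 'I_a] -> c != d ->
    F (y * tperm c d)%g = - F y.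
  move=> _ _ ncd; have nbcd : b c != b d by rewrite (inj_eq bi).
  rewrite /F -(lam_tperm _ nbcd).
  rewrite -hook_partial_permf; congr (lam (hook_partial _ r)).
  by apply/ffunP => i; rewrite !ffunE permM (inj_tperm _ _ _ bi).
have e (s : 'S_a) : perm_on [set: 'I_a] s by apply/subsetP => i _; rewrite in_setT.
have F1 : F 1%g = lam (hook_partial b r).
  by congr (lam (hook_partial _ r)); apply/ffunP => i; rewrite ffunE perm1.
rewrite -F1 scaler_nat -sumr_const; apply: eq_bigr => s _.
have := antisym_perm aF 1%g (e s); rewrite mul1g => Fs.
by rewrite -/(F s) Fs scalerA -expr2 sqrr_sign scale1r.
Qed.

Lemma hook_lift_term_coker b t : bijb b -> bijb t ->
  q (hook_lift eU (hook_term k b t)) = #|'S_a|%:R *: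
    \sum_(x | perm_on col x) (-1) ^+ x *: lam (hook_partial b (rows (permf x t))).
Proof.
move=> bb bt; rewrite (hook_lift_term k ell_gt0) // (lin_sumZ linq).
transitivity (\sum_(x | perm_on col x) (-1) ^+ x *: \sum_(s : 'S_a)
    (-1) ^+ s *: lam (hook_partial [ffun i => b (s i)] (rows (permf x t)))).
  under [RHS]eq_bigr do rewrite scaler_sumr.
  rewrite [RHS]exchange_big; apply: eq_bigr => s _; rewrite (lin_sumZ linq) scaler_sumr.
  by apply: eq_bigr => x _; rewrite !scalerA mulrC.
rewrite scaler_sumr; apply: eq_bigr => x _.
by rewrite lam_alt // !scalerA mulrC.
Qed.

Lemma hook_partial_surj b phi : bijb b -> onto_partial ell phi ->
  exists2 t : {ffun U -> C}, bijb t & hook_partial b (rows t) = phi.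
Proof.
move=> bb hphi; have [r rK bK] := bij_inv (exist _ b bb : bij 'I_a X).
have inj := onto_partial_inj eU hphi; have /andP[/eqP uphi /eqP iphi] := hphi.
have cX : a = #|X| by rewrite -(bijb_card bb) card_ord.
have crow : #|~: legs| = ell.
  apply/eqP; rewrite -(eqn_add2l #|legs|) cardsC card_hook // card_imset; last exact: leg_inj.
  by rewrite card_ord addnC.
(* The ell undefined points fill the first row in enumeration order; their indices are below ell, so
   the default [corner] is never reached. *)
pose t : {ffun U -> C} := [ffun u => if phi u is Some x then leg ell (r x)
  else nth corner (enum (~: legs)) (index u (enum (undef phi)))].
have tN u : phi u = None -> t u \notin legs.
  move=> eu; rewrite -in_setC -mem_enum ffunE eu mem_nth // -cardE crow -uphi cardE.
  by rewrite index_mem mem_enum inE eu.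
have tS u x : phi u = Some x -> t u = leg ell (r x) by move=> eu; rewrite ffunE eu.
have tl u x : phi u = Some x -> t u \in legs by move=> /tS->; rewrite imset_f.
have ti : injective t.
  move=> u v e; case eu : (phi u) => [x|]; case ev : (phi v) => [y|].
  - move: e; rewrite (tS _ _ eu) (tS _ _ ev) => /leg_inj/(can_inj rK) exy.
    by rewrite exy in eu; exact: inj eu ev.
  - by have := tN _ ev; rewrite -e (tl _ _ eu).
  - by have := tN _ eu; rewrite e (tl _ _ ev).
  move/eqP: e; rewrite !ffunE eu ev nth_uniq ?enum_uniq //.
  - by move=> /eqP/(index_inj u); apply; rewrite mem_enum inE ?eu ?ev.
  - by rewrite -cardE crow -uphi cardE index_mem mem_enum inE eu.
  - by rewrite -cardE crow -uphi cardE index_mem mem_enum inE ev.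
exists t.
  apply/bijbP; split=> // c; have [g gK tK] : bijective t.
    by apply: inj_card_bij => //; rewrite card_hook // eU cX.
  by exists (g c).
apply/ffunP => u; rewrite 2!ffunE; case eu : (phi u) => [x|].
  by rewrite (tS _ _ eu) leg_index_row /=; congr Some; exact: rK.
by have := tN _ eu; rewrite mem_legs negbK => /eqP->.
Qed.

(** One ordering b is enough: by [hook_partial_surj] all basis vectors come from b by varying the
    tableau, and [lam_row_col] computes the composite on them. *)
Lemma hook_lift_map_coker (m : dayval k ell X U) : a = #|X| ->
  q (hook_lift eU (hook_map_at a m)) = (hook_scale ell_gt0 a X)%:R *: q m.
Proof.
move=> ea; pose b : {ffun 'I_a -> X} := [ffun i => enum_val (cast_ord ea i)].
have bb : bijb b.
  apply/bijbP; split=> [i j|x]; first by rewrite !ffunE => /enum_val_inj/cast_ord_inj.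
  by exists (cast_ord (esym ea) (enum_rank x)); rewrite ffunE cast_ordKV enum_rankK.
have linh := @hook_map_at_linear k ell a X U.
have linl := @hook_lift_linear k ell a X U eU.
rewrite (day_basE eU m) (lin_sumZ linh) (lin_sumZ linl) !(lin_sumZ linq) scaler_sumr.
apply: eq_bigr => phi _; rewrite [RHS]scalerA mulrC -scalerA.
have [hphi|nphi] := boolP (onto_partial ell phi); last by rewrite dcoef0 // !scale0r.
have [t bt <-] := hook_partial_surj bb hphi; congr (_ *: _).
rewrite (hook_map_at_bas k ell_gt0) // (linZ linl) (linZ linq).
rewrite (lin_sum _ _ _ linl) (lin_sum _ _ _ linq).
rewrite /hook_scale -mulnA natrM -scalerA natrM -[in RHS]scalerA; congr (_ *: _).
rewrite -lam_row_col // scaler_sumr; apply: eq_bigr => z _.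
by rewrite hook_lift_term_coker // bijb_permf.
Qed.

End Bas.
End Cokernel.

(** * Exactness at each object *)

Section ThetaImage.
Variables (k : fieldType) (ell : nat) (X U : finType).

Definition theta_im : {pred dayval k ell X U} :=
  fun m => `[< exists x, @theta_pre k ell X U x = m >].

Fact theta_im_closed : submod_closed theta_im.
Proof.
split=> [|c m n /asboolP[x <-] /asboolP[y <-]]; apply/asboolP.
  by exists 0; exact: lin0 (@theta_pre_linear k ell X U).
by exists (c *: x + y); exact: theta_pre_linear.
Qed.

HB.instance Definition _ :=
  GRing.isSubmodClosed.Build k (dayval k ell X U) theta_im theta_im_closed.

End ThetaImage.

Section Exactness.
Variables (k : fieldType) (ell : nat) (X U : finType).
Hypothesis char0 : [pchar k] =i pred0.
Hypothesis ell_gt0 : (0 < ell)%N.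

(** Off the diagonal there is no ordering of X by a elements or no tableau on U, so the spanning set
    is empty. *)
Lemma hook_term_eq0 a (A : tens (sgn_mod k a X) (specht_mod k (hook ell a) U)) :
  ~~ ((a == #|X|) && (#|U| == (ell + #|X|)%N)) -> A = 0.
Proof.
move=> nU; apply: (hook_term_ext (F := id) (G := fun=> 0)) => // [c B B'|b t bb bt].
  by rewrite scaler0 addr0.
case/negP: nU; rewrite -(bijb_card bb) card_ord eqxx (bijb_card bt).
by rewrite card_hook // eqxx.
Qed.

Lemma hook_map_onto (P : hook_sum k ell X U) : exists n, hook_map n = P.
Proof.
have [eU|nU] := eqVneq #|U| (ell + #|X|)%N; last first.
  exists 0; apply: dirsumP => a.
  by rewrite [LHS]hook_term_eq0 ?[RHS]hook_term_eq0 // negb_and nU orbT.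
pose c := (hook_scale ell_gt0 #|X| X)%:R : k.
have linh := @hook_map_at_linear k ell #|X| X U.
have linl := @hook_lift_linear k ell #|X| X U eU.
(* On the summand a = |X|, [hook_map_at] undoes [hook_lift] up to the scalar c, invertible in
   characteristic zero; the other summands are 0. *)
exists (c^-1 *: hook_lift eU (P #|X|)); apply: dirsumP => a.
have [->|na] := eqVneq a #|X|; last first.
  by rewrite [LHS]hook_term_eq0 ?[RHS]hook_term_eq0 // negb_and na.
change (hook_map_at #|X| (c^-1 *: hook_lift eU (P #|X|)) = P #|X|).
rewrite (linZ linh); move: (P #|X|); apply: hook_term_ext => // [d A B|b t bb bt].
  by rewrite linl linh scalerDr !scalerA mulrC.
rewrite (hook_map_lift_term ell_gt0 char0) // scalerA mulVf ?scale1r //.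
exact: hook_scale_neq0.
Qed.

Lemma hook_map_theta (x : FStm k ell%:Z U X) : hook_map (theta_pre x) = 0.
Proof. by apply: dirsumP => a; exact: hook_map_at_theta. Qed.

(** On the diagonal, lifting [hook_map n = 0] back gives a nonzero multiple of n modulo the image of
    theta, so n lies in that image. Off the diagonal theta is onto. *)
Lemma hook_map_ker (n : dayval k ell X U) :
  hook_map n = 0 -> exists x : FStm k ell%:Z U X, theta_pre x = n.
Proof.
have [eU|nU] := eqVneq #|U| (ell + #|X|)%N; last by move=> _; exact: theta_pre_surj.
move=> n0; pose q := quot_proj (@theta_im k ell X U).
have linq : linear q by exact: quot_proj_linear.
have q_theta (x : FStm k ell%:Z U X) : q (theta_pre x) = 0.
  by rewrite -(lin0 linq); apply/quot_projP; rewrite subr0; apply/asboolP; exists x.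
have := hook_lift_map_coker ell_gt0 eU linq q_theta n (erefl #|X|).
have -> : hook_map_at #|X| n = 0 by have := congr1 (fun d : hook_sum k ell X U => d #|X|) n0.
rewrite (lin0 (hook_lift_linear eU)) (lin0 linq) => /esym/eqP.
rewrite scaler_eq0 (negPf (hook_scale_neq0 _ char0 _ _)) /= -(lin0 linq) => /eqP/quot_projP.
by rewrite subr0 => /asboolP.
Qed.

End Exactness.

Theorem theorem1p3 (k : fieldType) (ell : nat) :
  ([pchar k]%R =i pred0) -> (0 < ell)%N ->
  exists p : bimodHom (day_mod k ell) (hook_coker k ell),
    short_exact (theta k ell) p.
Proof.
move=> char0 ell_gt0; exists (hook_hom k ell) => X U; split.
- exact: theta_inj.
- move=> n; split=> [/(hook_map_ker char0 ell_gt0)[x <-]|[m <-]].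
    by exists (quot_proj _ x); exact: theta_mapE.
  rewrite -[m]quot_reprK; have := hook_map_theta char0 ell_gt0 (quot_repr m).
  by rewrite -theta_mapE.
- exact: hook_map_onto.
Qed.
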